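(* Let $\Delta t>0$ and let $\ell(u,\rho,B)=\int_\Omega\left[\frac12\rho|u|^2-\epsilon(\rho)-\frac12|B|^2\right]dx$. Suppose that $u_k\in U_h^{\operatorname{grad}}$, $\rho_k\in F_h$, $B_k\in U_h^{\operatorname{div}}$ ($k=0,1,2,\dots$) are such that for each $k$ there exist $\theta\in F_h$ and $J,H,U,E,\alpha\in U_h^{\operatorname{curl}}$ (depending on $k$) with $$\begin{aligned} \left\langle \tfrac{\rho_{k+1}u_{k+1}-\rho_ku_k}{\Delta t},v\right\rangle+a\left((\rho u)_{k+1/2},u_{k+1/2},v\right)+b_h(\theta,\rho_{k+1/2},v)+\langle\alpha,v\rangle&=d(u_{k+1/2},v),&&\forall v\in U_h^{\operatorname{grad}},\\ \left\langle\tfrac{\rho_{k+1}-\rho_k}{\Delta t},\sigma\right\rangle+b_h(\sigma,\rho_{k+1/2},u_{k+1/2})&=0,&&\forall\sigma\in F_h,\\ \left\langle\tfrac{B_{k+1}-B_k}{\Delta t},C\right\rangle+\langle\operatorname{curl}E,C\rangle&=-\nu\langle\operatorname{curl}J,C\rangle,&&\forall C\in U_h^{\operatorname{div}},\\ \langle\theta,\tau\rangle&=\left\langle\tfrac12u_k\cdot u_{k+1}-\delta(\rho_k,\rho_{k+1}),\tau\right\rangle,&&\forall\tau\in F_h,\\ \langle J,K\rangle&=\langle B_{k+1/2},\operatorname{curl}K\rangle,&&\forall K\in U_h^{\operatorname{curl}},\\ \langle H,G\rangle&=\langle B_{k+1/2},G\rangle,&&\forall G\in U_h^{\operatorname{curl}},\\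 \langle U,V\rangle&=\langle u_{k+1/2},V\rangle,&&\forall V\in U_h^{\operatorname{curl}},\\ \langle E,F\rangle&=-\langle U\times H,F\rangle,&&\forall F\in U_h^{\operatorname{curl}},\\ \langle\alpha,\beta\rangle&=-\langle J\times H,\beta\rangle,&&\forall\beta\in U_h^{\operatorname{curl}}. \end{aligned}$$ Here $u_{k+1/2}=\frac{u_k+u_{k+1}}2$, $\rho_{k+1/2}=\frac{\rho_k+\rho_{k+1}}2$, $B_{k+1/2}=\frac{B_k+B_{k+1}}2$, $(\rho u)_{k+1/2}=\frac{\rho_ku_k+\rho_{k+1}u_{k+1}}2$, and $\delta(x,y)=\frac{\epsilon(y)-\epsilon(x)}{y-x}$. If $B_0$ is exactly divergence-free, then for all $k$: $$\begin{aligned} \operatorname{div}B_k&\equiv0,\\ \int_\Omega\rho_{k+1}\,dx&=\int_\Omega\rho_k\,dx,\\ \frac{\mathcal{E}_{k+1}-\mathcal{E}_k}{\Delta t}&=d(u_{k+1/2},u_{k+1/2})+e_h(B_{k+1/2},B_{k+1/2}),\\ \frac1{\Delta t}\left(\int_\Omega A_{k+1}\cdot B_{k+1}\,dx-\int_\Omega A_k\cdot B_k\,dx\right)&=2\,e_h(B_{k+1/2},\pi_h^{\operatorname{div}}A_{k+1/2}), \end{aligned}$$ where $\mathcal{E}_k=\langle\frac{\delta\ell}{\delta u_k},u_k\rangle-\ell(u_k,\rho_k,B_k)=\int_\Omega\left[\frac12\rho_k|u_k|^2+\epsilon(\rho_k)+\frac12|B_k|^2\right]dx$ is the total energy, $A_k$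 is any vector field satisfying $\operatorname{curl}A_k=B_k$ and $A_k\times n|_{\partial\Omega}=0$ (i.e. $A_k\in H_0(\operatorname{curl},\Omega)$ with $\operatorname{curl}A_k=B_k$), and $A_{k+1/2}=\frac{A_k+A_{k+1}}2$.
   Context: Let $d\in\{2,3\}$, let $\Omega\subset\mathbb{R}^d$ be a bounded domain with outward unit normal $n$ on $\partial\Omega$, and let $\mathcal{T}_h$ be a (conforming simplicial) triangulation of $\Omega$, belonging to a shape-regular family. $P_r(K)$ denotes polynomials of degree at most $r$ on a simplex $K$. $\langle\cdot,\cdot\rangle$ is the $L^2(\Omega)$ inner product (of scalar or vector fields). Fix integers $r,s\ge0$ and constants $\mu>0$, $\lambda$ with $2\mu+3\lambda\ge0$, and $\nu>0$. The energy density $\epsilon$ is a continuously differentiable real function on an interval containing all values taken by the densities $\rho_k$ on the closed simplices, and $\delta(x,x)$ is understood as $\epsilon'(x)$. Continuous spaces: $H_0^1(\Omega)$ is the usual space; $H_0(\operatorname{div},\Omega)=\{u\in L^2(\Omega)^d: \operatorname{div}u\in L^2,\ u\cdot n=0\text{ on }\partial\Omega\}$; for $d=3$, $H_0(\operatorname{curl},\Omega)=\{u\in L^2(\Omega)^3:\operatorname{curl}u\in L^2(\Omega)^3,\ u\times n=0\text{ on }\partial\Omega\}$. Finite element spaces: - $U_h^{\operatorname{grad}}=\{u\in H_0^1(\Omega)^d: u|_K\in P_{r+1}(K)^d\ \forall K\in\mathcal{T}_h\}$ (continuous Galerkin); - $U_h^{\operatorname{div}}=\{u\in H_0(\operatorname{div},\Omega):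 u|_K\in P_r(K)^d+xP_r(K)\ \forall K\}$ (Raviart-Thomas); - $F_h=\{f\in L^2(\Omega): f|_K\in P_s(K)\ \forall K\}$ (discontinuous Galerkin); - for $d=3$, $U_h^{\operatorname{curl}}=\{u\in H_0(\operatorname{curl},\Omega): u|_K\in P_r(K)^3+x\times P_r(K)^3\ \forall K\}$ (Nedelec, first kind). Convention for $d=2$: planar fields $(f_1,f_2)$ are identified with $(f_1,f_2,0)$ and scalars $g$ with the orthogonal fields $(0,0,g)$, and cross products and curls are the three-dimensional ones for fields independent of $x_3$. Elements of $U_h^{\operatorname{grad}},U_h^{\operatorname{div}}$ are planar. $U_h^{\operatorname{curl}}$ consists of fields whose planar part lies in $\{u\in L^2(\Omega)^2:\partial_{x_1}u_2-\partial_{x_2}u_1\in L^2,\ u_1n_2-u_2n_1=0\text{ on }\partial\Omega,\ u|_K\in P_r(K)^2+(x_2,-x_1)P_r(K)\ \forall K\}$ and whose orthogonal component lies in $\{g\in H_0^1(\Omega): g|_K\in P_{r+1}(K)\ \forall K\}$ (so automatically $H,U,\alpha$ are planar and $J,E$ are orthogonal to the plane); $H_0(\operatorname{curl},\Omega)$ likewise consists of fields with planar part in $L^2$ with $L^2$ scalar curl and zero tangential trace, and orthogonal component in $H^1_0(\Omega)$. $\pi_h^{\operatorname{div}}$ is the $L^2$-orthogonal projector onto $U_h^{\operatorname{div}}$. The map $\operatorname{curl}_h:U_h^{\operatorname{div}}\to U_h^{\operatorname{curl}}$ is defined by $\langle\operatorname{curl}_hu,v\rangle=\langle u,\operatorname{curl}v\rangle$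 for all $v\in U_h^{\operatorname{curl}}$. Let $\mathcal{E}_h$ be the set of interior $(d-1)$-dimensional faces. On $e=K_1\cap K_2\in\mathcal{E}_h$, for piecewise smooth scalar $f$ with $f_i=f|_{K_i}$, set $\llbracket f\rrbracket=f_1n_1+f_2n_2$ and $\{f\}=\frac{f_1+f_2}{2}$, where $n_1$ is the unit normal to $e$ pointing from $K_1$ to $K_2$ and $n_2=-n_1$. Forms: - $a(w,u,v)=-\int_\Omega w\cdot[u,v]\,dx$, with $[u,v]=u\cdot\nabla v-v\cdot\nabla u$; - $b_h(f,g,u)=-\sum_{K\in\mathcal{T}_h}\int_K(u\cdot\nabla f)g\,dx+\sum_{e\in\mathcal{E}_h}\int_e u\cdot\llbracket f\rrbracket\{g\}\,ds$ for $f,g\in F_h$ and $u\in U_h^{\operatorname{div}}$ or $U_h^{\operatorname{grad}}$; - $d(u,v)=-\int_\Omega[\mu\nabla u:\nabla v+(\lambda+\mu)\operatorname{div}u\operatorname{div}v]\,dx$; - $e_h(B,C)=-\nu\langle\operatorname{curl}_hB,\operatorname{curl}_hC\rangle$ for $B,C\in U_h^{\operatorname{div}}$. *)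

(* Defs.v *)
From HB Require Import structures.
From mathcomp Require Import all_boot all_order all_algebra.
From mathcomp Require Import all_classical all_reals all_analysis.

Set Implicit Arguments.
Unset Strict Implicit.
Unset Printing Implicit Defensive.

Import Order.TTheory GRing.Theory Num.Theory.
Import numFieldNormedType.Exports.

Local Open Scope classical_set_scope.
Local Open Scope ring_scope.

(* Lebesgue measure on ['rV[R]_n], the row vectors being given the product
   sigma-algebra (which is the Borel one). *)
Definition rV_display : measure_display. Proof. exact. Qed.

Definition rV_coord (R : realType) (n : nat) (i : 'I_n) (x : 'rV[R]_n) :
  measurableTypeR R := x 0 i.

HB.instance Definition _ (R : realType) (n : nat) :=
  @isMeasurable.Build rV_display 'rV[R]_n
    (g_sigma_preimage (@rV_coord R n))
    (@sigma_algebra0 _ _ _)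
    (fun A => @sigma_algebraC _ _ A)
    (fun F => @sigma_algebra_bigcup _ setT _ F).

Lemma measurable_rV_coord (R : realType) (n : nat) (i : 'I_n) :
  measurable_fun [set: 'rV[R]_n] (@rV_coord R n i).
Proof.
move=> _ Y mY; rewrite setTI; apply: sub_sigma_algebra => /=.
rewrite -bigcup_seq/=; exists i => /=; first by rewrite mem_index_enum.
by exists Y => //; rewrite setTI.
Qed.

Lemma measurable_fun_rVP (R : realType) (n : nat) d (T : measurableType d)
    (f : T -> 'rV[R]_n) :
  (forall i, measurable_fun setT (@rV_coord R n i \o f)) ->
  measurable_fun setT f.
Proof.
move=> mf _ A mA; rewrite setTI; move: A mA; apply: smallest_sub.
  split; rewrite /= ?preimage_set0//.
  - by move=> A mA; rewrite setTD -preimage_setC; exact: measurableC.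
  - by move=> F mF; rewrite preimage_bigcup; exact: bigcup_measurable.
move=> A; rewrite -bigcup_seq/= => -[i _ [B mB <-]].
by have := mf i measurableT B mB; rewrite !setTI.
Qed.

Definition rV_cons (R : realType) (n : nat) (p : measurableTypeR R * 'rV[R]_n) :
  'rV[R]_n.+1 := \row_i oapp (fun j => p.2 0 j) p.1 (unlift ord0 i).

Lemma measurable_rV_cons (R : realType) (n : nat) :
  measurable_fun setT (@rV_cons R n).
Proof.
apply: measurable_fun_rVP => i.
rewrite (_ : _ \o _ = fun p : measurableTypeR R * 'rV[R]_n =>
    oapp (fun j : 'I_n => p.2 0 j) p.1 (unlift ord0 i)).
  case: unliftP => [j _|_] /=; last exact: measurable_fst.
  exact: (measurableT_comp (measurable_rV_coord j) measurable_snd).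
by apply/funext => p; rewrite /rV_coord /= mxE.
Qed.

(* The library proves this too, but its canonical instance is shadowed by the
   one for products of subprobabilities. *)
Lemma sigma_finite_prod (R : realType) d1 d2 (T1 : measurableType d1)
    (T2 : measurableType d2) (m1 : {sigma_finite_measure set T1 -> \bar R})
    (m2 : {sigma_finite_measure set T2 -> \bar R}) :
  sigma_finite setT (m1 \x m2)%E.
Proof.
have /sigma_finiteP[F [TF ndF Foo]] := sigma_finiteT m1.
have /sigma_finiteP[G [TG ndG Goo]] := sigma_finiteT m2.
exists (fun n => F n `*` G n).
  rewrite -setXTT TF TG predeqE => -[x y]; split.
    move=> [/= [n _ Fnx] [k _ Gky]]; exists (maxn n k) => //; split.
    - by move: x Fnx; exact/subsetPset/ndF/leq_maxl.
    - by move: y Gky; exact/subsetPset/ndG/leq_maxr.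
  by move=> [n _ []/= ? ?]; split; exists n.
move=> k; have [? ?] := Foo k; have [? ?] := Goo k.
split; first exact: measurableX.
by rewrite product_measure1E// lte_mul_pinfty// ge0_fin_numE.
Qed.

Lemma rV_cons_sigma_finite (R : realType) (n : nat)
    (m1 : {sigma_finite_measure set (measurableTypeR R) -> \bar R})
    (m : {sigma_finite_measure set 'rV[R]_n -> \bar R}) :
  sigma_finite setT (pushforward (m1 \x m)%E (@rV_cons R n)).
Proof.
have [F TF Foo] := sigma_finite_prod m1 m.
pose unc (x : 'rV[R]_n.+1) : measurableTypeR R * 'rV[R]_n :=
  (x 0 ord0, \row_j x 0 (lift ord0 j)).
have uncK p : unc (rV_cons p) = p.
  case: p => a v; rewrite /unc /rV_cons mxE unlift_none; congr pair.
  by apply/rowP => j; rewrite !mxE liftK.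
have munc : measurable_fun setT unc.
  apply/measurable_fun_pairP; split; first exact: (measurable_rV_coord ord0).
  apply: measurable_fun_rVP => j; rewrite (_ : _ \o _ = rV_coord (lift ord0 j)).
    exact: measurable_rV_coord.
  by apply/funext => x; rewrite /rV_coord /= mxE.
exists (fun i => unc @^-1` F i).
  by rewrite -preimage_bigcup -TF preimage_setT.
move=> i; have [mF Fi] := Foo i; split.
  by rewrite -[X in measurable X]setTI; exact: munc.
rewrite /pushforward -comp_preimage.
by rewrite (_ : unc \o _ = id)//; apply/funext => p /=.
Qed.

Definition rV_measureM (R : realType) (n : nat)
    (m1 : {sigma_finite_measure set (measurableTypeR R) -> \bar R})
    (m : {sigma_finite_measure set 'rV[R]_n -> \bar R}) :
  set 'rV[R]_n.+1 -> \bar R :=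
  pushforward (m1 \x m)%E (@rV_cons R n).

HB.instance Definition _ (R : realType) (n : nat) m1 m :=
  Measure.copy (@rV_measureM R n m1 m)
    (measure_function_pushforward__canonical__measure_function_Measure
       (m1 \x m)%E (@measurable_rV_cons R n)).

HB.instance Definition _ (R : realType) (n : nat) m1 m :=
  @Measure_isSigmaFinite.Build _ _ _ (@rV_measureM R n m1 m)
    (rV_cons_sigma_finite m1 m).

Fixpoint lebesgue_rV (R : realType) (n : nat) :
    {sigma_finite_measure set 'rV[R]_n -> \bar R} :=
  if n is n'.+1 then rV_measureM (@lebesgue_measure R) (lebesgue_rV R n')
  else \d_(0 : 'rV[R]_0).

Lemma lebesgue_rV_box (R : realType) (n : nat)
    (A : 'I_n -> set (measurableTypeR R)) :
  (forall i, measurable (A i)) ->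
  lebesgue_rV R n [set x | forall i, A i (x 0 i)] =
  (\prod_(i < n) lebesgue_measure (A i))%E.
Proof.
elim: n A => [|n IHn] A mA.
  by rewrite big_ord0 /= diracE mem_set// => -[].
rewrite big_ord_recl -IHn; last by move=> i; exact: mA.
have mB : measurable [set x : 'rV[R]_n | forall i, A (lift ord0 i) (x 0 i)].
  rewrite (_ : [set x | _] =
      \bigcap_(i : 'I_n) (@rV_coord R n i @^-1` A (lift ord0 i))).
    apply: fin_bigcap_measurable => // i _.
    by rewrite -[X in measurable X]setTI; apply: measurable_rV_coord.
  by apply/seteqP; split => x /= Ax i; [move=> _|]; exact: Ax.
rewrite /= /rV_measureM /pushforward -product_measure1E//.
congr product_measure1; apply/seteqP; split => -[a v] /=.
- move=> h; split=> [|i /=].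
    by have := h ord0; rewrite mxE unlift_none.
  by have := h (lift ord0 i); rewrite mxE liftK.
- case=> /= Aa Av i; rewrite mxE.
  by case: unliftP => [j ->|->] /=; [exact: Av|].
Qed.

(* For d = 2 and for d = 3, vector fields on R^d have three components: a planar
   field has third component 0, an orthogonal one has first two components 0.
   A scalar or vector field is a function on all of R^d of which only the values
   in Omega matter. *)
Notation sfield R d := ('rV[R]_d -> R).
Notation vfield R d := ('rV[R]_d -> 'rV[R]_3).

Definition dot (R : realType) (m : nat) (a b : 'rV[R]_m) : R :=
  \sum_(i < m) a 0 i * b 0 i.

(* Indices are added modulo 3. *)
Definition cross (R : realType) (a b : 'rV[R]_3) : 'rV[R]_3 :=
  \row_i (a 0 (i + 1) * b 0 (i + 2%:R) - a 0 (i + 2%:R) * b 0 (i + 1)).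

Definition vcomp (R : realType) (d : nat) (i : 'I_3) (u : vfield R d) :
  sfield R d := fun x => u x 0 i.

Definition emb (R : realType) (d : nat) (x : 'rV[R]_d) : 'rV[R]_3 :=
  \row_(i < 3) oapp (fun j : 'I_d => x 0 j) 0 (insub (i : nat)).

Definition orth (R : realType) (g : R) : 'rV[R]_3 :=
  \row_(i < 3) (if i == ord_max then g else 0).

Definition planar_part (R : realType) (d : nat) (u : vfield R d) : vfield R d :=
  fun x => \row_(i < 3) (if i == ord_max then 0 else u x 0 i).

(* [pd i f] is the i-th partial derivative of f, and 0 if [d <= i]. *)
Definition pd (R : realType) (d : nat) (i : 'I_3) (f : sfield R d) :
  sfield R d :=
  fun x => oapp (fun j : 'I_d => 'D_(delta_mx 0 j) f x) 0 (insub (i : nat)).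

Definition grad (R : realType) (d : nat) (f : sfield R d) : vfield R d :=
  fun x => \row_i pd i f x.

Definition div (R : realType) (d : nat) (u : vfield R d) : sfield R d :=
  fun x => \sum_(i < 3) pd i (vcomp i u) x.

Definition curl (R : realType) (d : nat) (u : vfield R d) : vfield R d :=
  fun x => \row_i (pd (i + 1) (vcomp (i + 2%:R) u) x -
                   pd (i + 2%:R) (vcomp (i + 1) u) x).

Fixpoint Cn (R : realType) (d n : nat) (f : sfield R d) : Prop :=
  continuous f /\
  if n is n'.+1 then
    forall j : 'I_d, (forall x, derivable f x (delta_mx 0 j)) /\
      Cn n' (fun x => 'D_(delta_mx 0 j) f x)
  else True.

Definition smooth (R : realType) (d : nat) (f : sfield R d) : Prop :=
  forall n, Cn n f.

Definition vsmooth (R : realType) (d : nat) (u : vfield R d) : Prop :=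
  forall i, smooth (vcomp i u).

Definition test (R : realType) (d : nat) (Omega : set 'rV[R]_d)
    (f : sfield R d) : Prop :=
  [/\ smooth f, compact (closure [set x | f x != 0]) &
      closure [set x | f x != 0] `<=` Omega].

Definition vtest (R : realType) (d : nat) (Omega : set 'rV[R]_d)
    (u : vfield R d) : Prop :=
  forall i, test Omega (vcomp i u).

Definition L2 (R : realType) (d : nat) (Omega : set 'rV[R]_d)
    (f : sfield R d) : Prop :=
  measurable_fun Omega f /\
  (lebesgue_rV R d).-integrable Omega (fun x => (f x ^+ 2)%:E).

Definition vL2 (R : realType) (d : nat) (Omega : set 'rV[R]_d)
    (u : vfield R d) : Prop :=
  forall i, L2 Omega (vcomp i u).

Definition ip (R : realType) (d : nat) (Omega : set 'rV[R]_d)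
    (f g : sfield R d) : R :=
  \int[lebesgue_rV R d]_(x in Omega) (f x * g x).

Definition vip (R : realType) (d : nat) (Omega : set 'rV[R]_d)
    (u v : vfield R d) : R :=
  \int[lebesgue_rV R d]_(x in Omega) dot (u x) (v x).

Definition weak_grad (R : realType) (d : nat) (Omega : set 'rV[R]_d)
    (f : sfield R d) (g : vfield R d) : Prop :=
  vL2 Omega g /\
  forall Phi, vtest Omega Phi -> vip Omega g Phi = - ip Omega f (div Phi).

Definition weak_div (R : realType) (d : nat) (Omega : set 'rV[R]_d)
    (u : vfield R d) (f : sfield R d) : Prop :=
  L2 Omega f /\
  forall phi, test Omega phi -> ip Omega f phi = - vip Omega u (grad phi).

Definition weak_curl (R : realType) (d : nat) (Omega : set 'rV[R]_d)
    (u w : vfield R d) : Prop :=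
  vL2 Omega w /\
  forall Phi, vtest Omega Phi -> vip Omega w Phi = vip Omega u (curl Phi).

(* Weak derivatives as functions: they are unique up to null sets, and are only
   used under integrals over Omega, for fields which have them. *)
Definition wgrad (R : realType) (d : nat) (Omega : set 'rV[R]_d)
    (f : sfield R d) : vfield R d :=
  xget (fun=> 0) [set g | weak_grad Omega f g].

Definition wdiv (R : realType) (d : nat) (Omega : set 'rV[R]_d)
    (u : vfield R d) : sfield R d :=
  xget (fun=> 0) [set f | weak_div Omega u f].

Definition wcurl (R : realType) (d : nat) (Omega : set 'rV[R]_d)
    (u : vfield R d) : vfield R d :=
  xget (fun=> 0) [set w | weak_curl Omega u w].

(* H^1_0 is the closure of the test functions in H^1. *)
Definition H10 (R : realType) (d : nat) (Omega : set 'rV[R]_d)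
    (f : sfield R d) : Prop :=
  L2 Omega f /\
  exists2 g, weak_grad Omega f g &
    forall e : R, 0 < e -> exists2 phi, test Omega phi &
      ip Omega (f \- phi) (f \- phi) +
      vip Omega (fun x => g x - grad phi x) (fun x => g x - grad phi x) < e.

(* The normal trace of u in H(div) is the functional sending the trace of phi to
   the integral of [u . grad phi + (div u) phi], for phi smooth up to the
   boundary; [u . n = 0] says that this functional is zero. *)
Definition H0div (R : realType) (d : nat) (Omega : set 'rV[R]_d)
    (u : vfield R d) : Prop :=
  vL2 Omega u /\
  exists2 f, weak_div Omega u f &
    forall phi, smooth phi -> vip Omega u (grad phi) + ip Omega f phi = 0.

(* Likewise [u x n] is the functional sending the trace of Phi to the integral of
   [u . curl Phi - (curl u) . Phi]. *)
Definition H0curl_trace (R : realType) (d : nat) (Omega : set 'rV[R]_d)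
    (u : vfield R d) : Prop :=
  vL2 Omega u /\
  exists2 w, weak_curl Omega u w &
    forall Phi, vsmooth Phi -> vip Omega u (curl Phi) - vip Omega w Phi = 0.

(* For a planar field with d = 2, [H0curl_trace] only involves the third
   component of curl u and of Phi. *)
Definition H0curl (R : realType) (d : nat) (Omega : set 'rV[R]_d)
    (u : vfield R d) : Prop :=
  if d == 2%N then
    H0curl_trace Omega (planar_part u) /\ H10 Omega (vcomp ord_max u)
  else H0curl_trace Omega u.

(* A d-simplex is given by its family of d + 1 vertices. *)
Notation simplex R d := ('I_d.+1 -> 'rV[R]_d).

Definition nondegenerate (R : realType) (d : nat) (K : simplex R d) : bool :=
  \matrix_(i < d) (K (lift ord0 i) - K ord0) \in unitmx.

Definition vertex_hull (R : realType) (d : nat) (K : simplex R d)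
    (A : pred 'I_d.+1) : set 'rV[R]_d :=
  [set x | exists c : 'I_d.+1 -> R,
    [/\ forall i, 0 <= c i, forall i, ~~ A i -> c i = 0,
        \sum_i c i = 1 & x = \sum_i c i *: K i]].

Definition closed_simplex (R : realType) (d : nat) (K : simplex R d) :
  set 'rV[R]_d := vertex_hull K xpredT.

Definition open_simplex (R : realType) (d : nat) (K : simplex R d) :
  set 'rV[R]_d :=
  [set x | exists c : 'I_d.+1 -> R,
    [/\ forall i, 0 < c i, \sum_i c i = 1 & x = \sum_i c i *: K i]].

Definition bounded_domain (R : realType) (d : nat) (Omega : set 'rV[R]_d) :
  Prop :=
  [/\ Omega !=set0, open Omega, connected Omega & bounded_set Omega].

Definition common_vertex (R : realType) (d : nat) (K L : simplex R d) :
  pred 'I_d.+1 := fun i => [exists j, K i == L j].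

Definition triangulation (R : realType) (d N : nat) (Omega : set 'rV[R]_d)
    (T : 'I_N -> simplex R d) : Prop :=
  [/\ forall k, nondegenerate (T k),
      Omega = interior (\bigcup_k closed_simplex (T k)),
      forall k l, k != l -> open_simplex (T k) `&` open_simplex (T l) = set0 &
      forall k l, k != l -> closed_simplex (T k) `&` closed_simplex (T l) =
        vertex_hull (T k) (common_vertex (T k) (T l))].

(* The value at a point x of the closed simplex K of the continuous extension of
   the restriction of f to the interior of K. *)
Definition trace_on (R : realType) (d : nat) (K : simplex R d)
    (f : sfield R d) : sfield R d :=
  fun x => lim (f y @[y --> within (open_simplex K) (nbhs x)]).

Definition vtrace_on (R : realType) (d : nat) (K : simplex R d)
    (u : vfield R d) : vfield R d :=
  fun x => \row_i trace_on K (vcomp i u) x.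

(* Below, "the face i of K" is the one opposite to the vertex K i. It is shared
   by K and L if all its vertices are vertices of L. *)
Definition shared_face (R : realType) (d : nat) (K L : simplex R d)
    (i : 'I_d.+1) : bool :=
  [forall j, (j != i) ==> common_vertex K L j].

Definition outward_normal (R : realType) (d : nat) (K : simplex R d)
    (i : 'I_d.+1) : 'rV[R]_d :=
  xget 0 [set n | [/\ dot n n = 1,
    forall j j', j != i -> j' != i -> dot n (K j - K j') = 0 &
    forall j, j != i -> dot n (K i - K j) < 0]].

Definition face_vertices (R : realType) (d : nat) (K : simplex R d)
    (i : 'I_d.+1) : seq 'rV[R]_d := [seq K j | j <- enum 'I_d.+1 & j != i].

Definition face_edge (R : realType) (d : nat) (K : simplex R d)
    (i : 'I_d.+1) (m : nat) : 'rV[R]_d :=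
  (face_vertices K i)`_m.+1 - (face_vertices K i)`_0.

Definition reference_simplex (R : realType) (m : nat) : set 'rV[R]_m :=
  [set t | (forall i, 0 <= t 0 i) /\ \sum_i t 0 i <= 1].

(* Surface integral over the face i of K, computed in the affine parametrization
   by the (d-1)-dimensional reference simplex. *)
Definition face_integral (R : realType) (d : nat) (K : simplex R d)
    (i : 'I_d.+1) (f : sfield R d) : R :=
  let G := \matrix_(m < d.-1) face_edge K i m in
  Num.sqrt (\det (G *m G^T)) *
  \int[lebesgue_rV R d.-1]_(t in @reference_simplex R d.-1)
     f ((face_vertices K i)`_0 + \sum_(m < d.-1) t 0 m *: face_edge K i m).

Definition poly_fun (R : realType) (d r : nat) (p : sfield R d) : Prop :=
  exists c : {ffun 'I_d -> 'I_r.+1} -> R, forall x,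
    p x = \sum_(al : {ffun 'I_d -> 'I_r.+1} | (\sum_i al i <= r)%N)
            c al * \prod_i x 0 i ^+ al i.

(* The space P_r^d: for d = 2, the third component is 0. *)
Definition poly_vec (R : realType) (d r : nat) (p : vfield R d) : Prop :=
  forall i : 'I_3, poly_fun r (vcomp i p) /\
    ((d <= i)%N -> forall x, p x 0 i = 0).

Definition U_grad (R : realType) (d N : nat) (Omega : set 'rV[R]_d)
    (T : 'I_N -> simplex R d) (r : nat) (u : vfield R d) : Prop :=
  (forall i, H10 Omega (vcomp i u)) /\
  forall k, exists2 p, poly_vec r.+1 p &
    forall x, open_simplex (T k) x -> u x = p x.

Definition U_div (R : realType) (d N : nat) (Omega : set 'rV[R]_d)
    (T : 'I_N -> simplex R d) (r : nat) (u : vfield R d) : Prop :=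
  H0div Omega u /\
  forall k, exists p q, [/\ poly_vec r p, poly_fun r q &
    forall x, open_simplex (T k) x -> u x = p x + q x *: emb x].

Definition F_dg (R : realType) (d N : nat) (Omega : set 'rV[R]_d)
    (T : 'I_N -> simplex R d) (s : nat) (f : sfield R d) : Prop :=
  L2 Omega f /\
  forall k, exists2 p, poly_fun s p &
    forall x, open_simplex (T k) x -> f x = p x.

(* For d = 2, [cross (emb x) (orth c)] is [(c x_2, - c x_1, 0)]. *)
Definition U_curl (R : realType) (d N : nat) (Omega : set 'rV[R]_d)
    (T : 'I_N -> simplex R d) (r : nat) (u : vfield R d) : Prop :=
  H0curl Omega u /\
  forall k,
    if d == 2%N then
      exists p q g, [/\ poly_vec r p, poly_fun r q, poly_fun r.+1 g &
        forall x, open_simplex (T k) x ->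
          u x = p x + cross (emb x) (orth (q x)) + orth (g x)]
    else
      exists p q, [/\ poly_vec r p, poly_vec r q &
        forall x, open_simplex (T k) x -> u x = p x + cross (emb x) (q x)].

Definition pi_div (R : realType) (d N : nat) (Omega : set 'rV[R]_d)
    (T : 'I_N -> simplex R d) (r : nat) (u : vfield R d) : vfield R d :=
  xget (fun=> 0) [set w | U_div Omega T r w /\
    forall v, U_div Omega T r v -> vip Omega w v = vip Omega u v].

Definition curl_h (R : realType) (d N : nat) (Omega : set 'rV[R]_d)
    (T : 'I_N -> simplex R d) (r : nat) (u : vfield R d) : vfield R d :=
  xget (fun=> 0) [set w | U_curl Omega T r w /\
    forall v, U_curl Omega T r v -> vip Omega w v = vip Omega u (wcurl Omega v)].

Definition bracket (R : realType) (d : nat) (Omega : set 'rV[R]_d)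
    (u v : vfield R d) : vfield R d :=
  fun x => \row_i (dot (u x) (wgrad Omega (vcomp i v) x) -
                   dot (v x) (wgrad Omega (vcomp i u) x)).

Definition a_form (R : realType) (d : nat) (Omega : set 'rV[R]_d)
    (w u v : vfield R d) : R :=
  - vip Omega w (bracket Omega u v).

(* The interior faces are enumerated as (k, l, i) with k < l, where i is the face
   of T k shared with T l. The normal component of u is continuous across it, so
   that taking the trace of u from T k is no restriction. *)
Definition b_form (R : realType) (d N : nat) (T : 'I_N -> simplex R d)
    (f g : sfield R d) (u : vfield R d) : R :=
  - (\sum_(k < N) \int[lebesgue_rV R d]_(x in open_simplex (T k))
       (dot (u x) (grad f x) * g x)) +
  \sum_(k < N) \sum_(l < N | (k < l)%N) \sum_(i < d.+1 | shared_face (T k) (T l) i)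
    let n1 := emb (outward_normal (T k) i) in
    let n2 := - n1 in
    face_integral (T k) i (fun x =>
      dot (vtrace_on (T k) u x)
        (trace_on (T k) f x *: n1 + trace_on (T l) f x *: n2) *
      ((trace_on (T k) g x + trace_on (T l) g x) / 2)).

Definition d_form (R : realType) (d : nat) (Omega : set 'rV[R]_d)
    (mu lambda : R) (u v : vfield R d) : R :=
  - \int[lebesgue_rV R d]_(x in Omega)
      (mu * (\sum_i dot (wgrad Omega (vcomp i u) x)
                     (wgrad Omega (vcomp i v) x)) +
       (lambda + mu) * (wdiv Omega u x * wdiv Omega v x)).

Definition e_form (R : realType) (d N : nat) (Omega : set 'rV[R]_d)
    (T : 'I_N -> simplex R d) (r : nat) (nu : R) (B C : vfield R d) : R :=
  - nu * vip Omega (curl_h Omega T r B) (curl_h Omega T r C).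

(* The derivative relative to the set I, one-sided at the endpoints of an
   interval I. *)
Definition quotient_within (R : realType) (I : set R) (f : R -> R) (x : R) :=
  ((f y - f x) / (y - x)) @[y --> within (I `\ x) (nbhs x)].

Definition derive_within (R : realType) (I : set R) (f : R -> R) (x : R) : R :=
  lim (quotient_within I f x).

Definition C1_on (R : realType) (I : set R) (f : R -> R) : Prop :=
  (forall x, I x -> cvg (quotient_within I f x)) /\
  {within I, continuous (derive_within I f)}.

Definition delta (R : realType) (I : set R) (eps : R -> R) (x y : R) : R :=
  if x == y then derive_within I eps x else (eps y - eps x) / (y - x).

Definition ell (R : realType) (d : nat) (Omega : set 'rV[R]_d) (eps : R -> R)
    (u : vfield R d) (rho : sfield R d) (B : vfield R d) : R :=
  \int[lebesgue_rV R d]_(x in Omega)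
    (2^-1 * rho x * dot (u x) (u x) - eps (rho x) - 2^-1 * dot (B x) (B x)).

(* The pairing of the functional derivative of ell in u with a field v. *)
Definition dell_du (R : realType) (d : nat) (Omega : set 'rV[R]_d)
    (eps : R -> R) (u : vfield R d) (rho : sfield R d) (B v : vfield R d) : R :=
  derive1 (fun t : R => ell Omega eps (fun x => u x + t *: v x) rho B) 0.

Definition energy (R : realType) (d : nat) (Omega : set 'rV[R]_d)
    (eps : R -> R) (u : vfield R d) (rho : sfield R d) (B : vfield R d) : R :=
  dell_du Omega eps u rho B u - ell Omega eps u rho B.

(* Main.v *)
Require Import Defs.
From HB Require Import structures.
From mathcomp Require Import all_boot all_order all_algebra.
From mathcomp Require Import all_classical all_reals all_analysis.
From mathcomp Require Import measurable_realfun ring lra.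
Set Implicit Arguments.
Unset Strict Implicit.
Unset Printing Implicit Defensive.

Import Order.TTheory GRing.Theory Num.Theory.
Import numFieldNormedType.Exports.

Local Open Scope classical_set_scope.
Local Open Scope ring_scope.

(* The scheme mirrors the cancellations of the continuous equations, so testing
   it with u_{k+1/2}, theta, (rho_{k+1} - rho_k) / dt, B_{k+1/2}, E, J, H, U and
   alpha gives the energy balance, the trilinear terms being mixed products that
   cancel pairwise. The tests are admissible thanks to three facts.

   - The weak curl of a field of U_curl is piecewise polynomial of the
     Raviart-Thomas type and has zero normal trace (for d = 2, up to a field
     orthogonal to the plane, which is not seen by U_div). Hence
     (B_{k+1} - B_k) / dt + curl E + nu curl J lies in U_div and is orthogonal to
     U_div, so it is zero: div B is preserved.
   - <A, curl A'> = <curl A, A'> for A, A' in H_0(curl) with piecewise smooth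
     curls. It follows from the definition of the zero trace by integrating
     A(x) . curl_x (kappa(x - y) A'(y)) over x and y and letting the kernel kappa
     concentrate: no regularity of the boundary is needed. With
     <B_{k+1/2}, E> = <H, E> = - <U x H, H> = 0 this gives the helicity balance.
   - U_div and U_curl are finite-dimensional modulo null fields, so that pi_div
     and curl_h satisfy their defining identities.

   A weak derivative is known only against test functions; smooth cut-offs
   vanishing near the faces make these sufficient to determine integrals against
   piecewise smooth fields. *)

(** * Null sets, continuity and Lebesgue measure *)

(** The balances are exact because the scheme obeys a discrete chain rule in time: [delta] times the
    density increment is the increment of the internal energy, and the term $\frac12 u_k\cdot
    u_{k+1}$ in [theta] removes the cross terms that $(\rho_{k+1}u_{k+1}-\rho_ku_k)\cdot u_{k+1/2}$
    leaves beside the kinetic energies.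

    The analytic obstacle is that [wcurl], [pi_div] and [curl_h] are arbitrary choices among fields
    that agree up to null sets; [wcurl] need not even be linear. They are handled through integrals
    against piecewise smooth or discrete fields, on which the choice has no influence. No space is
    divided by its null fields: where uniqueness is needed, being zero is replaced by having zero
    norm.

    Integrals over Omega are computed over [mesh], the union of the open simplices, where the
    discrete fields have explicit formulas. Dimensions 2 and 3 share one calculus of three-component
    fields, in which the missing partial derivative is zero. *)

Section null_sets.
Context d (T : measurableType d) (R : realType) (mu : {measure set T -> \bar R}).
Import HBNNSimple.

Lemma sintegral_proj_null (N : set T) (mN : measurable N) (h : {nnsfun T >-> R}) :
  mu N = 0%E -> sintegral mu (proj_nnsfun h (measurableC mN)) = sintegral mu h.
Proof.
move=> N0; have E (f : {nnsfun T >-> R}) : sintegral mu f = (\int[mu]_x (f x)%:E)%E.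
  by rewrite integral_nnsfun // patch_setT.
rewrite !E.
rewrite (@ge0_negligible_integral _ _ _ mu setT N)//; first last.
- by move=> x _; rewrite lee_fin.
- by apply/measurable_EFinP; exact: measurable_funTS.
rewrite [RHS](@ge0_negligible_integral _ _ _ mu setT N)//; first last.
- by move=> x _; rewrite lee_fin.
- by apply/measurable_EFinP; exact: measurable_funTS.
apply: eq_integral => x /set_mem[_ Nx]; rewrite /= mindicE mem_set ?mulr1//.
Qed.

(* No measurability is assumed: the integral of a nonnegative function is a
   supremum over simple functions, which may be cut off on a null set. *)
Lemma integral_eq_off_null (N : set T) (f g : T -> \bar R) :
  measurable N -> mu N = 0%E -> (forall x, ~ N x -> f x = g x) ->
  (\int[mu]_x f x = \int[mu]_x g x)%E.
Proof.
move=> mN N0 fg; rewrite /integral /= !patch_setT.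
pose nni (F : T -> \bar R) := ereal_sup
  [set sintegral mu h | h in [set h : {nnsfun T >-> R} |
     forall x, ((h x)%:E <= F x)%E]].
suff H F G : (forall x, ~ N x -> F x = G x) -> (forall x, 0 <= G x)%E ->
    (nni F <= nni G)%E.
  rewrite -!/(nni _); congr (_ - _)%E; apply/eqP; rewrite eq_le; apply/andP;
    split; apply: H => x *; rewrite ?funepos_ge0 ?funeneg_ge0//.
  - by rewrite !funeposE fg.
  - by rewrite !funeposE fg.
  - by rewrite !funenegE fg.
  - by rewrite !funenegE fg.
move=> FG G0; apply: ge_ereal_sup => _ [h hF <-].
rewrite -(sintegral_proj_null mN h N0); apply: ereal_sup_ubound.
exists (proj_nnsfun h (measurableC mN)) => // x /=.
rewrite mindicE; case: (boolP (x \in _)) => [/set_mem/= Nx|_].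
  by rewrite mulr1 -FG.
by rewrite mulr0.
Qed.

(** Nothing is asked of [f], so that every integral over Omega, whatever its integrand, can be moved
    to the open simplices. *)
Lemma Rintegral_sub_null (D E : set T) (f : T -> R) :
  D `<=` E -> measurable (E `\` D) -> mu (E `\` D) = 0%E ->
  \int[mu]_(x in E) f x = \int[mu]_(x in D) f x.
Proof.
move=> DE mED ED0; rewrite /Rintegral; congr fine.
rewrite integral_mkcond [RHS]integral_mkcond.
apply: (integral_eq_off_null mED ED0) => x EDx.
rewrite !patchE; case: (boolP (x \in D)) => [/set_mem Dx|Dx].
  by rewrite mem_set//; exact: DE.
rewrite memNset// => Ex; apply: EDx; split=> //.
by move: Dx; rewrite notin_setE.
Qed.

End null_sets.

Section continuous_real.
Variables (R : realType) (T : topologicalType).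
Implicit Types f g : T -> R.

Lemma continuous_mul f g :
  continuous f -> continuous g -> continuous (fun x => f x * g x).
Proof. by move=> cf cg x; exact: (cvgM (cf x) (cg x)). Qed.

Lemma continuous_add f g :
  continuous f -> continuous g -> continuous (fun x => f x + g x).
Proof. by move=> cf cg x; exact: (cvgD (cf x) (cg x)). Qed.

Lemma continuous_const (a : R) : continuous (fun _ : T => a).
Proof. by move=> x; exact: cvg_cst. Qed.

Lemma continuous_sum (J : Type) (r : seq J) (P : pred J) (F : J -> T -> R) :
  (forall i, P i -> continuous (F i)) ->
  continuous (fun x => \sum_(i <- r | P i) F i x).
Proof.
by apply: (@continuous_big _ _ +%R); exact: add_continuous.
Qed.

Lemma continuous_prod (J : Type) (r : seq J) (P : pred J) (F : J -> T -> R) :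
  (forall i, P i -> continuous (F i)) ->
  continuous (fun x => \prod_(i <- r | P i) F i x).
Proof.
move=> cF; elim: r => [|i r IH].
  by under [fun x => _]eq_fun do rewrite big_nil; exact: continuous_const.
under [fun x => _]eq_fun do rewrite big_cons.
by have [Pi|] := boolP (P i) => //; apply: continuous_mul => //; exact: cF.
Qed.

End continuous_real.

Section rV_measure.
Variable R : realType.

Lemma measurable_rV_box n (A : 'I_n -> set (measurableTypeR R)) :
  (forall i, measurable (A i)) ->
  measurable [set x : 'rV[R]_n | forall i, A i (x 0 i)].
Proof.
move=> mA; rewrite (_ : [set x | _] = \bigcap_(i : 'I_n) (@rV_coord R n i @^-1` A i)).
  apply: fin_bigcap_measurable => // i _.
  by rewrite -[X in measurable X]setTI; apply: measurable_rV_coord.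
by apply/seteqP; split => x /= Ax i; [move=> _|]; exact: Ax.
Qed.

(** The sigma-algebra is generated by the coordinates, so [U] is written as the countable union of
    the open boxes with rational centre and radius that it contains. *)
Lemma open_measurable_rV n (U : set 'rV[R]_n) : open U -> measurable U.
Proof.
move=> oU.
pose box (q : 'rV[rat]_n * rat) : set 'rV[R]_n :=
  [set x | forall i, `]ratr (q.1 0 i) - ratr q.2, ratr (q.1 0 i) + ratr q.2[%classic (x 0 i)].
rewrite (_ : U = \bigcup_q (if `[< box q `<=` U >] then box q else set0)).
  apply: countable_bigcupT_measurable => // q.
  case: ifPn => // _.
  by apply: (@measurable_rV_box n (fun i => `]ratr (q.1 0 i) - ratr q.2,
    ratr (q.1 0 i) + ratr q.2[%classic)) => i; exact: measurable_itv.
apply/seteqP; split => [x Ux|x [q _]]; last first.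
  by case: ifPn => // /asboolP; apply.
have /nbhs_ballP[e /= e0 eU] : nbhs x U by exact: open_nbhs_nbhs.
(* Half of [e]: a point of the box is within [k] of the rational centre, which is itself within [k]
   of [x]. *)
have [k /andP[k0 ke]] : exists k : rat, 0 < (ratr k : R) < e / 2.
  have [|k] := @rat_in_itvoo R 0 (e / 2); first by rewrite divr_gt0.
  by rewrite in_itv /=; exists k.
have /choice[q qP] : forall i, exists q : rat, x 0 i - ratr k < ratr q < x 0 i + ratr k.
  move=> i; have [|q] := @rat_in_itvoo R (x 0 i - ratr k) (x 0 i + ratr k).
    by rewrite ltrD2l gtrN.
  by rewrite in_itv /=; exists q.
exists (\row_i q i, k) => //; rewrite asboolT.
  move=> i /=; rewrite in_itv /= mxE; have /andP[] := qP i; lra.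
move=> y yb; apply: eU; split => // i j.
rewrite (ord1 i) /ball /= ltr_norml.
have := yb j; rewrite /= in_itv /= mxE; have /andP[] := qP j; lra.
Qed.

Lemma continuous_measurable_rV n (f : 'rV[R]_n -> R) :
  continuous f -> measurable_fun setT f.
Proof.
move=> cf; apply: (measurability (@RGenOInfty.G R)).
  exact: RGenOInfty.measurableE.
move=> _ [_ [a ->] <-]; rewrite setTI.
by apply: open_measurable_rV; apply: open_comp => // ? _; exact: cf.
Qed.

Lemma continuous_coord n (i : 'I_n) : continuous (fun x : 'rV[R]_n => x 0 i).
Proof. by move=> x; apply: differentiable_continuous; exact: differentiable_coord. Qed.

Lemma ler_coord_norm n (x : 'rV[R]_n) (i : 'I_n) : `|x 0 i| <= `|x|.
Proof.
rewrite [leRHS]/Num.norm /= mx_normrE.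
exact: (@le_bigmax _ _ _ _ (fun ij : 'I_1 * 'I_n => `|x ij.1 ij.2|) (0, i)).
Qed.

Lemma bounded_finite_measure n (A : set 'rV[R]_n) :
  bounded_set A -> measurable A -> (lebesgue_rV R n A < +oo)%E.
Proof.
move=> bA mA; have [M [_ /(_ (M + 1))]] := bA; rewrite ltrDl ltr01 => /(_ isT) AM.
pose I := `[- (M + 1), M + 1]%classic : set (measurableTypeR R).
pose B := [set x : 'rV[R]_n | forall i : 'I_n, I (x 0 i)].
apply: (@le_lt_trans _ _ (lebesgue_rV R n B)).
  apply: le_measure; rewrite ?inE//.
    by apply: (@measurable_rV_box n (fun=> I)) => i; exact: measurable_itv.
  move=> x /AM xM i; rewrite /I /= in_itv /=.
  rewrite -ler_norml; apply: le_trans xM.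
  exact: ler_coord_norm.
rewrite (@lebesgue_rV_box R n (fun=> I)); last by move=> i; exact: measurable_itv.
suff /andP[] : (0 <= \prod_(i < n) lebesgue_measure I < +oo)%E by [].
elim/big_ind : _ => [|x y /andP[x0 xoo] /andP[y0 yoo]|i _].
- by rewrite lee01 ltry.
- by rewrite mule_ge0// lte_mul_pinfty// ge0_fin_numE.
- rewrite measure_ge0 lebesgue_measure_itv; case: ifPn => //= _.
  by rewrite -EFinB ltry.
Qed.

Lemma continuous_dot n (c : 'rV[R]_n) : continuous (dot c).
Proof.
apply: continuous_sum => i _; apply: continuous_mul.
  exact: continuous_const.
exact: continuous_coord.
Qed.

Lemma measurable_hyperplane n (c : 'rV[R]_n) (b : R) :
  measurable [set x : 'rV[R]_n | dot c x = b].
Proof.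
rewrite (_ : mkset _ = setT `&` dot c @^-1` [set b]); last by rewrite setTI.
by apply: (continuous_measurable_rV (@continuous_dot n c)).
Qed.

(** Fubini in the first coordinate: if the remaining coefficients [c'] do not all vanish, each slice
    is a null hyperplane by induction; otherwise the slices are empty except over the single point
    [b / c 0 0]. *)
Lemma hyperplane_null n (c : 'rV[R]_n) (b : R) : c != 0 ->
  lebesgue_rV R n [set x : 'rV[R]_n | dot c x = b] = 0%E.
Proof.
elim: n c b => [c b|n IH c b c0].
  by rewrite (_ : c = 0) ?eqxx//; apply/rowP => -[].
rewrite /= /rV_measureM /pushforward /product_measure1 /=.
pose c' : 'rV[R]_n := \row_i c 0 (lift ord0 i).
have dE t y : dot c (rV_cons (t, y)) = c 0 0 * t + dot c' y.
  rewrite /dot big_ord_recl; congr (_ + _).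
    by rewrite mxE unlift_none.
  by apply: eq_bigr => i _; rewrite !mxE liftK.
pose A t := [set y : 'rV[R]_n | dot c' y = b - c 0 0 * t].
transitivity (\int[@lebesgue_measure R]_t lebesgue_rV R n (A t))%E.
  apply: eq_integral => t _; congr (lebesgue_rV R n _).
  apply/seteqP; split => y; rewrite /xsection /= inE /= dE /A /= => h; lra.
have [c'0|c'0] := eqVneq c' 0; last first.
  by rewrite integral0_eq// => t _; exact: IH.
have c00 : c 0 0 != 0.
  apply: contra c0 => /eqP c00; apply/eqP/rowP => i; rewrite mxE.
  case: (unliftP ord0 i) => [j ->|-> //].
  by have /rowP/(_ j) := c'0; rewrite !mxE.
rewrite -[RHS](integral0 (@lebesgue_measure R) setT).
apply: (@integral_eq_off_null _ _ _ (@lebesgue_measure R) [set b / c 0 0]).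
- exact: measurable_set1.
- exact: lebesgue_measure_set1.
- move=> t /eqP tb.
  rewrite (_ : A t = set0) ?measure0// -subset0 => y; rewrite /A /= c'0.
  rewrite /dot big1 => [/esym/eqP|i _]; last by rewrite mxE mul0r.
  rewrite subr_eq0 => /eqP bt; apply/negP: tb.
  by rewrite bt mulrC mulKf ?eqxx.
Qed.

End rV_measure.

(** * Barycentric coordinates *)

Section barycentric.
Variables (R : realType) (d : nat) (K : simplex R d).
Hypothesis ndK : Defs.nondegenerate K.

Definition edge_mx : 'M[R]_d := \matrix_(i < d) (K (lift ord0 i) - K ord0).

(** The coordinates of index [lift ord0 j] are read off in the basis of the edges issuing from
    [K ord0], and the one of [ord0] is set by the total being 1. They are affine functions on the
    whole space. *)
Definition bary (i : 'I_d.+1) (x : 'rV[R]_d) : R :=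
  let y := (x - K ord0) *m invmx edge_mx in
  oapp (fun j => y 0 j) (1 - \sum_j y 0 j) (unlift ord0 i).

Lemma bary_sum x : \sum_i bary i x = 1.
Proof.
rewrite big_ord_recl /bary unlift_none /=.
rewrite -[RHS](subrK (\sum_j ((x - K ord0) *m invmx edge_mx) 0 j)).
by congr (_ + _); apply: eq_bigr => i _; rewrite liftK.
Qed.

Lemma comb_edge (c : 'I_d.+1 -> R) : \sum_i c i = 1 ->
  \sum_i c i *: K i = K ord0 + (\row_j c (lift ord0 j)) *m edge_mx.
Proof.
move=> c1; have c0 : c ord0 = 1 - \sum_(j < d) c (lift ord0 j).
  by rewrite -c1 big_ord_recl addrK.
rewrite big_ord_recl c0 scalerBl scale1r -addrA; congr (_ + _).
rewrite scaler_suml addrC -sumrB mulmx_sum_row.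
by apply: eq_bigr => j _; rewrite !mxE rowK scalerBr.
Qed.

Lemma bary_comb x : \sum_i bary i x *: K i = x.
Proof.
rewrite comb_edge ?bary_sum//.
rewrite (_ : \row_j _ = (x - K ord0) *m invmx edge_mx).
  by rewrite mulmxKV// addrC subrK.
by apply/rowP => j; rewrite mxE /bary liftK.
Qed.

Lemma bary_uniq (c : 'I_d.+1 -> R) x : \sum_i c i = 1 -> x = \sum_i c i *: K i ->
  forall i, c i = bary i x.
Proof.
move=> c1; rewrite comb_edge// => xE.
have yE : (x - K ord0) *m invmx edge_mx = \row_j c (lift ord0 j).
  by rewrite xE addrC addKr mulmxK.
have cl (j : 'I_d) : c (lift ord0 j) = bary (lift ord0 j) x.
  by rewrite /bary liftK /= yE mxE.
move=> i; case: (unliftP ord0 i) => [j ->//|->].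
rewrite /bary unlift_none /= yE; under eq_bigr do rewrite mxE.
by rewrite -c1 big_ord_recl addrK.
Qed.

Lemma bary_affine i : exists (a : R) (g : 'rV[R]_d),
  forall x, bary i x = a + dot g x.
Proof.
pose N := invmx edge_mx.
have E j x : ((x - K ord0) *m N) 0 j = - (K ord0 *m N) 0 j + dot (\row_k N k j) x.
  rewrite mulmxBl !mxE addrC; congr (_ + _); rewrite /dot.
  by apply: eq_bigr => k _; rewrite !mxE mulrC.
rewrite /bary; case: (unliftP ord0 i) => [j _|_] /=.
  by exists (- (K ord0 *m N) 0 j), (\row_k N k j) => x; exact: E.
exists (1 + \sum_j (K ord0 *m N) 0 j), (- \sum_j (\row_k N k j)) => x.
rewrite -addrA; congr (_ + _); under eq_bigr do rewrite E.
rewrite big_split /= opprD sumrN opprK; congr (_ + _).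
rewrite /dot exchange_big /= -sumrN; apply: eq_bigr => k _.
by rewrite mxE summxE -mulr_suml mulNr.
Qed.

Lemma bary_vertex i j : bary i (K j) = (i == j)%:R.
Proof.
rewrite -(@bary_uniq (fun i => (i == j)%:R))//.
  by rewrite (bigD1 j)//= eqxx big1 ?addr0// => k /negbTE ->.
by rewrite (bigD1 j)//= eqxx scale1r big1 ?addr0// => k /negbTE ->; rewrite scale0r.
Qed.

Lemma open_simplexE : open_simplex K = [set x | forall i, 0 < bary i x].
Proof.
apply/seteqP; split => x /=.
  by move=> [c [c0 c1 xE]] i; rewrite -(bary_uniq c1 xE).
by move=> x0; exists (bary^~ x); rewrite bary_sum bary_comb.
Qed.

Lemma closed_simplexE : closed_simplex K = [set x | forall i, 0 <= bary i x].
Proof.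
apply/seteqP; split => x /=.
  by move=> [c [c0 _ c1 xE]] i; rewrite -(bary_uniq c1 xE).
by move=> x0; exists (bary^~ x); rewrite bary_sum bary_comb.
Qed.

Lemma open_simplex_sub : open_simplex K `<=` closed_simplex K.
Proof. by rewrite open_simplexE closed_simplexE => x x0 i; exact/ltW/x0. Qed.

Lemma continuous_bary i : continuous (bary i).
Proof.
have [a [g E]] := bary_affine i; rewrite (funext E).
by apply: continuous_add; [exact: continuous_const|exact: continuous_dot].
Qed.

Lemma open_open_simplex : open (open_simplex K).
Proof.
rewrite open_simplexE openE => x x0; apply: (@filter_forall _ _ (fun i y => 0 < bary i y) (nbhs x) _) => i.
apply: (@continuous_bary i x [set t | 0 < t]).
by apply: open_nbhs_nbhs; split; [exact: open_gt|exact: x0].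
Qed.

Lemma closed_closed_simplex : closed (closed_simplex K).
Proof.
rewrite closed_simplexE (_ : [set x | _] = \bigcap_(i in [set: 'I_d.+1]) (bary i @^-1` [set t | 0 <= t])).
  apply: closed_bigI => i _; apply: closed_comp; last exact: closed_ge.
  by move=> x _; exact: continuous_bary.
by apply/seteqP; split => x x0 // i; [move=> _|]; exact: x0.
Qed.

Lemma bounded_closed_simplex : bounded_set (closed_simplex K).
Proof.
exists (\sum_i `|K i|); split; first exact: num_real.
move=> M ltM x [c [c0 _ c1 ->]] /=.
apply: (le_trans (ler_norm_sum _ _ _)); apply: le_trans (ltW ltM).
apply: ler_sum => i _; rewrite normrZ ger0_norm//.
apply: ler_piMl => //; rewrite -c1 (bigD1 i)//= lerDl; exact: sumr_ge0.
Qed.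

Lemma compact_closed_simplex : compact (closed_simplex K).
Proof.
by apply: bounded_closed_compact; [exact: bounded_closed_simplex|exact: closed_closed_simplex].
Qed.

Lemma bary_face_null i : (0 < d)%N ->
  measurable [set x | bary i x = 0] /\ lebesgue_rV R d [set x | bary i x = 0] = 0%E.
Proof.
move=> d0; have [a [g E]] := bary_affine i.
have S : [set x | bary i x = 0] = [set x | dot g x = - a].
  by apply/seteqP; split => x /=; rewrite E => h; lra.
rewrite S; split; first exact: measurable_hyperplane.
apply: hyperplane_null; apply/eqP => g0.
have [j ij] : exists j, j != i.
  by exists (lift i (Ordinal d0)); rewrite eq_sym neq_lift.
have dg x : dot g x = 0 by rewrite g0 /dot big1// => k _; rewrite mxE mul0r.
have := E (K i); have := E (K j); rewrite !dg !bary_vertex eqxx eq_sym (negbTE ij).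
by move=> <- /eqP; rewrite oner_eq0.
Qed.

(** Moving from [x] towards the barycentre [z] makes all barycentric coordinates positive at once,
    so every neighbourhood of [x] meets the open simplex. Properness is what makes [trace_on] a
    genuine limit. *)
Lemma within_open_simplex_proper x : closed_simplex K x ->
  ProperFilter (within (open_simplex K) (nbhs x)).
Proof.
rewrite closed_simplexE => x0; apply: Build_ProperFilter_ex.
move=> P /nbhs_ballP[e /= e0 eP].
pose z := \sum_i (d.+1%:R^-1 : R) *: K i.
have zE i : bary i z = d.+1%:R^-1.
  rewrite -(@bary_uniq (fun=> d.+1%:R^-1))//.
  by rewrite sumr_const card_ord -[_ *+ _]mulr_natl divff// pnatr_eq0.
pose M := `|z - x| + 1.
have M0 : 0 < M by rewrite ltr_wpDl.
pose t := Num.min 1 (e / 2 / M).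
have t0 : 0 < t by rewrite lt_min ltr01 !divr_gt0.
have t1 : t <= 1 by rewrite ge_min lexx.
have tM : t * M < e.
  apply: (@le_lt_trans _ _ (e / 2)); last by lra.
  by rewrite -ler_pdivlMr// ge_min lexx orbT.
exists (x + t *: (z - x)); apply: eP.
  rewrite -ball_normE /= opprD addNKr normrN normrZ gtr0_norm//.
  apply: le_lt_trans tM; rewrite ler_pM2l// /M; lra.
rewrite open_simplexE => i /=.
have -> : bary i (x + t *: (z - x)) = (1 - t) * bary i x + t * bary i z.
  have [a [g E]] := bary_affine i; rewrite !E.
  have -> : dot g (x + t *: (z - x)) = dot g x + t * (dot g z - dot g x).
    rewrite /dot -sumrB mulr_sumr -big_split /=; apply: eq_bigr => k _.
    by rewrite !mxE; ring.
  ring.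
rewrite zE ltr_wpDl// ?mulr_gt0// ?invr_gt0//.
by rewrite mulr_ge0// subr_ge0.
Qed.

End barycentric.

(** * Smooth functions and integration by parts *)

Section exp_cutoff.
Variable R : realType.
Implicit Types (P Q : {poly R}) (t : R).

(* With [P = 1] this is the flat function [exp(-1/t)] of [t > 0], and the family
   of all [P] is closed under differentiation. *)
Definition flat P t : R := if 0 < t then P.[t^-1] * expR (- t^-1) else 0.

(** Differentiating $P(1/t)e^{-1/t}$ produces $t^{-2}(P-P')(1/t)e^{-1/t}$, and the factor $t^{-2}$
    is the square of the variable $1/t$. *)
Definition flat_deriv P : {poly R} := 'X^2 * (P - P^`()).

(** With $x=(n+1)y$ the claim becomes $y^{n+1}\le e^{(n+1)y}$, which follows from $y\le 1+y\le
    e^y$. *)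
Lemma exprn_expRN_le n (x : R) : 0 <= x -> x ^+ n.+1 * expR (- x) <= n.+1%:R ^+ n.+1.
Proof.
move=> x0; rewrite expRN ler_pdivrMr ?expR_gt0//.
have -> : x = n.+1%:R * (x / n.+1%:R) by rewrite mulrC divfK// pnatr_eq0.
have : 0 <= x / n.+1%:R by rewrite divr_ge0.
move: (x / _) => y y0.
rewrite expRM_natl exprMn ler_pM2l ?exprn_gt0//.
apply: lerXn2r; rewrite ?nnegrE ?expR_ge0//.
by apply: le_trans (expR_ge1Dx _); rewrite lerDr.
Qed.

(** Each monomial contributes $t^{-i}e^{-1/t}=t\cdot t^{-(i+1)}e^{-1/t}$, to which the previous
    estimate applies at $x=1/t$. *)
Lemma flat_bound P : exists2 C : R, 0 <= C & forall t, `|flat P t| <= C * `|t|.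
Proof.
elim/poly_ind: P => [|P c _].
  by exists 0 => // t; rewrite /flat horner0 mul0r if_same normr0 mul0r.
pose Q := P * 'X + c%:P.
exists (\sum_(i < size Q) `|Q`_i| * i.+1%:R ^+ i.+1).
  by apply: sumr_ge0 => i _; rewrite mulr_ge0// exprn_ge0.
move=> t; rewrite /flat; case: ifPn => t0; last first.
  by rewrite normr0 mulr_ge0// sumr_ge0// => i _; rewrite mulr_ge0// exprn_ge0.
rewrite -/Q horner_coef mulr_suml mulr_suml.
apply: (le_trans (ler_norm_sum _ _ _)); apply: ler_sum => i _.
rewrite -mulrA normrM -mulrA ler_wpM2l// gtr0_norm ?mulr_gt0 ?exprn_gt0 ?invr_gt0 ?expR_gt0//.
rewrite gtr0_norm// -ler_pdivrMr// mulrAC -exprSr.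
by apply: exprn_expRN_le; rewrite invr_ge0 ltW.
Qed.

Lemma is_derive_flat P t : is_derive t 1 (flat P) (flat (flat_deriv P) t).
Proof.
have [t0|t0|->] := ltgtP t 0.
- rewrite {2}/flat ltNge (ltW t0) /=.
  apply: (@near_eq_is_derive R R R (fun=> 0) (flat P)).
  near=> s; rewrite /flat ltNge (ltW (_ : s < 0))//; near: s.
  exact: lt_nbhsl.
- apply: (@near_eq_is_derive R R R (fun s => P.[s^-1] * expR (- s^-1))).
    near=> s; rewrite /flat (_ : 0 < s)//; near: s; exact: lt_nbhsr.
  have dV : is_derive t 1 (fun s : R => s^-1) (- t ^- 2).
    apply: is_derive_eq; first by apply: is_deriveV; rewrite gt_eqF.
    by rewrite /GRing.scale /= mulr1.
  have dN : is_derive t 1 (fun s : R => - s^-1) (t ^- 2).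
    by apply: is_derive_eq; rewrite opprK.
  have dP := is_derive1_comp (is_derive_poly P t^-1) dV.
  have dE := @is_derive1_comp R expR (fun s => - s^-1) t _ _ (is_derive_expR _) dN.
  apply: (is_derive_eq (is_deriveM dP dE)).
  rewrite /flat t0 /flat_deriv !hornerE /GRing.scale /= -!exprVn; ring.
(* The difference quotient of [flat P] at 0 is [flat ('X * P)], whose linear bound forces the
   derivative at 0 to vanish. *)
- have [C C0 HC] := flat_bound ('X * P).
  rewrite {2}/flat ltxx.
  have F : (fun h : R => h^-1 *: ((flat P \o shift 0) (h *: 1) - flat P 0))
      @ 0^' --> (0 : R).
    apply/cvgrPdist_lt => e e0; near=> h.
    rewrite sub0r normrN [flat P 0]/flat ltxx subr0 /= addr0 /GRing.scale /= mulr1.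
    apply: (@le_lt_trans _ _ (C * `|h|)).
      apply: le_trans (HC h); rewrite /flat; case: ifPn => // _.
        by rewrite hornerM hornerX mulrA.
      by rewrite mulr0.
    have : `|h| < e / (C + 1).
      by near: h; apply: dnbhs0_lt; rewrite divr_gt0// ltr_wpDl.
    rewrite ltr_pdivlMr ?ltr_wpDl// => /le_lt_trans; apply.
    by rewrite mulrC ler_wpM2l// lerDl.
  apply: DeriveDef; first by apply/cvg_ex; exists 0.
  exact: cvg_lim F.
Unshelve. all: by end_near. Qed.

End exp_cutoff.

Section smooth_functions.
Variables (R : realType) (d : nat).
Implicit Types f g : sfield R d.

Notation "''e_' j" := (delta_mx 0 j : 'rV[R]_d) (at level 8, j at level 2, format "''e_' j").

Lemma is_derive_line f (v : 'rV[R]_d) (y : 'rV[R]_d) (s : R) (l : R) :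
  is_derive (y + s *: v) v f l -> is_derive s 1 (fun t : R => f (y + t *: v)) l.
Proof.
move=> [df <-].
have E : (fun h : R => h^-1 *: (((fun t : R => f (y + t *: v)) \o shift s) (h *: 1) -
      f (y + s *: v))) =
    (fun h : R => h^-1 *: ((f \o shift (y + s *: v)) (h *: v) - f (y + s *: v))).
  apply/funext => h /=; congr (_ *: (f _ - _)).
  by rewrite [h%:A]mulr1 scalerDl addrCA.
by apply: DeriveDef; rewrite /derivable /derive E.
Qed.

(** Only directional derivatives are available, not differentiability in several variables; the
    one-variable chain rule is applied along the line through [x] with direction [v]. *)
Lemma is_derive_line_comp (h : R -> R) f (v x : 'rV[R]_d) (a b : R) :
  is_derive (f x) 1 h a -> is_derive x v f b -> is_derive x v (fun y => h (f y)) (a * b).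
Proof.
move=> dh df.
have df0 : is_derive (0 : R) 1 (fun t : R => f (x + t *: v)) b.
  by apply: is_derive_line; rewrite scale0r addr0.
have dh0 : is_derive (f (x + 0 *: v)) 1 h a by rewrite scale0r addr0.
have [] := @is_derive1_comp _ h (fun t : R => f (x + t *: v)) _ _ _ dh0 df0.
have E : (fun t : R => t^-1 *: (((h \o (fun t : R => f (x + t *: v))) \o shift 0) (t *: 1) -
      (h \o (fun t : R => f (x + t *: v))) 0)) =
    (fun t : R => t^-1 *: (((fun y => h (f y)) \o shift x) (t *: v) - h (f x))).
  apply/funext => t /=; congr (_ *: (h (f _) - h (f _))).
    by rewrite addr0 [t%:A]mulr1 addrC.
  by rewrite scale0r addr0.
by rewrite /derivable /derive E => ? <-; apply: DeriveDef.
Qed.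

Lemma Cn_continuous n f : Cn n f -> continuous f.
Proof. by case: n => [|n] []. Qed.

Lemma Cn_is_derive n f j x : Cn n.+1 f -> is_derive x 'e_j f ('D_('e_j) f x).
Proof. by move=> [_ /(_ j)[df _]]; exact: DeriveDef. Qed.

Lemma Cn_derive n f j : Cn n.+1 f -> Cn n (fun x => 'D_('e_j) f x).
Proof. by move=> [_ /(_ j)[]]. Qed.

Lemma CnS n f : Cn n.+1 f -> Cn n f.
Proof.
elim: n f => [f []//|n IH f [cf H]]; split=> // j.
by have [df /IH Df] := H j.
Qed.

Lemma Cn_intro n f : continuous f ->
  (forall j, exists2 f', (forall x, is_derive x 'e_j f (f' x)) & Cn n f') ->
  Cn n.+1 f.
Proof.
move=> cf H; split=> // j; have [f' df Cf'] := H j; split.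
  by move=> x; have [] := df x.
rewrite (_ : (fun x => _) = f')//; apply/funext => x.
by have [_ ->] := df x.
Qed.

Lemma Cn_const n (a : R) : Cn n (fun _ : 'rV[R]_d => a).
Proof.
elim: n a => [|n IH] a; first by split=> //; exact: continuous_const.
apply: Cn_intro => [|j]; first exact: continuous_const.
exists (fun=> 0); last exact: IH.
by move=> x; exact: (is_derive_cst a).
Qed.

Lemma Cn_add n f g : Cn n f -> Cn n g -> Cn n (fun x => f x + g x).
Proof.
elim: n f g => [f g [cf _] [cg _]|n IH f g Cf Cg].
  by split=> //; exact: continuous_add.
apply: Cn_intro => [|j].
  exact: (continuous_add (Cn_continuous Cf) (Cn_continuous Cg)).
exists (fun x => 'D_('e_j) f x + 'D_('e_j) g x).
  by move=> x; exact: (is_deriveD (Cn_is_derive j x Cf) (Cn_is_derive j x Cg)).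
by apply: IH; exact: Cn_derive.
Qed.

Lemma Cn_mul n f g : Cn n f -> Cn n g -> Cn n (fun x => f x * g x).
Proof.
elim: n f g => [f g [cf _] [cg _]|n IH f g Cf Cg].
  by split=> //; exact: continuous_mul.
apply: Cn_intro => [|j].
  exact: (continuous_mul (Cn_continuous Cf) (Cn_continuous Cg)).
exists (fun x => f x * 'D_('e_j) g x + g x * 'D_('e_j) f x).
  by move=> x; exact: (is_deriveM (Cn_is_derive j x Cf) (Cn_is_derive j x Cg)).
by apply: Cn_add; apply: IH; (exact: Cn_derive || exact: CnS).
Qed.

Lemma Cn_opp n f : Cn n f -> Cn n (fun x => - f x).
Proof.
move=> Cf; rewrite (_ : (fun x => _) = (fun x => -1 * f x)).
  by apply: Cn_mul => //; exact: Cn_const.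
by apply/funext => x; rewrite mulN1r.
Qed.

Lemma Cn_sum n (J : Type) (r : seq J) (P : pred J) (F : J -> sfield R d) :
  (forall i, P i -> Cn n (F i)) -> Cn n (fun x => \sum_(i <- r | P i) F i x).
Proof.
move=> CF; elim: r => [|i r IH].
  by under [fun x => _]eq_fun do rewrite big_nil; exact: Cn_const.
under [fun x => _]eq_fun do rewrite big_cons.
by have [Pi|] := boolP (P i) => //; apply: Cn_add => //; exact: CF.
Qed.

Lemma Cn_prod n (J : Type) (r : seq J) (P : pred J) (F : J -> sfield R d) :
  (forall i, P i -> Cn n (F i)) -> Cn n (fun x => \prod_(i <- r | P i) F i x).
Proof.
move=> CF; elim: r => [|i r IH].
  by under [fun x => _]eq_fun do rewrite big_nil; exact: Cn_const.
under [fun x => _]eq_fun do rewrite big_cons.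
by have [Pi|] := boolP (P i) => //; apply: Cn_mul => //; exact: CF.
Qed.

Lemma is_derive_coord (i j : 'I_d) x :
  is_derive x 'e_j (fun y : 'rV[R]_d => y 0 i) ((i == j)%:R : R).
Proof.
have F : (fun h : R => h^-1 *: (((fun y : 'rV[R]_d => y 0 i) \o shift x) (h *: 'e_j) - x 0 i))
    @ 0^' --> ((i == j)%:R : R).
  apply: (@cvg_trans _ ((fun _ : R => (i == j)%:R : R) @ 0^')); last exact: cvg_cst.
  apply: near_eq_cvg; near=> h; rewrite /= !mxE eqxx /= addrK /GRing.scale /= mulrA mulVf ?mul1r//.
  by near: h; exact: nbhs_dnbhs_neq.
by apply: DeriveDef; [apply/cvg_ex; exists (i == j)%:R|exact: cvg_lim F].
Unshelve. all: by end_near. Qed.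

Lemma Cn_coord n (i : 'I_d) : Cn n (fun x : 'rV[R]_d => x 0 i).
Proof.
case: n => [|n]; first by split=> //; exact: continuous_coord.
apply: Cn_intro => [|j]; first exact: continuous_coord.
exists (fun=> (i == j)%:R); last exact: Cn_const.
by move=> x; exact: is_derive_coord.
Qed.

Lemma Cn_flat_comp n P f : Cn n f -> Cn n (fun x => flat P (f x)).
Proof.
have cP Q : continuous (flat Q).
  by move=> t; apply/differentiable_continuous/derivable1_diffP; have [] := is_derive_flat Q t.
elim: n f P => [f P [cf _]|n IH f P Cf].
  by split=> // x; apply: (continuous_comp (cf x)); exact: cP.
apply: Cn_intro => [x|j].
  by apply: (continuous_comp (Cn_continuous Cf (x := x))); exact: cP.
exists (fun x => flat (flat_deriv P) (f x) * 'D_('e_j) f x).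
  by move=> x; exact: (is_derive_line_comp (is_derive_flat P _) (Cn_is_derive j x Cf)).
by apply: Cn_mul; [apply: IH; exact: CnS|exact: Cn_derive].
Qed.

Lemma smooth_derive f j : smooth f -> smooth (fun x => 'D_('e_j) f x).
Proof. by move=> sf n; exact: Cn_derive. Qed.

End smooth_functions.

(** * Symmetry of second partial derivatives *)

Section schwarz.
Variables (R : realType) (d : nat).
Implicit Types f : sfield R d.

Lemma mvt_line f (f' : sfield R d) (v y : 'rV[R]_d) (h : R) : 0 < h ->
  (forall x, is_derive x v f (f' x)) ->
  exists2 c : R, 0 <= c <= h & f (y + h *: v) - f y = h * f' (y + c *: v).
Proof.
move=> h0 df.
have dl (s : R) : is_derive s 1 (fun t : R => f (y + t *: v)) (f' (y + s *: v)).
  by apply: is_derive_line; exact: df.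
have [|c] := @MVT_segment R (fun t => f (y + t *: v)) (fun t => f' (y + t *: v)) 0 h (ltW h0) (fun x _ => dl x).
  by apply: derivable_within_continuous => x _; have [] := dl x.
rewrite in_itv /= => ch; rewrite scale0r addr0 subr0 => ->.
by exists c => //; rewrite mulrC.
Qed.

(** The mean value theorem is applied twice: along [v] to the increment in direction [w], then along
    [w] to [fv]. *)
Lemma second_difference f (fv fvw : sfield R d) (v w x : 'rV[R]_d) (h : R) : 0 < h ->
  (forall y, is_derive y v f (fv y)) -> (forall y, is_derive y w fv (fvw y)) ->
  exists2 c : R * R, (0 <= c.1 <= h) && (0 <= c.2 <= h) &
    f (x + h *: v + h *: w) - f (x + h *: v) - (f (x + h *: w) - f x)
    = h * (h * fvw (x + c.1 *: v + c.2 *: w)).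
Proof.
move=> h0 dv dw.
have d1 y : is_derive y v (fun z => f (z + h *: w) - f z) (fv (y + h *: w) - fv y).
  apply: is_deriveB.
  have := dv (y + h *: w).
  move=> [df E]; have S : (fun k : R => k^-1 *: (((fun z => f (z + h *: w)) \o shift y) (k *: v) - f (y + h *: w)))
     = (fun k : R => k^-1 *: ((f \o shift (y + h *: w)) (k *: v) - f (y + h *: w))).
    by apply/funext => k /=; rewrite addrA.
  by apply: DeriveDef; rewrite /derivable /derive S.
have [c1 c1h E1] := mvt_line x h0 d1.
have [c2 c2h E2] := mvt_line (x + c1 *: v) h0 dw.
by exists (c1, c2); rewrite /= ?c1h// E1 E2.
Qed.

(** The second difference is symmetric in [v] and [w], so for every small h some value of [fvw] and
    some value of [fwv], both taken within 2h of [x], coincide; continuity then excludes a gap at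
    [x], whose half is [e]. *)
Lemma mixed_derivatives f (fv fw fvw fwv : sfield R d) (v w x : 'rV[R]_d) :
  `|v| <= 1 -> `|w| <= 1 ->
  (forall y, is_derive y v f (fv y)) -> (forall y, is_derive y w fv (fvw y)) ->
  (forall y, is_derive y w f (fw y)) -> (forall y, is_derive y v fw (fwv y)) ->
  continuous fvw -> continuous fwv -> fvw x = fwv x.
Proof.
move=> v1 w1 dv dvw dw dwv cvw cwv.
apply/eqP; rewrite -subr_eq0; apply/negPn/negP => ne.
have [e e0 eE] : exists2 e : R, 0 < e & e + e = `|fvw x - fwv x|.
  by exists (`|fvw x - fwv x| / 2); [rewrite divr_gt0// normr_gt0|rewrite -splitr].
have /nbhs_ballP[r1 /= r10 B1] := @cvw x _ (nbhsx_ballx (fvw x) e e0).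
have /nbhs_ballP[r2 /= r20 B2] := @cwv x _ (nbhsx_ballx (fwv x) e e0).
have [h h0 /andP[hr1 hr2]] : exists2 h : R, 0 < h & (h + h < r1) && (h + h < r2).
  exists (Num.min r1 r2 / 2 / 2); first by rewrite !divr_gt0// lt_min r10.
  rewrite -splitr -lt_min ltr_pdivrMr// ltr_pMr ?ltr1n//.
  by rewrite lt_min r10.
have near_x a b (c : R * R) : `|a| <= 1 -> `|b| <= 1 ->
    (0 <= c.1 <= h) && (0 <= c.2 <= h) ->
    `|x - (x + c.1 *: a + c.2 *: b)| <= h + h.
  move=> a1 b1 /andP[/andP[c10 c1h] /andP[c20 c2h]].
  rewrite -addrA opprD addNKr normrN; apply: le_trans (ler_normD _ _) _.
  rewrite !normrZ !ger0_norm//.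
  by apply: lerD; rewrite -[leRHS]mulr1; apply: ler_pM.
have alg (a1 a2 a3 a4 : R) : a1 - a2 - (a3 - a4) = a1 - a3 - (a2 - a4) by ring.
have [c cP E1] := second_difference x h0 dv dvw.
have [c' c'P E2] := second_difference x h0 dw dwv.
have E : fvw (x + c.1 *: v + c.2 *: w) = fwv (x + c'.1 *: w + c'.2 *: v).
  apply: (mulfI (lt0r_neq0 h0)); apply: (mulfI (lt0r_neq0 h0)).
  apply: etrans (esym E1) _; apply: etrans E2.
  rewrite (addrAC x); exact: alg.
have H1 : ball (fvw x) e (fvw (x + c.1 *: v + c.2 *: w)).
  apply: B1; rewrite -ball_normE /=.
  exact: le_lt_trans (near_x _ _ _ v1 w1 cP) hr1.
have H2 : ball (fwv x) e (fwv (x + c'.1 *: w + c'.2 *: v)).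
  apply: B2; rewrite -ball_normE /=.
  exact: le_lt_trans (near_x _ _ _ w1 v1 c'P) hr2.
move: H1 H2; rewrite -!ball_normE /= E => H1 H2.
have := ltrD H1 H2; rewrite eE ltNge (distrC (fwv x)) => /negP; apply.
apply: le_trans (ler_normD _ _).
by rewrite addrA subrK.
Qed.

Lemma derive_comm f (i j : 'I_d) x : Cn 2 f ->
  'D_(delta_mx 0 i) (fun y => 'D_(delta_mx 0 j) f y) x =
  'D_(delta_mx 0 j) (fun y => 'D_(delta_mx 0 i) f y) x.
Proof.
move=> Cf.
have nd m : `|delta_mx 0 m : 'rV[R]_d| <= 1.
  rewrite [leLHS]/Num.norm /= mx_normrE; apply/bigmax_leP; split=> // ij _.
  by rewrite mxE; case: (_ && _); rewrite ?normr1 ?normr0.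
have D k := fun y => Cn_is_derive k y Cf.
have DD k l := fun y => Cn_is_derive l y (Cn_derive k Cf).
have cDD k l := Cn_continuous (Cn_derive l (Cn_derive k Cf)).
exact: (mixed_derivatives x (nd j) (nd i) (D j) (DD j i) (D i) (DD i j) (cDD j i) (cDD i j)).
Qed.

End schwarz.

(** * Integration coordinate by coordinate *)

Section integral_rV.
Variable R : realType.

Lemma integrable_rV_cons n (f : 'rV[R]_n.+1 -> \bar R) :
  (lebesgue_rV R n.+1).-integrable setT f ->
  (@lebesgue_measure R \x lebesgue_rV R n)%E.-integrable setT (f \o @rV_cons R n).
Proof.
move=> /integrableP[mf foo]; apply/integrableP; split.
  exact: (measurableT_comp mf (@measurable_rV_cons R n)).
move: foo; rewrite /= /rV_measureM.
rewrite (@ge0_integral_pushforward _ _ _ _ _ _ (@measurable_rV_cons R n) _ setT)//.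
by apply: measurableT_comp.
Qed.

Lemma integral_rV_cons n (f : 'rV[R]_n.+1 -> \bar R) :
  (lebesgue_rV R n.+1).-integrable setT f ->
  (\int[lebesgue_rV R n.+1]_x f x =
   \int[@lebesgue_measure R \x lebesgue_rV R n]_p f (rV_cons p))%E.
Proof.
move=> fi; rewrite /= /rV_measureM.
rewrite (@integral_pushforward _ _ _ _ _ _ (@measurable_rV_cons R n) _ setT)//.
- exact: measurable_int fi.
- exact: integrable_rV_cons.
Qed.

Lemma integral_rV_cons12 n (f : 'rV[R]_n.+1 -> \bar R) :
  (lebesgue_rV R n.+1).-integrable setT f ->
  (\int[lebesgue_rV R n.+1]_x f x =
   \int[@lebesgue_measure R]_t \int[lebesgue_rV R n]_y f (rV_cons (t, y)))%E.
Proof.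
move=> fi; rewrite integral_rV_cons// -(integral12_prod_meas1 (integrable_rV_cons fi)).
by [].
Qed.

Lemma integral_rV_cons21 n (f : 'rV[R]_n.+1 -> \bar R) :
  (lebesgue_rV R n.+1).-integrable setT f ->
  (\int[lebesgue_rV R n.+1]_x f x =
   \int[lebesgue_rV R n]_y \int[@lebesgue_measure R]_t f (rV_cons (t, y)))%E.
Proof.
move=> fi; rewrite integral_rV_cons// -(integral21_prod_meas1 (integrable_rV_cons fi)).
by [].
Qed.

Lemma closed_norm_le n (M : R) : closed [set x : 'rV[R]_n | `|x| <= M].
Proof.
apply: (@closed_comp _ _ (fun x : 'rV[R]_n => `|x|) [set t | t <= M]); last exact: closed_le.
by move=> x _; exact: norm_continuous.
Qed.

Lemma bounded_norm_le n (M : R) : bounded_set [set x : 'rV[R]_n | `|x| <= M].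
Proof.
exists M; split; first exact: num_real.
by move=> N MN x /= /le_trans; apply; exact: ltW.
Qed.

Lemma continuous_bounded_on n (f : 'rV[R]_n -> R) (A : set 'rV[R]_n) :
  continuous f -> bounded_set A -> exists2 M : R, 0 <= M & forall x, A x -> `|f x| <= M.
Proof.
move=> cf [M [_ /(_ (M + 1))]]; rewrite ltrDl ltr01 => /(_ isT) AM.
pose B := [set x : 'rV[R]_n | `|x| <= M + 1].
have cB : compact B.
  by apply: bounded_closed_compact; [exact: bounded_norm_le|exact: closed_norm_le].
have : compact (f @` B) by apply: continuous_compact => //; exact: continuous_subspaceT.
move=> /compact_bounded[C [_ /(_ (`|C| + 1))]].
rewrite ltr_pwDr// ?ler_norm// => /(_ isT) fC.
exists (`|C| + 1); first by rewrite addr_ge0.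
by move=> x Ax; apply: fC; exists x => //; exact: AM.
Qed.

Lemma integrable_bounded_support n (f : 'rV[R]_n -> R) (M : R) :
  continuous f -> (forall x, M < `|x| -> f x = 0) ->
  (lebesgue_rV R n).-integrable setT (EFin \o f).
Proof.
move=> cf f0; pose A := [set x : 'rV[R]_n | `|x| <= M].
have mA : measurable A.
  rewrite -[A]setCK; apply: measurableC; apply: open_measurable_rV.
  by rewrite openC; exact: closed_norm_le.
have bA : bounded_set A by exact: bounded_norm_le.
have [C C0 fC] := continuous_bounded_on cf bA.
rewrite (_ : EFin \o f = (EFin \o f) \_ A); last first.
  apply/funext => x; rewrite patchE; case: ifPn => //.
  by rewrite notin_setE => /negP; rewrite -ltNge /= => /f0 ->.
apply/(integrable_mkcond _ mA).
apply: measurable_bounded_integrable => //.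
- exact: bounded_finite_measure.
- by apply: measurable_funTS; exact: continuous_measurable_rV.
- exists C; split; first exact: num_real.
  by move=> N CN x Ax; apply: le_trans (fC x Ax) (ltW CN).
Qed.

End integral_rV.

(** * Vanishing integrals of compactly supported derivatives *)

Section integral_derivative.
Variable R : realType.

Lemma is_derive_reparam (V W : normedModType R) (g : V -> R) (F : W -> R) (y v : V) (x w : W) (l : R) :
  (forall h : R, g (h *: v + y) = F (h *: w + x)) ->
  is_derive x w F l -> is_derive y v g l.
Proof.
move=> gF [dF <-].
have g0 : g y = F x by have := gF 0; rewrite !scale0r !add0r.
have E : (fun h : R => h^-1 *: ((g \o shift y) (h *: v) - g y)) =
    (fun h : R => h^-1 *: ((F \o shift x) (h *: w) - F x)).
  by apply/funext => h /=; rewrite gF g0.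
by apply: DeriveDef; rewrite /derivable /derive E.
Qed.

Lemma derive_outside n (F : sfield R n) (f : 'rV[R]_n -> R) (v : 'rV[R]_n) (M : R) :
  (forall x, is_derive x v F (f x)) -> (forall x, M < `|x| -> F x = 0) ->
  forall x, M < `|x| -> f x = 0.
Proof.
move=> df F0 x Mx; have [_ <-] := df x.
have : is_derive x v F 0.
  apply: (@near_eq_is_derive _ _ _ (fun=> 0) F).
  near=> y; apply/esym/F0; near: y.
  apply: (@norm_continuous _ _ x [set t | M < t]).
  by apply: open_nbhs_nbhs; split=> //; exact: open_gt.
by move=> [_].
Unshelve. all: by end_near. Qed.

Lemma integral_FTC2 (F f : R -> R) (a b : R) : a < b ->
  (forall t, is_derive t (1 : R) F (f t)) -> continuous f ->
  (\int[@lebesgue_measure R]_(t in `[a, b]) (f t)%:E = (F b)%:E - (F a)%:E)%E.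
Proof.
move=> ab dF cf; have cF : continuous F.
  by move=> t; apply/differentiable_continuous/derivable1_diffP; have [] := dF t.
apply: continuous_FTC2 => //.
- exact: continuous_subspaceT.
- split.
  + by move=> t _; have [] := dF t.
  + by apply: cvg_at_right_filter; exact: cF.
  + by apply: cvg_at_left_filter; exact: cF.
- by move=> t _; rewrite derive1E; have [_ ->] := dF t.
Qed.

Lemma integral_itv_support (f : R -> R) (a b : R) :
  (forall t, ~ (a <= t <= b) -> f t = 0) ->
  (\int[@lebesgue_measure R]_t (f t)%:E = \int[@lebesgue_measure R]_(t in `[a, b]) (f t)%:E)%E.
Proof.
move=> f0; rewrite [RHS]integral_mkcond; apply: eq_integral => t _.
rewrite patchE; case: ifPn => // /negP tab; rewrite f0// => h; apply: tab.
by rewrite inE /= in_itv.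
Qed.

Lemma integral_derivative1 (F f : R -> R) (M : R) :
  (forall t, is_derive t (1 : R) F (f t)) -> continuous f ->
  (forall t, M < `|t| -> F t = 0) -> (forall t, M < `|t| -> f t = 0) ->
  (\int[@lebesgue_measure R]_t (f t)%:E = 0)%E.
Proof.
move=> dF cf F0 f0; pose N := `|M| + 1.
have N0 : 0 < N by rewrite ltr_wpDl.
have MN : M < N by rewrite ltr_pwDr// ler_norm.
rewrite (@integral_itv_support f (- N) N); last first.
  move=> t tN; apply: f0; rewrite ltNge; apply/negP => tM; apply: tN.
  by rewrite -ler_norml; apply: le_trans tM (ltW MN).
rewrite (integral_FTC2 _ dF)// ?gtrN//.
by rewrite !F0 ?subee// ?normrN gtr0_norm.
Qed.

Lemma rV_cons_lift n (t : R) (y : 'rV[R]_n) (s : R) j :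
  rV_cons (t : measurableTypeR R, y + s *: delta_mx 0 j) =
  rV_cons (t : measurableTypeR R, y) + s *: delta_mx 0 (lift ord0 j).
Proof.
apply/rowP => i; rewrite !mxE /=; case: (unliftP ord0 i) => [k ->|->] /=.
  by rewrite !mxE (inj_eq lift_inj).
by rewrite mulr0 addr0.
Qed.

Lemma rV_cons_ord0 n (t s : R) (y : 'rV[R]_n) :
  rV_cons (t + s : measurableTypeR R, y) =
  rV_cons (t : measurableTypeR R, y) + s *: delta_mx 0 ord0.
Proof.
apply/rowP => i; rewrite !mxE /=; case: (unliftP ord0 i) => [k ->|->] /=.
  by rewrite mulr0 addr0.
by rewrite ?eqxx mulr1.
Qed.

Lemma norm_rV_cons n (t : R) (y : 'rV[R]_n) :
  `|t| <= `|rV_cons (t : measurableTypeR R, y)| /\ `|y| <= `|rV_cons (t : measurableTypeR R, y)|.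
Proof.
split.
  apply: le_trans (ler_coord_norm _ ord0).
  by rewrite mxE unlift_none.
rewrite [leLHS]/Num.norm /= mx_normrE; apply/bigmax_leP; split=> // -[a j] _ /=.
apply: le_trans (ler_coord_norm _ (lift ord0 j)).
by rewrite mxE liftK (ord1 a).
Qed.

Lemma continuous_rV_consl n (y : 'rV[R]_n) :
  continuous (fun t : R => rV_cons (t : measurableTypeR R, y)).
Proof.
rewrite (_ : (fun t : R => _) = fun t : R => rV_cons (0 : measurableTypeR R, y) + t *: delta_mx 0 ord0).
  by move=> t; apply: cvgD; [exact: cvg_cst|apply: cvgZr_tmp; exact: cvg_id].
by apply/funext => t; rewrite -rV_cons_ord0 add0r.
Qed.

Lemma continuous_rV_consr n (t : R) :
  continuous (fun y : 'rV[R]_n => rV_cons (t : measurableTypeR R, y)).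
Proof.
move=> y; apply/(@cvgrPdist_lt R _ _ (nbhs y) (nbhs_filter y)) => e e0; near=> z.
have -> : rV_cons (t : measurableTypeR R, y) - rV_cons (t : measurableTypeR R, z) =
    rV_cons (0 : measurableTypeR R, y - z).
  apply/rowP => i; rewrite !mxE /=; case: (unliftP ord0 i) => [k _|_] /=.
    by rewrite !mxE.
  by rewrite subrr.
apply: (@le_lt_trans _ _ `|y - z|); last first.
  by near: z; move/cvgrPdist_lt : (@cvg_id _ (nbhs y)); apply.
rewrite [leLHS]/Num.norm /= mx_normrE; apply/bigmax_leP; split=> // -[a j] _ /=.
rewrite mxE /=; case: (unliftP ord0 j) => [k _|_] /=; first exact: ler_coord_norm.
by rewrite normr0.
Unshelve. all: by end_near. Qed.

(** The order of integration in Fubini's theorem follows [j]: if [j] is not the first coordinate,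
    the remaining coordinates are integrated innermost and induction applies to each slice;
    otherwise the first coordinate is innermost and the fundamental theorem of calculus applies. *)
Lemma integral_derivative n (j : 'I_n) (F f : sfield R n) (M : R) :
  (forall x, is_derive x (delta_mx 0 j : 'rV[R]_n) F (f x)) -> continuous f ->
  (forall x, M < `|x| -> F x = 0) ->
  (\int[lebesgue_rV R n]_x (f x)%:E = 0)%E.
Proof.
elim: n j F f => [[]//|n IH j F f dF cf F0].
have f0 := derive_outside dF F0.
have fi := integrable_bounded_support cf f0.
case: (unliftP ord0 j) => [k jk|jk].
  rewrite integral_rV_cons12//; rewrite integral0_eq// => t _.
  apply: (IH k (fun y => F (rV_cons (t : measurableTypeR R, y)))).
  - move=> y; apply: is_derive_reparam (dF (rV_cons (t : measurableTypeR R, y))) => h.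
    by rewrite jk addrC rV_cons_lift addrC.
  - by move=> y; apply: (continuous_comp (@continuous_rV_consr n t y)); exact: cf.
  - move=> y My; apply: F0; apply: lt_le_trans My _; exact: (norm_rV_cons t y).2.
rewrite integral_rV_cons21//; rewrite integral0_eq// => y _.
apply: (@integral_derivative1 (fun t => F (rV_cons (t : measurableTypeR R, y))) _ M).
- move=> t; apply: is_derive_reparam (dF (rV_cons (t : measurableTypeR R, y))) => h.
  by rewrite jk addrC rV_cons_ord0 addrC [h%:A]mulr1.
- by move=> t; apply: (continuous_comp (@continuous_rV_consl n y t)); exact: cf.
- by move=> t Mt; apply: F0; apply: lt_le_trans Mt _; exact: (norm_rV_cons t y).1.
- by move=> t Mt; apply: f0; apply: lt_le_trans Mt _; exact: (norm_rV_cons t y).1.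
Qed.

End integral_derivative.

(** * Polynomial functions *)

Section poly_functions.
Variables (R : realType) (d : nat).
Implicit Types (f g : sfield R d) (w : seq 'I_d) (s : seq (R * seq 'I_d)).

(* A polynomial is represented by a list of coefficients and words in the
   coordinates, on which degrees and products are read off. *)
Definition word_mon w (x : 'rV[R]_d) : R := \prod_(i <- w) x 0 i.

Definition word_poly s (x : 'rV[R]_d) : R := \sum_(q <- s) q.1 * word_mon q.2 x.

Lemma word_monE w x : word_mon w x = \prod_i x 0 i ^+ count_mem i w.
Proof.
elim: w => [|j w IH]; first by rewrite /word_mon big_nil big1.
rewrite /word_mon big_cons -/(word_mon w x) IH [RHS](bigD1 j)//= [in LHS](bigD1 j)//=.
rewrite eqxx exprD expr1 -!mulrA; congr (_ * (_ * _)).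
by apply: eq_bigr => i ij; rewrite eq_sym (negbTE ij).
Qed.

Lemma sum_count w : (\sum_(i < d) count_mem i w)%N = size w.
Proof.
elim: w => [|j w IH]; first by rewrite big1.
by rewrite /= big_split /= IH (bigD1 j)//= eqxx big1 // => i; rewrite eq_sym => /negbTE ->.
Qed.

Lemma poly_fun_add r f g : poly_fun r f -> poly_fun r g -> poly_fun r (fun x => f x + g x).
Proof.
move=> [c fc] [c' gc]; exists (fun al => c al + c' al) => x.
by rewrite fc gc -big_split; apply: eq_bigr => al _; rewrite mulrDl.
Qed.

Lemma poly_fun_scale r a f : poly_fun r f -> poly_fun r (fun x => a * f x).
Proof.
move=> [c fc]; exists (fun al => a * c al) => x.
by rewrite fc mulr_sumr; apply: eq_bigr => al _; rewrite mulrA.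
Qed.

Lemma poly_fun_word_mon r w : (size w <= r)%N -> poly_fun r (word_mon w).
Proof.
move=> wr; have cw i : (count_mem i w < r.+1)%N by rewrite ltnS (leq_trans (count_size _ _)).
pose al0 : {ffun 'I_d -> 'I_r.+1} := [ffun i => Ordinal (cw i)].
exists (fun al => (al == al0)%:R) => x.
rewrite (bigD1 al0) /=; last by under eq_bigr do rewrite ffunE; rewrite sum_count.
rewrite eqxx mul1r [X in _ + X]big1 ?addr0 => [|al /andP[_ /negbTE ->]]; last by rewrite mul0r.
by rewrite word_monE; apply: eq_bigr => i _; rewrite ffunE.
Qed.

Lemma poly_fun_wordP r f : poly_fun r f <->
  exists2 s, all (fun q => size q.2 <= r)%N s & forall x, f x = word_poly s x.
Proof.
split=> [[c fc]|[s sr fs]].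
  pose wd (al : {ffun 'I_d -> 'I_r.+1}) := flatten [seq nseq (al i) i | i <- enum 'I_d].
  exists [seq (c al, wd al) | al : {ffun 'I_d -> 'I_r.+1} <- enum {: {ffun 'I_d -> 'I_r.+1}} & (\sum_i al i <= r)%N].
    apply/allP => q /mapP[al]; rewrite mem_filter => /andP[alr _] -> /=.
    rewrite size_flatten /shape -map_comp sumnE big_map big_enum /=.
    by under eq_bigr do rewrite size_nseq.
  move=> x; rewrite fc /word_poly big_map big_filter big_enum_cond /=.
  apply: eq_bigr => al _; congr (_ * _).
  rewrite /word_mon big_flatten big_map big_enum /=; apply: eq_bigr => i _.
  by rewrite big_nseq -Monoid.iteropE.
rewrite (_ : f = word_poly s); last exact/funext.
elim: s sr {fs} => [_|q s IH /= /andP[qr sr]].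
  rewrite (_ : word_poly [::] = (fun x => 0 * word_mon [::] x)).
    by apply: poly_fun_scale; exact: poly_fun_word_mon.
  by apply/funext => x; rewrite /word_poly big_nil mul0r.
rewrite (_ : word_poly _ = (fun x => q.1 * word_mon q.2 x + word_poly s x)).
  apply: poly_fun_add; last exact: IH.
  by apply: poly_fun_scale; exact: poly_fun_word_mon.
by apply/funext => x; rewrite /word_poly big_cons.
Qed.

Lemma poly_fun_leq r r' f : (r <= r')%N -> poly_fun r f -> poly_fun r' f.
Proof.
move=> rr' /poly_fun_wordP[s sr fs]; apply/poly_fun_wordP; exists s => //.
by apply: sub_all sr => q /leq_trans; apply.
Qed.

Lemma poly_fun_const r a : poly_fun r (fun _ : 'rV[R]_d => a).
Proof.
apply/poly_fun_wordP; exists [:: (a, [::])] => // x.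
by rewrite /word_poly big_seq1 /word_mon big_nil mulr1.
Qed.

Lemma poly_fun_opp r f : poly_fun r f -> poly_fun r (fun x => - f x).
Proof.
move=> /(poly_fun_scale (-1)); rewrite (_ : (fun x => -1 * _) = (fun x => - f x))//.
by apply/funext => x; rewrite mulN1r.
Qed.

Lemma poly_fun_sub r f g : poly_fun r f -> poly_fun r g -> poly_fun r (fun x => f x - g x).
Proof. by move=> pf /poly_fun_opp; exact: poly_fun_add. Qed.

Lemma poly_fun_sum (J : Type) (l : seq J) (P : pred J) r (F : J -> sfield R d) :
  (forall i, P i -> poly_fun r (F i)) -> poly_fun r (fun x => \sum_(i <- l | P i) F i x).
Proof.
move=> PF; elim: l => [|i l IH].
  by under [fun x => _]eq_fun do rewrite big_nil; exact: poly_fun_const.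
under [fun x => _]eq_fun do rewrite big_cons.
by have [Pi|] := boolP (P i) => //; apply: poly_fun_add => //; exact: PF.
Qed.

Lemma poly_fun_coordM r (i : 'I_d) f :
  poly_fun r f -> poly_fun r.+1 (fun x : 'rV[R]_d => x 0 i * f x).
Proof.
move=> /poly_fun_wordP[s sr fs]; apply/poly_fun_wordP.
exists [seq (q.1, i :: q.2) | q <- s]; first by rewrite all_map.
move=> x; rewrite fs /word_poly big_map mulr_sumr; apply: eq_bigr => q _.
by rewrite /word_mon /= big_cons mulrCA.
Qed.

Lemma word_poly_Cn n s : Cn n (word_poly s).
Proof.
apply: Cn_sum => q _; apply: Cn_mul; first exact: Cn_const.
by apply: Cn_prod => i _; exact: Cn_coord.
Qed.

Lemma poly_fun_smooth r f : poly_fun r f -> smooth f.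
Proof.
move=> /poly_fun_wordP[s _ fs] n; rewrite (_ : f = word_poly s); last exact/funext.
exact: word_poly_Cn.
Qed.

(** At r = 0 the bound [r.-1] only says that the derivative is constant; the clause for r = 0
    records that it vanishes. It keeps $x_i\,\partial_j f$ of degree at most r in that case too. *)
Lemma is_derive_word_mon (j : 'I_d) w r : (size w <= r)%N ->
  exists2 f', poly_fun r.-1 f' &
    (r = 0%N -> forall x, f' x = 0) /\
    forall x, is_derive x (delta_mx 0 j : 'rV[R]_d) (word_mon w) (f' x).
Proof.
elim: w r => [|i w IH] r wr.
  exists (fun=> 0); first exact: poly_fun_const.
  split=> // x; rewrite (_ : word_mon [::] = fun=> 1); first exact: (is_derive_cst (1 : R)).
  by apply/funext => y; rewrite /word_mon big_nil.
case: r wr => // r; rewrite /= ltnS => wr.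
have [f' pf' [f'0 df']] := IH r wr.
exists (fun x : 'rV[R]_d => x 0 i * f' x + (i == j)%:R * word_mon w x).
  apply: poly_fun_add; last by apply: poly_fun_scale; exact: poly_fun_word_mon.
  case: r wr pf' f'0 {IH} => [|r] wr pf' f'0; last exact: poly_fun_coordM.
  rewrite (_ : (fun x => _) = fun=> 0); first exact: poly_fun_const.
  by apply/funext => x; rewrite f'0// mulr0.
split=> // x; rewrite (_ : word_mon (i :: w) = (fun y => y 0 i * word_mon w y)).
  apply: (is_derive_eq (is_deriveM (is_derive_coord i j x) (df' x))).
  by congr (_ + _); exact: mulrC.
by apply/funext => y; rewrite /word_mon big_cons.
Qed.

Lemma poly_fun_derive r f (j : 'I_d) : poly_fun r f ->
  poly_fun r.-1 (fun x => 'D_(delta_mx 0 j) f x) /\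
  (r = 0%N -> forall x, 'D_(delta_mx 0 j) f x = 0).
Proof.
move=> /poly_fun_wordP[s sr fs]; rewrite (_ : f = word_poly s); last exact/funext.
suff [f' pf' [f'0 df']] : exists2 f', poly_fun r.-1 f' &
    (r = 0%N -> forall x, f' x = 0) /\
    forall x, is_derive x (delta_mx 0 j : 'rV[R]_d) (word_poly s) (f' x).
  have E : (fun x => 'D_(delta_mx 0 j) (word_poly s) x) = f'.
    by apply/funext => x; have [_ ->] := df' x.
  by rewrite E; split=> // r0 x; have [_ ->] := df' x; exact: f'0.
elim: s sr {fs} => [_|q s IH /= /andP[qr sr]].
  exists (fun=> 0); first exact: poly_fun_const.
  split=> // x; rewrite (_ : word_poly [::] = fun=> 0); first exact: (is_derive_cst (0 : R)).
  by apply/funext => y; rewrite /word_poly big_nil.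
have [f' pf' [f'0 df']] := IH sr.
have [g' pg' [g'0 dg']] := is_derive_word_mon j qr.
exists (fun x => q.1 * g' x + f' x).
  by apply: poly_fun_add => //; exact: poly_fun_scale.
split=> [r0 x|x]; first by rewrite f'0// g'0// mulr0 addr0.
rewrite (_ : word_poly (q :: s) = (fun y => q.1 * word_mon q.2 y + word_poly s y)).
  exact: (is_deriveD (is_deriveZ q.1 (dg' x)) (df' x)).
by apply/funext => y; rewrite /word_poly big_cons.
Qed.

Lemma poly_fun_coord_derive r f (i j : 'I_d) : poly_fun r f ->
  poly_fun r (fun x : 'rV[R]_d => x 0 i * 'D_(delta_mx 0 j) f x).
Proof.
move=> pf; have [pD D0] := poly_fun_derive j pf.
case: r pf pD D0 => [|r] pf pD D0; last exact: poly_fun_coordM.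
rewrite (_ : (fun x => _) = fun=> 0); first exact: poly_fun_const.
by apply/funext => x; rewrite D0// mulr0.
Qed.

End poly_functions.

(** * Square-integrable fields *)

Section L2_space.
Variables (R : realType) (d : nat) (D : set 'rV[R]_d).
Hypotheses (mD : measurable D) (finD : (lebesgue_rV R d D < +oo)%E).
Local Notation mu := (lebesgue_rV R d).
Implicit Types (f g h : sfield R d) (u v w : vfield R d).

Definition integ f := mu.-integrable D (EFin \o f).

(** Triple products such as $\rho|u|^2$ are not controlled by [L2]. Bounded measurable functions
    form an algebra and, as [D] has finite measure, are integrable and square-integrable. *)
Definition bdd f := measurable_fun D f /\ exists M : R, forall x, D x -> `|f x| <= M.

Lemma integ_add f g : integ f -> integ g -> integ (fun x => f x + g x).
Proof. by move=> fi gi; have := integrableD mD fi gi. Qed.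

Lemma integ_scale a f : integ f -> integ (fun x => a * f x).
Proof. by move=> fi; have := integrableZl mD a fi. Qed.

Lemma integ_opp f : integ f -> integ (fun x => - f x).
Proof. by move=> /(integ_scale (-1)); rewrite /integ;
  under [X in _.-integrable _ (_ \o X)]eq_fun do rewrite mulN1r. Qed.

Lemma integ_sub f g : integ f -> integ g -> integ (fun x => f x - g x).
Proof. by move=> fi /integ_opp; exact: integ_add. Qed.

Lemma integ_sum (J : Type) (r : seq J) (P : pred J) (F : J -> sfield R d) :
  (forall i, P i -> integ (F i)) -> integ (fun x => \sum_(i <- r | P i) F i x).
Proof.
move=> Fi; elim: r => [|i r IH].
  rewrite /integ; under [X in _.-integrable _ (_ \o X)]eq_fun do rewrite big_nil.
  exact: integrable0.
rewrite /integ; under [X in _.-integrable _ (_ \o X)]eq_fun do rewrite big_cons.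
by have [Pi|//] := boolP (P i); apply: integ_add => //; exact: Fi.
Qed.

Lemma integ_le f g : measurable_fun D f -> integ g ->
  (forall x, D x -> `|f x| <= g x) -> integ f.
Proof.
move=> mf gi fg; apply: (le_integrable mD _ _ gi); first exact/measurable_EFinP.
by move=> x Dx /=; rewrite lee_fin (le_trans (fg x Dx))// ler_norm.
Qed.

Lemma integ_measurable f : integ f -> measurable_fun D f.
Proof. by move=> /measurable_int/measurable_EFinP. Qed.

Lemma bdd_integ f : bdd f -> integ f.
Proof.
move=> [mf [M fM]]; apply: measurable_bounded_integrable => //.
exists M; split; first exact: num_real.
by move=> N MN x Dx; exact: le_trans (fM x Dx) (ltW MN).
Qed.

Lemma bdd_const a : bdd (fun=> a).
Proof. by split; [exact: measurable_cst|exists `|a|]. Qed.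

Lemma bdd_add f g : bdd f -> bdd g -> bdd (fun x => f x + g x).
Proof.
move=> [mf [M fM]] [mg [N gN]]; split; first exact: measurable_funD.
exists (M + N) => x Dx; apply: le_trans (ler_normD _ _) _.
by apply: lerD; [exact: fM|exact: gN].
Qed.

Lemma bdd_mul f g : bdd f -> bdd g -> bdd (fun x => f x * g x).
Proof.
move=> [mf [M fM]] [mg [N gN]]; split; first exact: measurable_funM.
by exists (M * N) => x Dx; rewrite normrM; apply: ler_pM => //; [exact: fM|exact: gN].
Qed.

Lemma bdd_scale a f : bdd f -> bdd (fun x => a * f x).
Proof. by apply: bdd_mul; exact: bdd_const. Qed.

Lemma bdd_opp f : bdd f -> bdd (fun x => - f x).
Proof.
move=> /(bdd_scale (-1)); rewrite (_ : (fun x => -1 * _) = (fun x => - f x))//.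
by apply/funext => x; rewrite mulN1r.
Qed.

Lemma bdd_sub f g : bdd f -> bdd g -> bdd (fun x => f x - g x).
Proof. by move=> fi /bdd_opp; exact: bdd_add. Qed.

Lemma bdd_sum (J : Type) (r : seq J) (P : pred J) (F : J -> sfield R d) :
  (forall i, P i -> bdd (F i)) -> bdd (fun x => \sum_(i <- r | P i) F i x).
Proof.
move=> Fi; elim: r => [|i r IH].
  by under [fun x => _]eq_fun do rewrite big_nil; exact: bdd_const.
under [fun x => _]eq_fun do rewrite big_cons.
by have [Pi|//] := boolP (P i); apply: bdd_add => //; exact: Fi.
Qed.

Lemma L2_mul_integ f g : L2 D f -> L2 D g -> integ (fun x => f x * g x).
Proof.
move=> [mf fi] [mg gi]; apply: (@integ_le _ (fun x => f x ^+ 2 + g x ^+ 2)).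
- exact: measurable_funM.
- exact: integ_add.
- move=> x Dx; rewrite ler_norml.
  have := sqr_ge0 (f x - g x); have := sqr_ge0 (f x + g x).
  have := sqr_ge0 (f x); have := sqr_ge0 (g x).
  by rewrite sqrrB sqrrD !mulr2n; lra.
Qed.

Lemma bdd_L2 f : bdd f -> L2 D f.
Proof.
move=> bf; split; first by case: bf.
by have := bdd_integ (bdd_mul bf bf); rewrite /integ.
Qed.

Lemma L2_integ f : L2 D f -> integ f.
Proof.
move=> fi; have := L2_mul_integ fi (bdd_L2 (bdd_const 1)).
by rewrite /integ; under [X in _.-integrable _ (_ \o X)]eq_fun do rewrite mulr1.
Qed.

Lemma L2_add f g : L2 D f -> L2 D g -> L2 D (fun x => f x + g x).
Proof.
move=> fL gL; have [[mf fi] [mg gi]] := (fL, gL); split; first exact: measurable_funD.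
have := integ_add (integ_add fi gi) (integ_scale 2 (L2_mul_integ fL gL)).
rewrite /integ (_ : _ \o _ = (fun x => ((f x + g x) ^+ 2)%:E))//.
by apply/funext => x /=; congr EFin; ring.
Qed.

Lemma bdd_L2_mul f g : bdd f -> L2 D g -> L2 D (fun x => f x * g x).
Proof.
move=> [mf [M fM]] [mg gi]; split; first exact: measurable_funM.
apply: (@integ_le (fun x => (f x * g x) ^+ 2) (fun x => M ^+ 2 * g x ^+ 2)).
- by apply: measurable_funX; exact: measurable_funM.
- exact: integ_scale.
- move=> x Dx; rewrite ger0_norm ?sqr_ge0// exprMn ler_wpM2r ?sqr_ge0//.
  rewrite -(real_normK (num_real (f x))) lerXn2r ?nnegrE//; last exact: fM.
  exact: le_trans (fM x Dx).
Qed.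

Lemma L2_scale a f : L2 D f -> L2 D (fun x => a * f x).
Proof. by apply: bdd_L2_mul; exact: bdd_const. Qed.

Lemma L2_opp f : L2 D f -> L2 D (fun x => - f x).
Proof.
move=> /(L2_scale (-1)); rewrite (_ : (fun x => -1 * _) = (fun x => - f x))//.
by apply/funext => x; rewrite mulN1r.
Qed.

Lemma L2_sub f g : L2 D f -> L2 D g -> L2 D (fun x => f x - g x).
Proof. by move=> fi /L2_opp; exact: L2_add. Qed.

Lemma L2_0 : L2 D (fun=> 0).
Proof. exact/bdd_L2/bdd_const. Qed.

Lemma ipC f g : ip D f g = ip D g f.
Proof. by rewrite /ip; under eq_Rintegral do rewrite mulrC. Qed.

Lemma ip_addl f g h : L2 D f -> L2 D g -> L2 D h ->
  ip D (fun x => f x + g x) h = ip D f h + ip D g h.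
Proof.
move=> fi gi hi; rewrite /ip -RintegralD//; last 2 first.
- exact: L2_mul_integ.
- exact: L2_mul_integ.
by apply: eq_Rintegral => x _; rewrite mulrDl.
Qed.

Lemma ip_scalel a f g : L2 D f -> L2 D g ->
  ip D (fun x => a * f x) g = a * ip D f g.
Proof.
move=> fi gi; rewrite /ip -RintegralZl//; last exact: L2_mul_integ.
by apply: eq_Rintegral => x _; rewrite mulrA.
Qed.

Lemma ip_ge0 f : 0 <= ip D f f.
Proof. by apply: Rintegral_ge0 => x _; rewrite -expr2 sqr_ge0. Qed.

(** As $\langle f,f\rangle=0$, the squared norm of $tf+g$ is an affine function of t; being
    nonnegative for all t, it has slope zero. *)
Lemma ip_null f g : L2 D f -> L2 D g -> ip D f f = 0 -> ip D f g = 0.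
Proof.
move=> fi gi f0.
have H t : 0 <= 2 * t * ip D f g + ip D g g.
  have := ip_ge0 (fun x => t * f x + g x).
  have tf := L2_scale t fi.
  rewrite ip_addl//; last exact: L2_add.
  rewrite ip_scalel//; last exact: L2_add.
  rewrite ![ip D _ (fun x => t * f x + g x)]ipC !ip_addl// !ip_scalel// f0.
  by rewrite [ip D g f]ipC mulr0 add0r; lra.
apply/eqP/negPn/negP => ne; pose a := ip D f g.
(* This value of t makes the affine function equal to -1. *)
have := H (- (ip D g g + 1) / 2 / a); rewrite -/a.
have -> : 2 * (- (ip D g g + 1) / 2 / a) * a = - (ip D g g + 1) by field.
by lra.
Qed.

End L2_space.

Section vector_L2_space.
Variables (R : realType) (d : nat) (D : set 'rV[R]_d).
Hypotheses (mD : measurable D) (finD : (lebesgue_rV R d D < +oo)%E).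
Implicit Types (u v w : vfield R d).

Lemma vcompD i u v : vcomp i (fun x => u x + v x) = fun x => vcomp i u x + vcomp i v x.
Proof. by apply/funext => x; rewrite /vcomp mxE. Qed.

Lemma vcompZ i a u : vcomp i (fun x => a *: u x) = fun x => a * vcomp i u x.
Proof. by apply/funext => x; rewrite /vcomp mxE. Qed.

Lemma vcompB i u v : vcomp i (fun x => u x - v x) = fun x => vcomp i u x - vcomp i v x.
Proof. by apply/funext => x; rewrite /vcomp !mxE. Qed.

Lemma vL2_add u v : vL2 D u -> vL2 D v -> vL2 D (fun x => u x + v x).
Proof. by move=> ui vi i; rewrite vcompD; exact: L2_add. Qed.

Lemma vL2_scale a u : vL2 D u -> vL2 D (fun x => a *: u x).
Proof. by move=> ui i; rewrite vcompZ; exact: L2_scale. Qed.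

Lemma vL2_sub u v : vL2 D u -> vL2 D v -> vL2 D (fun x => u x - v x).
Proof. by move=> ui vi i; rewrite vcompB; exact: L2_sub. Qed.

Lemma dot_integ u v : vL2 D u -> vL2 D v -> integ D (fun x => dot (u x) (v x)).
Proof. by move=> ui vi; apply: integ_sum => // i _; exact: (L2_mul_integ mD (ui i) (vi i)). Qed.

Lemma Rintegral_sum (J : Type) (r : seq J) (F : J -> sfield R d) :
  (forall i, integ D (F i)) ->
  \int[lebesgue_rV R d]_(x in D) (\sum_(i <- r) F i x) =
  \sum_(i <- r) \int[lebesgue_rV R d]_(x in D) F i x.
Proof.
move=> Fi; elim: r => [|i r IH].
  rewrite big_nil; under eq_Rintegral do rewrite big_nil.
  by rewrite Rintegral_cst// mul0r.
rewrite big_cons -IH -RintegralD//; [|exact: Fi|exact: integ_sum].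
by apply: eq_Rintegral => x _; rewrite big_cons.
Qed.

Lemma vipE u v : vL2 D u -> vL2 D v -> vip D u v = \sum_i ip D (vcomp i u) (vcomp i v).
Proof.
move=> ui vi; rewrite /vip /ip -(@Rintegral_sum _ _ (fun i x => vcomp i u x * vcomp i v x))//.
by move=> i; exact: (L2_mul_integ mD (ui i) (vi i)).
Qed.

Lemma dotC m (a b : 'rV[R]_m) : dot a b = dot b a.
Proof. by apply: eq_bigr => i _; rewrite mulrC. Qed.

Lemma dotDl m (a b c : 'rV[R]_m) : dot (a + b) c = dot a c + dot b c.
Proof. by rewrite /dot -big_split /=; apply: eq_bigr => i _; rewrite mxE mulrDl. Qed.

Lemma dotZl m t (a c : 'rV[R]_m) : dot (t *: a) c = t * dot a c.
Proof. by rewrite /dot mulr_sumr; apply: eq_bigr => i _; rewrite mxE mulrA. Qed.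

Lemma vipC u v : vip D u v = vip D v u.
Proof. by apply: eq_Rintegral => x _; rewrite dotC. Qed.

Lemma vip_addl u v w : vL2 D u -> vL2 D v -> vL2 D w ->
  vip D (fun x => u x + v x) w = vip D u w + vip D v w.
Proof.
move=> ui vi wi; rewrite /vip -RintegralD//; try exact: dot_integ.
by apply: eq_Rintegral => x _; rewrite dotDl.
Qed.

Lemma vip_scalel a u w : vL2 D u -> vL2 D w ->
  vip D (fun x => a *: u x) w = a * vip D u w.
Proof.
move=> ui wi; rewrite /vip -RintegralZl//; last exact: dot_integ.
by apply: eq_Rintegral => x _; rewrite dotZl.
Qed.

Lemma vip_subl u v w : vL2 D u -> vL2 D v -> vL2 D w ->
  vip D (fun x => u x - v x) w = vip D u w - vip D v w.
Proof.
move=> ui vi wi; rewrite /vip -RintegralB//; try exact: dot_integ.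
by apply: eq_Rintegral => x _; rewrite dotDl -scaleN1r dotZl mulN1r.
Qed.

Lemma vip_scaler a u w : vL2 D u -> vL2 D w ->
  vip D w (fun x => a *: u x) = a * vip D w u.
Proof. by move=> ui wi; rewrite vipC vip_scalel// vipC. Qed.

Lemma vip_ge0 u : 0 <= vip D u u.
Proof. by apply: Rintegral_ge0 => x _; apply: sumr_ge0 => i _; rewrite -expr2 sqr_ge0. Qed.

Lemma vip_null_comp u i : vL2 D u -> vip D u u = 0 -> ip D (vcomp i u) (vcomp i u) = 0.
Proof.
move=> ui; rewrite vipE// => /eqP; rewrite psumr_eq0 => [/allP/(_ i)|j _]; last exact: ip_ge0.
by rewrite mem_index_enum => /(_ isT)/eqP.
Qed.

Lemma vip_null u v : vL2 D u -> vL2 D v -> vip D u u = 0 -> vip D u v = 0.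
Proof.
move=> ui vi u0; rewrite vipE// big1// => i _.
by apply: ip_null => //; exact: vip_null_comp.
Qed.

End vector_L2_space.

(** * Piecewise smooth fields on a mesh *)

Section mesh.
Variables (R : realType) (d N : nat) (T : 'I_N -> simplex R d).
Hypothesis d_gt0 : (0 < d)%N.
Hypothesis ndT : forall k, Defs.nondegenerate (T k).
Hypothesis disjT : forall k l, k != l -> open_simplex (T k) `&` open_simplex (T l) = set0.
Implicit Types (f g phi : sfield R d) (k l : 'I_N).

Definition mesh : set 'rV[R]_d := \bigcup_k open_simplex (T k).

Local Notation D := mesh.
Local Notation mu := (lebesgue_rV R d).

Lemma open_mesh : open D.
Proof. by apply: bigcup_open => k _; exact: open_open_simplex. Qed.

Lemma measurable_mesh : measurable D.
Proof. by apply: open_measurable_rV; exact: open_mesh. Qed.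

Lemma bounded_bigcup_closed_simplex : bounded_set (\bigcup_k closed_simplex (T k)).
Proof.
have /choice[M MP] k : exists M : R, forall x, closed_simplex (T k) x -> `|x| <= M.
  have [M [_ MP]] := bounded_closed_simplex (T k).
  by exists (M + 1) => x Kx; apply: (MP (M + 1)) => //; rewrite ltrDl.
exists (\sum_k `|M k|); split; first exact: num_real.
move=> c ltc x [k _ Kx]; apply: le_trans (ltW ltc); apply: le_trans (MP k x Kx) _.
apply: le_trans (ler_norm _) _; rewrite (bigD1 k)//= lerDl; exact: sumr_ge0.
Qed.

Lemma bounded_sub (A B : set 'rV[R]_d) : A `<=` B -> bounded_set B -> bounded_set A.
Proof. by move=> AB [M [Mr MB]]; exists M; split=> // c Mc x /AB; exact: MB. Qed.

Lemma bounded_mesh : bounded_set D.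
Proof.
apply: bounded_sub bounded_bigcup_closed_simplex => x [k _ Kx].
by exists k => //; exact: open_simplex_sub.
Qed.

Lemma finite_mesh : (mu D < +oo)%E.
Proof. by apply: bounded_finite_measure; [exact: bounded_mesh|exact: measurable_mesh]. Qed.

Let mD := measurable_mesh.
Let finD := finite_mesh.

Lemma open_simplex_uniq k l x : open_simplex (T k) x -> open_simplex (T l) x -> k = l.
Proof.
move=> kx lx; apply/eqP/negPn/negP => /disjT/seteqP[/(_ x) + _]; exact.
Qed.

Definition glue (P : 'I_N -> sfield R d) : sfield R d :=
  fun x => \sum_k \1_(open_simplex (T k)) x * P k x.

Lemma glueE (P : 'I_N -> sfield R d) k x : open_simplex (T k) x -> glue P x = P k x.
Proof.
move=> kx; rewrite /glue (bigD1 k)//= indicE mem_set// mul1r big1 ?addr0// => l lk.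
rewrite indicE memNset ?mul0r// => lx; move/eqP: lk; apply.
exact: open_simplex_uniq lx kx.
Qed.

Lemma glue_out (P : 'I_N -> sfield R d) x : ~ D x -> glue P x = 0.
Proof.
move=> Dx; rewrite /glue big1// => k _.
by rewrite indicE memNset ?mul0r// => kx; apply: Dx; exists k.
Qed.

Lemma measurable_glue (P : 'I_N -> sfield R d) A : (forall k, continuous (P k)) ->
  measurable_fun A (glue P).
Proof.
move=> cP; apply: (measurable_funS measurableT) => //; rewrite /glue.
apply: measurable_sum => k; apply: measurable_funM.
  by apply: measurable_indic; apply: open_measurable_rV; exact: open_open_simplex.
exact: continuous_measurable_rV.
Qed.

(* Only the values in the open simplices matter: the faces form a null set. *)
Definition pws f := forall k, exists2 p, smooth p &
  forall x, open_simplex (T k) x -> f x = p x.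

Lemma smooth_continuous f : smooth f -> continuous f.
Proof. by move=> /(_ 0%N)/Cn_continuous. Qed.

Lemma smooth_pws f : smooth f -> pws f.
Proof. by move=> sf k; exists f. Qed.

Lemma pws_rep f : pws f -> exists2 P : 'I_N -> sfield R d, (forall k, smooth (P k)) &
  forall k x, open_simplex (T k) x -> f x = P k x.
Proof.
by move=> /(_ _)/cid2-/all_sig2[P sP fP]; exists P.
Qed.

Lemma pws_bdd f : pws f -> bdd D f.
Proof.
move=> /pws_rep[P sP fP]; have cP k := smooth_continuous (sP k).
split.
  apply: (@eq_measurable_fun _ _ _ _ D (glue P)); last exact: measurable_glue.
  by move=> x /set_mem[k _ kx]; rewrite (fP k x kx) (glueE _ kx).
have /choice[M MP] k : exists M : R, forall x, closed_simplex (T k) x -> `|P k x| <= M.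
  by have [M _ MP] := continuous_bounded_on (cP k) (bounded_closed_simplex (T k)); exists M.
exists (\sum_k `|M k|) => x [k _ kx]; rewrite (fP k x kx).
apply: (@le_trans _ _ (M k)).
  by apply: MP; exact: open_simplex_sub.
by apply: le_trans (ler_norm _) _; rewrite (bigD1 k)//= lerDl; exact: sumr_ge0.
Qed.

Lemma near_eq_continuous_at f g x : (\near x, f x = g x) -> continuous g ->
  {for x, continuous f}.
Proof.
move=> fg cg; rewrite /prop_for /continuous_at (nbhs_singleton fg).
move=> A /cg gA; rewrite /nbhs /=; apply: filterS2 fg gA => y fgy.
by rewrite /preimage /= fgy.
Qed.

Lemma test_near0 (O : set 'rV[R]_d) phi x : test O phi -> ~ O x -> \forall y \near x, phi y = 0.
Proof.
move=> [_ _ sO] Ox; pose U := ~` closure [set x | phi x != 0].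
have oU : open U by rewrite openC; exact: closed_closure.
have Ux : U x by move=> /sO.
have : nbhs x U by exact: open_nbhs_nbhs.
apply: filterS => y Uy; apply/eqP/negPn/negP => phiy.
by apply: Uy; apply: subset_closure.
Qed.

Lemma test_near0_derive (O : set 'rV[R]_d) phi x (v : 'rV[R]_d) : test O phi -> ~ O x ->
  \forall y \near x, 'D_v phi y = 0.
Proof.
move=> tphi Ox; have /nbhs_interior := test_near0 tphi Ox.
apply: filterS => y Hy; rewrite (@near_eq_derive _ _ _ phi (cst 0))//.
exact: derive_cst.
Qed.

Lemma test_support (O : set 'rV[R]_d) phi : test O phi ->
  exists M : R, forall x, M < `|x| -> phi x = 0.
Proof.
move=> [_ /compact_bounded[M [_ H']] _].
have H := H' (`|M| + 1); exists (`|M| + 1) => x Mx.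
apply/eqP/negPn/negP => phix.
have : `|x| <= `|M| + 1 by apply: H; [rewrite ltr_pwDr// ler_norm|exact: subset_closure].
by rewrite leNgt Mx.
Qed.

Lemma near_open_simplex k x : open_simplex (T k) x ->
  \forall y \near x, open_simplex (T k) y.
Proof. by move=> kx; apply: open_nbhs_nbhs; split=> //; exact: open_open_simplex. Qed.

(** As [phi] vanishes near every point outside the open simplices, the products of [P k] and [phi]
    glue to a function differentiable everywhere with continuous derivative. The integral of that
    derivative is zero, and no face term arises. *)
Lemma ibp_mesh f g j phi (P : 'I_N -> sfield R d) :
  (forall k, smooth (P k)) ->
  (forall k x, open_simplex (T k) x -> f x = P k x) ->
  (forall k x, open_simplex (T k) x -> g x = 'D_(delta_mx 0 j) (P k) x) ->
  test D phi ->
  ip D f (fun x => 'D_(delta_mx 0 j) phi x) = - ip D g phi.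
Proof.
move=> sP fP gP tphi; have [sphi _ _] := tphi.
pose F := glue (fun k x => P k x * phi x).
pose dF k x := P k x * 'D_(delta_mx 0 j) phi x + phi x * 'D_(delta_mx 0 j) (P k) x.
pose G := glue dF.
have nearF k x : open_simplex (T k) x -> \forall y \near x, P k y * phi y = F y.
  by move=> /near_open_simplex; apply: filterS => y ky; rewrite /F (glueE _ ky).
have nearG k x : open_simplex (T k) x -> \forall y \near x, G y = dF k y.
  by move=> /near_open_simplex; apply: filterS => y ky; rewrite /G (glueE _ ky).
have F0 x : ~ D x -> \forall y \near x, 0 = F y.
  move=> /(test_near0 tphi); apply: filterS => y phiy.
  by rewrite /F /glue big1// => k _; rewrite phiy !mulr0.
have G0 x : ~ D x -> \forall y \near x, G y = 0.
  move=> Dx; apply: filterS2 (test_near0 tphi Dx) (test_near0_derive (delta_mx 0 j) tphi Dx) => y phiy dphiy.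
  by rewrite /G /glue big1// => k _; rewrite /dF phiy dphiy !(mulr0, mul0r) addr0 mulr0.
have ddF k : smooth (dF k).
  by move=> n; exact: (Cn_add (Cn_mul (sP k n) (smooth_derive j sphi n)) (Cn_mul (sphi n) (smooth_derive j (sP k) n))).
have dFG x : is_derive x (delta_mx 0 j : 'rV[R]_d) F (G x).
  have [[k _ kx]|Dx] := pselect (D x).
    apply: (near_eq_is_derive (nearF k x kx)).
    rewrite /G (glueE _ kx).
    exact: (is_deriveM (Cn_is_derive j x (sP k 1%N)) (Cn_is_derive j x (sphi 1%N))).
  rewrite /G glue_out//; apply: (near_eq_is_derive (F0 x Dx)).
have cG : continuous G.
  move=> x; have [[k _ kx]|Dx] := pselect (D x).
    by apply: (near_eq_continuous_at (nearG k x kx)); exact: smooth_continuous.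
  by apply: (near_eq_continuous_at (G0 x Dx)); exact: continuous_const.
have [M phi0] := test_support tphi.
have FM x : M < `|x| -> F x = 0.
  by move=> Mx; rewrite /F /glue big1// => k _; rewrite phi0// !mulr0.
have := integral_derivative dFG cG FM.
rewrite (_ : (fun x => _) = (EFin \o G) \_ D); last first.
  apply/funext => x; rewrite patchE; case: ifPn => //= /negP Dx.
  by rewrite /G glue_out// => Dx'; apply: Dx; rewrite inE.
rewrite -integral_mkcond => /(congr1 fine) /= GI.
have bf : bdd D f by apply: pws_bdd => k; exists (P k) => //; exact: fP.
have bg : bdd D g by apply: pws_bdd => k; exists (fun x => 'D_(delta_mx 0 j) (P k) x);
  [exact: smooth_derive|exact: gP].
have bphi : bdd D phi by exact/pws_bdd/smooth_pws.
have bdphi : bdd D (fun x => 'D_(delta_mx 0 j) phi x).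
  by apply/pws_bdd/smooth_pws; exact: smooth_derive.
apply/eqP; rewrite -addr_eq0 /ip -RintegralD//; first last.
- exact: (bdd_integ mD finD (bdd_mul bg bphi)).
- exact: (bdd_integ mD finD (bdd_mul bf bdphi)).
rewrite -[X in _ == X]GI; apply/eqP/eq_Rintegral => x /set_mem[k _ kx].
by rewrite /G (glueE _ kx) /dF (fP k x kx) (gP k x kx) [phi x * _]mulrC.
Qed.

(** * Cut-offs and density of test functions *)

Lemma flat1_ge0 (t : R) : 0 <= flat 1 t.
Proof. by rewrite /flat; case: ifPn => // _; rewrite hornerE mul1r expR_ge0. Qed.

Lemma flat1_le1 (t : R) : flat 1 t <= 1.
Proof.
rewrite /flat; case: ifPn => // t0; rewrite hornerE mul1r -expR0 ler_expR.
by rewrite oppr_le0 invr_ge0 ltW.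
Qed.

Lemma flat1_ge (t : R) : 0 < t -> 1 - t^-1 <= flat 1 t.
Proof. by move=> t0; rewrite /flat t0 hornerE mul1r; exact: expR_ge1Dx. Qed.

Lemma flat_le0 P (t : R) : t <= 0 -> flat P t = 0.
Proof. by rewrite /flat ltNge => ->. Qed.

Lemma flat1_cvg (b : R) : 0 < b -> flat 1 (n%:R * b - 1) @[n --> \oo] --> (1 : R).
Proof.
move=> b0; apply/cvgrPdist_le => e e0; near=> n.
have nb : 1 + e^-1 <= n%:R * b.
  rewrite -ler_pdivrMr//; near: n; exact: nbhs_infty_ger.
have t0 : 0 < n%:R * b - 1.
  by rewrite subr_gt0; apply: lt_le_trans nb; rewrite ltrDl invr_gt0.
rewrite ger0_norm ?subr_ge0 ?flat1_le1//.
have : 1 - (n%:R * b - 1)^-1 <= flat 1 (n%:R * b - 1) by exact: flat1_ge.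
have : (n%:R * b - 1)^-1 <= e.
  rewrite -[leRHS]invrK lef_pV2 ?posrE ?invr_gt0//; lra.
by lra.
Unshelve. all: by end_near. Qed.

Lemma natrM_gt0 n (b : R) : 0 < n%:R * b -> 0 < b.
Proof. by rewrite !ltNge; apply: contra => b0; rewrite mulr_ge0_le0. Qed.

(** A factor is nonzero only if n times its barycentric coordinate exceeds 1, which keeps the
    support away from the faces; inside the simplex all factors tend to 1 as n grows. *)
Definition cutoff k (n : nat) (x : 'rV[R]_d) : R :=
  \prod_i flat 1 (n%:R * bary (T k) i x - 1).

Lemma smooth_bary k i : smooth (bary (T k) i).
Proof.
have [a [g E]] := bary_affine (T k) i; rewrite (funext E) => n.
apply: Cn_add; first exact: Cn_const.
by apply: Cn_sum => j _; apply: Cn_mul; [exact: Cn_const|exact: Cn_coord].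
Qed.

Lemma smooth_cutoff k n : smooth (cutoff k n).
Proof.
move=> m; apply: Cn_prod => i _; apply: Cn_flat_comp.
apply: (Cn_add (f := fun x => n%:R * bary (T k) i x) (g := fun=> -1)); last exact: Cn_const.
by apply: Cn_mul; [exact: Cn_const|exact: smooth_bary].
Qed.

Lemma cutoff_ge0 k n x : 0 <= cutoff k n x.
Proof. by apply: prodr_ge0 => i _; exact: flat1_ge0. Qed.

Lemma cutoff_le1 k n x : cutoff k n x <= 1.
Proof. by apply: prodr_ile1 => i _; rewrite flat1_ge0 flat1_le1. Qed.

Lemma cutoff_cvg k x : open_simplex (T k) x -> cutoff k n x @[n --> \oo] --> (1 : R).
Proof.
rewrite open_simplexE// => kx.
rewrite (_ : 1 = \prod_(i < d.+1) (1 : R)); last by rewrite big1.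
rewrite /cutoff; apply: (@cvg_big R _ (fun a b => a * b)).
  exact: mul_continuous.
by move=> i _; apply: flat1_cvg; exact: kx.
Qed.

Lemma cutoff_neq0 k n x i : cutoff k n x != 0 -> 1 < n%:R * bary (T k) i x.
Proof.
move=> c0; rewrite ltNge; apply: contra c0 => nb.
by rewrite /cutoff (bigD1 i)//= flat_le0 ?mul0r// subr_le0.
Qed.

Lemma cutoff_out k l n x : open_simplex (T l) x -> l != k -> cutoff k n x = 0.
Proof.
move=> lx lk; apply/eqP/negPn/negP => c0.
suff kx : open_simplex (T k) x by move/eqP: lk; apply; exact: open_simplex_uniq lx kx.
rewrite open_simplexE// => i; have := cutoff_neq0 i c0.
by move/(lt_trans ltr01); exact: natrM_gt0.
Qed.

Definition cut (P : 'I_N -> sfield R d) n x := \sum_k cutoff k n x * P k x.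

(** The support lies in the closed set [S] of points at which, for some simplex, n times each
    barycentric coordinate is at least 1. [S] is contained in the mesh, which is bounded. *)
Lemma test_cut (P : 'I_N -> sfield R d) n : (forall k, smooth (P k)) -> test D (cut P n).
Proof.
move=> sP; pose S := \bigcup_(k in [set: 'I_N]) (\bigcap_(i in [set: 'I_d.+1]) [set x | 1 <= n%:R * bary (T k) i x]).
have cS : closed S.
  apply: closed_bigcup; first exact: finite_finset.
  move=> k _; apply: closed_bigI => i _.
  apply: (@closed_comp _ _ (fun x => n%:R * bary (T k) i x) [set t | 1 <= t]); last exact: closed_ge.
  move=> x _; apply: continuous_mul; first exact: continuous_const.
  exact: continuous_bary.
have SD : S `<=` D.
  move=> x [k _ kx]; exists k => //; rewrite open_simplexE// => i.
  have := kx i I; move/(lt_le_trans ltr01); exact: natrM_gt0.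
have sub : closure [set x | cut P n x != 0] `<=` S.
  rewrite [S](closure_id _).1//; apply: closureS => x /= c0.
  have [k ck] : exists k, cutoff k n x != 0.
    apply/not_existsP => H; move/eqP: c0; apply; apply: big1 => k _.
    by have /negP := H k; rewrite negbK => /eqP ->; rewrite mul0r.
  by exists k => // i _; apply/ltW; exact: cutoff_neq0.
split.
- by move=> m; apply: Cn_sum => k _; apply: Cn_mul; [exact: smooth_cutoff|exact: sP].
- apply: bounded_closed_compact; last exact: closed_closure.
  by apply: bounded_sub bounded_mesh => x /sub /SD.
- by move=> x /sub /SD.
Qed.

Lemma cut_cvg (P : 'I_N -> sfield R d) k x : open_simplex (T k) x ->
  cut P n x @[n --> \oo] --> P k x.
Proof.
move=> kx; rewrite (_ : (fun n => _) = (fun n => cutoff k n x * P k x)).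
  by rewrite -[X in _ --> X]mul1r; exact: (cvgM (cutoff_cvg kx) (cvg_cst _)).
apply/funext => n; rewrite /cut (bigD1 k)//= big1 ?addr0// => l lk.
by rewrite (cutoff_out _ kx) ?mul0r// eq_sym.
Qed.

(** Dominated convergence: the cut-offs of [C] are test functions that tend to [C] at every point of
    the mesh under a common bound. *)
Lemma test_dense f C : L2 D f ->
  (forall phi, test D phi -> ip D f phi = 0) -> pws C -> ip D f C = 0.
Proof.
move=> fL f0 /[dup] /pws_bdd bC /pws_rep[P sP CP].
pose F n x := (f x * cut P n x)%:E.
have [mf _] := fL.
have bcut n : bdd D (cut P n).
  by apply/pws_bdd/smooth_pws; have [] := test_cut n sP.
have /choice[M MP] k : exists M : R, forall x, D x -> `|P k x| <= M.
  by have [M _ MP] := continuous_bounded_on (smooth_continuous (sP k)) bounded_mesh; exists M.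
pose C' := \sum_k `|M k|.
have dom n x : D x -> `|cut P n x| <= C'.
  move=> Dx; apply: le_trans (ler_norm_sum _ _ _) _; apply: ler_sum => k _.
  rewrite normrM; apply: (@le_trans _ _ (1 * `|P k x|)).
    by apply: ler_wpM2r => //; rewrite ger0_norm ?cutoff_ge0 ?cutoff_le1.
  by rewrite mul1r; apply: le_trans (MP k x Dx) (ler_norm _).
have [] := @dominated_convergence _ _ R mu D mD F (fun x => (f x * C x)%:E) (fun x => (C' * `|f x|)%:E).
- by move=> n; apply/measurable_EFinP; apply: measurable_funM => //; have [] := bcut n.
- by apply/measurable_EFinP; apply: measurable_funM => //; have [] := bC.
- apply: aeW => x [k _ kx]; rewrite /F; apply: cvg_EFin; first by near=> n.
  rewrite (CP k x kx); apply: (@cvgM R nat \oo _ (fun=> f x) (cut P ^~ x)); first exact: cvg_cst.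
  exact: cut_cvg.
- apply: (integ_scale mD C'); apply: integrable_norm.
  exact: L2_integ.
- apply: aeW => x n Dx; rewrite /F lee_fin normrM mulrC; apply: ler_wpM2r => //.
  exact: dom.
move=> _ _; rewrite (_ : [sequence _]_n = fun=> 0%E); last first.
  apply/funext => n /=; have := f0 _ (test_cut n sP); rewrite /ip /Rintegral => H.
  rewrite -[LHS]fineK ?H//; apply: integrable_fin_num => //.
  apply: L2_mul_integ => //; exact: bdd_L2.
move=> /cvg_lim H; rewrite /ip /Rintegral -H// lim_cst//.
Unshelve. all: by end_near. Qed.

Definition vpws (u : vfield R d) := forall i, pws (vcomp i u).

Lemma vpws_bdd u i : vpws u -> bdd D (vcomp i u).
Proof. by move=> pu; exact: pws_bdd. Qed.

Lemma vpws_vL2 u : vpws u -> vL2 D u.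
Proof.
by move=> pu i; apply: bdd_L2 => //; exact: vpws_bdd.
Qed.

Lemma vtest_dense (w C : vfield R d) : vL2 D w ->
  (forall Phi, vtest D Phi -> vip D w Phi = 0) -> vpws C -> vip D w C = 0.
Proof.
move=> wL w0 pC.
rewrite vipE//; last exact: vpws_vL2.
rewrite big1// => i _; apply: test_dense => // phi tphi.
pose Phi : vfield R d := fun x => \row_j ((j == i)%:R * phi x).
have PhiE j : vcomp j Phi = if j == i then phi else fun=> 0.
  by apply/funext => x; rewrite /vcomp mxE; case: eqP => _; rewrite ?mul1r ?mul0r.
have t0 : test D (fun=> 0).
  split; first by move=> n; exact: Cn_const.
    rewrite (_ : [set _ | _] = set0) ?closure0; first exact: compact0.
    by rewrite -subset0 => x /=; rewrite eqxx.
  rewrite (_ : [set _ | _] = set0) ?closure0//.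
  by rewrite -subset0 => x /=; rewrite eqxx.
have tPhi : vtest D Phi by move=> j; rewrite PhiE; case: eqP.
have := w0 _ tPhi; rewrite vipE//; last first.
  by apply: vpws_vL2 => j; apply: smooth_pws; have [] := tPhi j.
rewrite (bigD1 i)//= PhiE eqxx big1 ?addr0// => j ji.
rewrite PhiE (negbTE ji) /ip; under eq_Rintegral do rewrite mulr0.
by rewrite Rintegral_cst// mul0r.
Qed.

(** * From the open simplices to Omega *)

Variable Omega : set 'rV[R]_d.
Hypothesis OmegaE : Omega = interior (\bigcup_k closed_simplex (T k)).

Lemma open_Omega : open Omega.
Proof. by rewrite OmegaE; exact: open_interior. Qed.

Lemma mesh_sub : D `<=` Omega.
Proof.
rewrite OmegaE -open_subsetE; last exact: open_mesh.
by move=> y [k _ ky]; exists k => //; exact: open_simplex_sub.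
Qed.

(** At a point of Omega outside the open simplices, some barycentric coordinate of some simplex
    vanishes. The zero sets of these coordinates are null, and [H] enumerates them by coding the
    pairs of a simplex and a vertex. *)
Lemma Omega_mesh_null : measurable (Omega `\` D) /\ mu (Omega `\` D) = 0%E.
Proof.
have mO : measurable Omega by apply: open_measurable_rV; exact: open_Omega.
have mOD : measurable (Omega `\` D) by exact: measurableD.
split=> //; apply/(negligibleP mu mOD).
pose H n := if unpickle n is Some (k, i) then [set x | bary (T k) i x = 0] else set0.
apply: (@negligibleS _ _ _ _ (\bigcup_n H n)); last first.
  apply: negligible_bigcup => n; rewrite /H; case: unpickle => [[k i]|]; last exact: negligible_set0.
  by have [mK K0] := bary_face_null (ndT k) i d_gt0; apply/(negligibleP mu mK).
move=> x [+ Dx]; rewrite OmegaE => /interior_subset[k _ kx].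
apply: contrapT => Hx; apply: Dx; exists k => //.
move: kx; rewrite closed_simplexE// open_simplexE// => kx i.
rewrite lt0r kx andbT; apply/eqP => b0; apply: Hx.
by exists (pickle (k, i)) => //; rewrite /H pickleK.
Qed.

Lemma Rintegral_Omega f : \int[mu]_(x in Omega) f x = \int[mu]_(x in D) f x.
Proof.
have [mOD OD0] := Omega_mesh_null.
exact: (Rintegral_sub_null _ mesh_sub mOD OD0).
Qed.

Lemma ip_Omega f g : ip Omega f g = ip D f g.
Proof. exact: Rintegral_Omega. Qed.

Lemma vip_Omega (u v : vfield R d) : vip Omega u v = vip D u v.
Proof. exact: Rintegral_Omega. Qed.

Lemma measurable_Omega : measurable Omega.
Proof. by apply: open_measurable_rV; exact: open_Omega. Qed.

Lemma bounded_Omega : bounded_set Omega.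
Proof.
apply: bounded_sub bounded_bigcup_closed_simplex.
by rewrite OmegaE; exact: interior_subset.
Qed.

Lemma finite_Omega : (mu Omega < +oo)%E.
Proof. by apply: bounded_finite_measure; [exact: bounded_Omega|exact: measurable_Omega]. Qed.

Let mO := measurable_Omega.
Let finO := finite_Omega.

Lemma L2_mesh f : L2 Omega f -> L2 D f.
Proof.
move=> [mf fi]; split; first exact: (measurable_funS measurable_Omega mesh_sub mf).
by apply: (integrableS _ _ _ fi); [exact: mO|exact: mD|exact: mesh_sub].
Qed.

Lemma vL2_mesh (u : vfield R d) : vL2 Omega u -> vL2 D u.
Proof. by move=> uL i; exact: L2_mesh. Qed.

Lemma smooth_L2 f : smooth f -> L2 Omega f.
Proof.
move=> sf; apply: bdd_L2 => //; split.
  apply: (measurable_funS measurableT) => //.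
  by apply: continuous_measurable_rV; exact: smooth_continuous.
by have [M _ MP] := continuous_bounded_on (smooth_continuous sf) bounded_Omega; exists M.
Qed.

Lemma vsmooth_vL2 (u : vfield R d) : vsmooth u -> vL2 Omega u.
Proof. by move=> su i; exact: smooth_L2. Qed.

Lemma vsmooth_vpws (u : vfield R d) : vsmooth u -> vpws u.
Proof. by move=> su i; exact: smooth_pws. Qed.

Lemma test_Omega phi : test D phi -> test Omega phi.
Proof. by move=> [s c sD]; split=> //; exact: subset_trans sD mesh_sub. Qed.

Lemma vtest_Omega (Phi : vfield R d) : vtest D Phi -> vtest Omega Phi.
Proof. by move=> tP i; exact: test_Omega. Qed.

Lemma pdP (i : 'I_3) :
  (exists2 j : 'I_d, (j : nat) = i &
    forall f, pd i f = fun x => 'D_(delta_mx 0 j) f x) \/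
  ((d <= i)%N /\ forall f, pd i f = fun=> 0).
Proof.
rewrite /pd; case: insubP => [j id ij|].
  by left; exists j => // f.
by rewrite -leqNgt => di; right; split.
Qed.

Lemma smooth_pd i f : smooth f -> smooth (pd i f).
Proof.
move=> sf; case: (pdP i) => [[j _ ->]|[_ ->]]; first exact: smooth_derive.
by move=> n; exact: Cn_const.
Qed.

Lemma smooth_const a : smooth (fun _ : 'rV[R]_d => a).
Proof. by move=> n; exact: Cn_const. Qed.

Lemma smooth_sub f g : smooth f -> smooth g -> smooth (fun x => f x - g x).
Proof. by move=> sf sg n; apply: Cn_add => //; exact: Cn_opp. Qed.

Lemma vcomp_curl i (u : vfield R d) : vcomp i (curl u) =
  fun x => pd (i + 1) (vcomp (i + 2%:R) u) x - pd (i + 2%:R) (vcomp (i + 1) u) x.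
Proof. by apply/funext => x; rewrite /vcomp mxE. Qed.

Lemma vcomp_grad i f : vcomp i (grad f) = pd i f.
Proof. by apply/funext => x; rewrite /vcomp mxE. Qed.

Lemma smooth_curl (u : vfield R d) : vsmooth u -> vsmooth (curl u).
Proof. by move=> su i; rewrite vcomp_curl; apply: smooth_sub; exact: smooth_pd. Qed.

Lemma smooth_grad f : smooth f -> vsmooth (grad f).
Proof. by move=> sf i; rewrite vcomp_grad; exact: smooth_pd. Qed.

Lemma ip_zeror (E : set 'rV[R]_d) f : measurable E -> ip E f (fun=> 0) = 0.
Proof.
by move=> mE; rewrite /ip; under eq_Rintegral do rewrite mulr0; rewrite Rintegral_cst// mul0r.
Qed.

Lemma ibp_mesh_pd f g i phi (P : 'I_N -> sfield R d) :
  (forall k, smooth (P k)) ->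
  (forall k x, open_simplex (T k) x -> f x = P k x) ->
  (forall k x, open_simplex (T k) x -> g x = pd i (P k) x) ->
  test D phi ->
  ip D f (pd i phi) = - ip D g phi.
Proof.
move=> sP fP gP tphi; case: (pdP i) => [[j _ E]|[_ E]]; last first.
  rewrite E ip_zeror//.
  rewrite ipC /ip (@eq_Rintegral _ _ _ _ _ (fun=> 0)).
    by rewrite Rintegral_cst ?mul0r ?oppr0//.
  by move=> x /set_mem[k _ kx]; rewrite (gP k x kx) E mulr0.
rewrite E; apply: (ibp_mesh sP fP) => // k x kx.
by rewrite (gP k x kx) E.
Qed.

Lemma ibp_smooth_pd i phi psi : test Omega phi -> smooth psi ->
  ip Omega phi (pd i psi) = - ip Omega (pd i phi) psi.
Proof.
move=> tphi spsi; have [sphi _ _] := tphi.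
case: (pdP i) => [[j _ E]|[_ E]]; last first.
  by rewrite (E phi) (E psi) [in RHS]ipC !ip_zeror ?oppr0//.
rewrite (E phi) (E psi).
pose F x := phi x * psi x.
pose G x := phi x * 'D_(delta_mx 0 j) psi x + psi x * 'D_(delta_mx 0 j) phi x.
have dF x : is_derive x (delta_mx 0 j : 'rV[R]_d) F (G x).
  exact: (is_deriveM (Cn_is_derive j x (sphi 1%N)) (Cn_is_derive j x (spsi 1%N))).
have cG : continuous G.
  apply: smooth_continuous => n.
  exact: (Cn_add (Cn_mul (sphi n) (smooth_derive j spsi n)) (Cn_mul (spsi n) (smooth_derive j sphi n))).
have [M phi0] := test_support tphi.
have FM x : M < `|x| -> F x = 0 by move=> Mx; rewrite /F phi0// mul0r.
have := integral_derivative dF cG FM.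
rewrite (_ : (fun x => _) = (EFin \o G) \_ Omega); last first.
  apply/funext => x; rewrite patchE; case: ifPn => //= /negP Ox.
  have Ox' : ~ Omega x by move=> Ox'; apply: Ox; rewrite inE.
  rewrite /G (nbhs_singleton (test_near0 tphi Ox')).
  by rewrite (nbhs_singleton (test_near0_derive (delta_mx 0 j) tphi Ox')) mul0r mulr0 addr0.
rewrite -integral_mkcond => /(congr1 fine) /= GI.
apply/eqP; rewrite -addr_eq0 /ip -RintegralD//.
- rewrite -[X in _ == X]GI; apply/eqP/eq_Rintegral => x _.
  by rewrite /G [psi x * _]mulrC.
- apply: (L2_mul_integ mO); first exact: smooth_L2.
  by apply: smooth_L2; exact: smooth_derive.
- apply: (L2_mul_integ mO); last exact: smooth_L2.
  by apply: smooth_L2; exact: smooth_derive.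
Qed.

(** Nonnegativity of the squared norm of $tf-g$. The free parameter t does the work of the
    Cauchy-Schwarz inequality without square roots. *)
Lemma ip_young (t : R) f g : L2 Omega f -> L2 Omega g ->
  2 * t * ip Omega f g <= t ^+ 2 * ip Omega f f + ip Omega g g.
Proof.
move=> fL gL.
have tf := L2_scale mO t fL; have ng := L2_scale mO (-1) gL.
have := ip_ge0 Omega (fun x => t * f x + -1 * g x).
rewrite ip_addl//; last exact: L2_add.
rewrite !ip_scalel//; try exact: L2_add.
rewrite ![ip _ _ (fun x => t * f x + -1 * g x)]ipC !ip_addl// !ip_scalel//.
by rewrite [ip Omega g f]ipC; lra.
Qed.

Lemma ip_comp_le (u : vfield R d) i : vL2 Omega u ->
  ip Omega (vcomp i u) (vcomp i u) <= vip Omega u u.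
Proof.
move=> uL; rewrite vipE//.
by rewrite (bigD1 i)//= lerDl; apply: sumr_ge0 => j _; exact: ip_ge0.
Qed.

(** The identity holds for test functions, and [f] is a limit of these in the $H^1$ norm. The defect
    [l] of the identity satisfies $2tl\le 1+B$ for every t by Young's inequality, which is
    impossible for $l\neq0$. *)
Lemma H10_ibp f : H10 Omega f -> exists2 g, weak_grad Omega f g &
  forall i psi, smooth psi -> ip Omega f (pd i psi) = - ip Omega (vcomp i g) psi.
Proof.
move=> [fL [g wg H]]; exists g => // i psi spsi.
have [gL _] := wg; have pL := smooth_L2 spsi.
have dpL := smooth_L2 (smooth_pd i spsi).
apply/eqP; rewrite -addr_eq0; apply/negPn/negP => l0.
pose l := ip Omega f (pd i psi) + ip Omega (vcomp i g) psi.
pose B := ip Omega (pd i psi) (pd i psi) + ip Omega psi psi.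
have B0 : 0 <= B by rewrite addr_ge0// ip_ge0.
suff Ht t : 2 * t * l <= 1 + B.
  have := Ht ((1 + B) / l); have -> : 2 * ((1 + B) / l) * l = 2 * (1 + B).
    by rewrite -mulrA divfK.
  lra.
have t20 : 0 < t ^+ 2 + 1 by rewrite ltr_wpDl ?sqr_ge0.
(* This accuracy keeps $t^2$ times the squared error at most 1. *)
have [|phi tphi He] := H (t ^+ 2 + 1)^-1; first by rewrite invr_gt0.
have [sphi _ _] := tphi.
have phiL := smooth_L2 sphi.
have dphiL := vsmooth_vL2 (smooth_grad sphi).
have aL : L2 Omega (f \- phi) by exact: L2_sub.
have bL : vL2 Omega (fun x => g x - grad phi x) by exact: vL2_sub.
have lE : l = ip Omega (f \- phi) (pd i psi) +
    ip Omega (vcomp i (fun x => g x - grad phi x)) psi.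
  rewrite /l; have -> : ip Omega (f \- phi) (pd i psi) = ip Omega f (pd i psi) - ip Omega phi (pd i psi).
    have := ip_addl mO aL phiL dpL; rewrite (_ : (fun x => _) = f).
      by move=> ->; rewrite addrK.
    by apply/funext => x /=; rewrite subrK.
  have -> : ip Omega (vcomp i (fun x => g x - grad phi x)) psi = ip Omega (vcomp i g) psi - ip Omega (pd i phi) psi.
    have := ip_addl mO (bL i) (dphiL i) pL; rewrite (_ : (fun x => _) = vcomp i g).
      by move=> ->; rewrite vcomp_grad addrK.
    by apply/funext => x; rewrite vcompB subrK.
  rewrite (ibp_smooth_pd i tphi spsi); lra.
have Y1 := ip_young t aL dpL.
have Y2 := ip_young t (bL i) pL.
have Y3 := ip_comp_le i bL.
have t2 : t ^+ 2 * (t ^+ 2 + 1)^-1 <= 1 by rewrite ler_pdivrMr// mul1r lerDl.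
have Y4 : t ^+ 2 * (ip Omega (f \- phi) (f \- phi) +
   ip Omega (vcomp i (fun x => g x - grad phi x)) (vcomp i (fun x => g x - grad phi x))) <= 1.
  apply: le_trans t2; apply: ler_wpM2l; first exact: sqr_ge0.
  by apply: le_trans (ltW He); rewrite lerD2l.
rewrite lE /B mulrDr.
move: Y1 Y2 Y4; rewrite mulrDr; lra.
Qed.

(** * Weak curls and zero tangential traces *)

Lemma ord3_add :
  (((0 + 1)%R = 1%R :> 'I_3) * ((0 + 2%:R)%R = 2%:R :> 'I_3) * ((1 + 1)%R = 2%:R :> 'I_3) *
   ((1 + 2%:R)%R = 0%R :> 'I_3) * ((2%:R + 1)%R = 0%R :> 'I_3) * ((2%:R + 2%:R)%R = 1%R :> 'I_3))%type.
Proof. by do ![split]; exact: val_inj. Qed.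

Lemma sum3 (F : 'I_3 -> R) : \sum_i F i = F 0 + F 1 + F 2%:R.
Proof.
rewrite !big_ord_recl big_ord0 addr0 addrA.
by congr (_ + F _ + F _); exact: val_inj.
Qed.

(* Membership in H_0(curl) in a form common to d = 2 and d = 3: for d = 2 the
   component in H^1_0 also satisfies it, by approximation with test functions. *)
Definition trace_curl (u w : vfield R d) := [/\ vL2 Omega u, weak_curl Omega u w &
  forall Phi, vsmooth Phi -> vip Omega u (curl Phi) = vip Omega w Phi].

Lemma vtest_smooth (O : set 'rV[R]_d) (Phi : vfield R d) : vtest O Phi -> vsmooth Phi.
Proof. by move=> t i; have [] := t i. Qed.

Lemma ip_addr f g h : L2 Omega f -> L2 Omega g -> L2 Omega h ->
  ip Omega h (fun x => f x + g x) = ip Omega h f + ip Omega h g.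
Proof.
move=> fL gL hL; rewrite ipC ip_addl//.
by rewrite ipC [ip _ g h]ipC.
Qed.

Lemma ip_oppr f g : L2 Omega f -> L2 Omega g -> ip Omega f (fun x => - g x) = - ip Omega f g.
Proof.
move=> fL gL; rewrite ipC [in RHS]ipC -mulN1r -ip_scalel//.
by congr ip; apply/funext => x; rewrite mulN1r.
Qed.

Lemma ip_subr f g h : L2 Omega f -> L2 Omega g -> L2 Omega h ->
  ip Omega h (fun x => f x - g x) = ip Omega h f - ip Omega h g.
Proof.
move=> fL gL hL; rewrite ip_addr// ?ip_oppr//.
exact: L2_opp.
Qed.

Lemma H0curl_trace_curl u : H0curl_trace Omega u -> exists w, trace_curl u w.
Proof.
move=> [uL [w ww H]]; exists w; split=> // Phi sPhi.
by apply/eqP; rewrite -subr_eq0 H.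
Qed.

Lemma vcomp_orth i f : vcomp i (fun x : 'rV[R]_d => orth (f x)) = if i == ord_max then f else fun=> 0.
Proof. by apply/funext => x; rewrite /vcomp mxE; case: eqP. Qed.

Lemma ord_max3 : ord_max = 2%:R :> 'I_3. Proof. exact: val_inj. Qed.

Lemma planar_orth (u : vfield R d) :
  u = (fun x => planar_part u x + orth (vcomp ord_max u x)).
Proof.
apply/funext => x; apply/rowP => i; rewrite !mxE /vcomp.
by case: eqP => [->|_]; rewrite ?add0r ?addr0.
Qed.

Lemma vL2_orth f : L2 Omega f -> vL2 Omega (fun x => orth (f x)).
Proof.
move=> fL i; rewrite vcomp_orth; case: eqP => // _.
exact: L2_0.
Qed.

Lemma vip_orthl f (v : vfield R d) : vip Omega (fun x => orth (f x)) v = ip Omega f (vcomp ord_max v).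
Proof.
rewrite /vip /ip; apply: eq_Rintegral => x _; rewrite /dot (bigD1 ord_max)//= big1.
  by rewrite addr0 mxE eqxx.
by move=> i /negbTE im; rewrite mxE im mul0r.
Qed.

(** The curl of $(0,0,f)$ is $(\partial_2f,-\partial_1f,0)$, where the weak gradient [g] replaces
    the derivatives. The zero trace comes from [H10_ibp], which allows smooth functions that do not
    vanish at the boundary. *)
Lemma orth_trace_curl f : H10 Omega f -> exists w, trace_curl (fun x => orth (f x)) w.
Proof.
move=> fH; have [fL _] := fH; have [g [gL _] Hg] := H10_ibp fH.
pose w : vfield R d := fun x => \row_i (if i == 0 then vcomp 1 g x else if i == 1 then - vcomp 0 g x else 0).
have w0 : vcomp 0 w = vcomp 1 g by apply/funext => x; rewrite /vcomp mxE.
have w1 : vcomp 1 w = fun x => - vcomp 0 g x by apply/funext => x; rewrite /vcomp mxE.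
have w2 : vcomp 2%:R w = fun=> 0 by apply/funext => x; rewrite /vcomp mxE.
have wL : vL2 Omega w.
  move=> i; have : (i == 0) || (i == 1) || (i == 2%:R) by case: i => -[|[|[|]]].
  case/orP => [/orP[]|] /eqP ->; rewrite ?w0 ?w1 ?w2//; last exact: L2_0.
  exact: L2_opp.
have TC Phi : vsmooth Phi -> vip Omega (fun x => orth (f x)) (curl Phi) = vip Omega w Phi.
  move=> sPhi; have PhiL := vsmooth_vL2 sPhi.
  rewrite vip_orthl ord_max3 vcomp_curl !ord3_add.
  rewrite ip_subr//; try by apply: smooth_L2; exact: smooth_pd.
  rewrite !Hg// vipE// sum3 w0 w1 w2 ipC -[ip _ (fun=> 0) _]ipC ip_zeror//.
  rewrite [ip Omega (fun x => - _) _]ipC ip_oppr// [ip _ (vcomp 1 Phi) _]ipC.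
  by ring.
exists w; split=> //; first exact: vL2_orth.
by split=> // Phi /vtest_smooth sPhi; rewrite TC.
Qed.

Lemma trace_curl_add u v w w' : trace_curl u w -> trace_curl v w' ->
  trace_curl (fun x => u x + v x) (fun x => w x + w' x).
Proof.
move=> [uL [wL _] Hu] [vL [w'L _] Hv].
have TC Phi : vsmooth Phi -> vip Omega (fun x => u x + v x) (curl Phi) = vip Omega (fun x => w x + w' x) Phi.
  move=> sPhi; have PhiL := vsmooth_vL2 sPhi.
  by rewrite !vip_addl// ?Hu ?Hv//; exact/vsmooth_vL2/smooth_curl.
split=> //; first exact: vL2_add.
by split=> [|Phi /vtest_smooth sPhi]; [exact: vL2_add|rewrite TC].
Qed.

Lemma trace_curl_scale a u w : trace_curl u w ->
  trace_curl (fun x => a *: u x) (fun x => a *: w x).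
Proof.
move=> [uL [wL _] Hu].
have TC Phi : vsmooth Phi -> vip Omega (fun x => a *: u x) (curl Phi) = vip Omega (fun x => a *: w x) Phi.
  move=> sPhi; have PhiL := vsmooth_vL2 sPhi.
  by rewrite !vip_scalel// ?Hu//; exact/vsmooth_vL2/smooth_curl.
split=> //; first exact: vL2_scale.
by split=> [|Phi /vtest_smooth sPhi]; [exact: vL2_scale|rewrite TC].
Qed.

Lemma H0curl_has_curl u : H0curl Omega u -> exists w, trace_curl u w.
Proof.
rewrite /H0curl; case: ifPn => _; last exact: H0curl_trace_curl.
move=> [/H0curl_trace_curl[w tw] /orth_trace_curl[w' tw']].
by have := trace_curl_add tw tw'; rewrite -planar_orth; exists (fun x => w x + w' x).
Qed.

(** Both weak curls have the same pairing with test fields supported in the mesh, hence with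
    piecewise smooth fields. This makes the arbitrary choice in [wcurl] harmless. *)
Lemma curl_dense u w w' C : weak_curl Omega u w -> weak_curl Omega u w' -> vpws C ->
  vip D w C = vip D w' C.
Proof.
move=> [/vL2_mesh wL wE] [/vL2_mesh w'L w'E] pC.
apply/eqP; rewrite -subr_eq0 -vip_subl//; last exact: vpws_vL2.
apply/eqP; apply: vtest_dense => //; first exact: vL2_sub.
move=> Phi tPhi; have tO := vtest_Omega tPhi.
have PhiL : vL2 D Phi by apply/vL2_mesh/vsmooth_vL2; exact: vtest_smooth tPhi.
by rewrite vip_subl// -!vip_Omega wE// w'E// subrr.
Qed.

Lemma pd_zero i : pd i (fun _ : 'rV[R]_d => 0 : R) = fun=> 0.
Proof.
by case: (pdP i) => [[j _ ->]|[_ ->]]//; apply/funext => x; exact: derive_cst.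
Qed.

Lemma pd_comm i j f : smooth f -> pd i (pd j f) = pd j (pd i f).
Proof.
move=> sf; case: (pdP i) => [[a _ Ea]|[_ Ea]]; last by rewrite !Ea pd_zero.
case: (pdP j) => [[b _ Eb]|[_ Eb]]; last by rewrite !Eb pd_zero.
by rewrite (Ea f) (Eb f) (Ea (fun x => _)) (Eb (fun x => _)); apply/funext => x; rewrite derive_comm.
Qed.

Lemma curl_grad f : smooth f -> curl (grad f) = fun=> 0.
Proof.
move=> sf; apply/funext => x; apply/rowP => i.
by rewrite !mxE !vcomp_grad pd_comm// subrr.
Qed.

(** * The curl of a piecewise smooth field *)

Section piecewise_curl.
Variable P : 'I_N -> vfield R d.
Hypothesis sP : forall k, vsmooth (P k).

Definition gpd (a b : 'I_3) := glue (fun k => pd a (vcomp b (P k))).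

Definition pcurl : vfield R d :=
  fun x => \row_i (gpd (i + 1) (i + 2%:R) x - gpd (i + 2%:R) (i + 1) x).

Lemma gpd_pws a b : pws (gpd a b).
Proof.
move=> k; exists (pd a (vcomp b (P k))); first by apply: smooth_pd; exact: sP.
by move=> x kx; rewrite /gpd (glueE _ kx).
Qed.

Lemma pcurlE k x : open_simplex (T k) x -> pcurl x = curl (P k) x.
Proof. by move=> kx; apply/rowP => i; rewrite !mxE /gpd !(glueE _ kx). Qed.

Lemma vcomp_pcurl i : vcomp i pcurl = fun x => gpd (i + 1) (i + 2%:R) x - gpd (i + 2%:R) (i + 1) x.
Proof. by apply/funext => x; rewrite /vcomp mxE. Qed.

Lemma gpd_L2 a b : L2 Omega (gpd a b).
Proof.
apply: bdd_L2 => //.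
have [_ [M MP]] := pws_bdd (gpd_pws a b).
split; first by apply: measurable_glue => k; apply/smooth_continuous/smooth_pd/sP.
exists `|M| => x Ox; have [Dx|Dx] := pselect (D x).
  exact: le_trans (MP x Dx) (ler_norm _).
by rewrite /gpd glue_out// normr0.
Qed.

Lemma pcurl_vL2 : vL2 Omega pcurl.
Proof.
move=> i; rewrite vcomp_pcurl; apply: L2_sub => //; exact: gpd_L2.
Qed.

Lemma pcurl_ibp u Phi : vL2 Omega u -> (forall k x, open_simplex (T k) x -> u x = P k x) ->
  vtest D Phi -> vip D u (curl Phi) = vip D pcurl Phi.
Proof.
move=> /vL2_mesh uL uP tPhi.
have sPhi := vtest_smooth tPhi; have PhiL := vL2_mesh (vsmooth_vL2 sPhi).
have pdL a c : L2 D (pd a (vcomp c Phi)) by apply/L2_mesh/smooth_L2/smooth_pd/sPhi.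
have gL a b : L2 D (gpd a b) by apply/L2_mesh/gpd_L2.
have I a b c : ip D (vcomp b u) (pd a (vcomp c Phi)) = - ip D (gpd a b) (vcomp c Phi).
  apply: (@ibp_mesh_pd _ _ a _ (fun k => vcomp b (P k))) => //.
  - by move=> k; exact: sP.
  - by move=> k x /uP; rewrite /vcomp => ->.
  - by move=> k x kx; rewrite /gpd (glueE _ kx).
have subr f g h : L2 D f -> L2 D g -> L2 D h -> ip D h (fun x => f x - g x) = ip D h f - ip D h g.
  move=> fL gL' hL; have := ip_addl mD (L2_sub mD fL gL') gL' hL.
  rewrite (_ : (fun x => _ - _ + _) = f); last by apply/funext => x; rewrite subrK.
  by rewrite ipC => ->; rewrite [ip D h g]ipC ipC addrK.
rewrite vipE//; last by apply/vL2_mesh/vsmooth_vL2/smooth_curl.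
rewrite vipE//; last exact/vL2_mesh/pcurl_vL2.
under eq_bigr => i _ do rewrite vcomp_curl subr// !I.
under [RHS]eq_bigr => i _ do rewrite vcomp_pcurl ipC subr// ![ip _ (vcomp i Phi) _]ipC.
rewrite !sum3 !ord3_add.
move: (ip D (gpd 1 0) (vcomp 2%:R Phi)) (ip D (gpd 2%:R 0) (vcomp 1 Phi))
  (ip D (gpd 2%:R 1) (vcomp 0 Phi)) (ip D (gpd 0 1) (vcomp 2%:R Phi))
  (ip D (gpd 0 2%:R) (vcomp 1 Phi)) (ip D (gpd 1 2%:R) (vcomp 0 Phi)) => a b c a' b' c'.
by clear; ring.
Qed.

(** [w] is an unknown square-integrable field, while [pcurl] is explicit. Tests supported in the
    open simplices show that both have the same integrals against piecewise smooth fields, in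
    particular against fields smooth up to the boundary, so the zero trace passes from [w] to
    [pcurl]. *)
Lemma pcurl_trace_curl u w : trace_curl u w ->
  (forall k x, open_simplex (T k) x -> u x = P k x) -> trace_curl u pcurl.
Proof.
move=> [uL [wL wE] wT] uP; have wL' := vL2_mesh wL.
have pL := vL2_mesh pcurl_vL2.
have H C : vpws C -> vip D w C = vip D pcurl C.
  move=> pC; apply/eqP; rewrite -subr_eq0 -vip_subl//; last exact: vpws_vL2.
  apply/eqP; apply: vtest_dense => //; first exact: vL2_sub.
  move=> Phi tPhi; have tO := vtest_Omega tPhi.
  have PhiL : vL2 D Phi by apply/vL2_mesh/vsmooth_vL2; exact: vtest_smooth tPhi.
  rewrite vip_subl// -(pcurl_ibp uL uP tPhi) -!vip_Omega wE//.
  by rewrite subrr.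
have TC Phi : vsmooth Phi -> vip Omega u (curl Phi) = vip Omega pcurl Phi.
  by move=> sPhi; rewrite wT// !vip_Omega H//; exact: vsmooth_vpws.
split=> //; split; first exact: pcurl_vL2.
by move=> Phi /vtest_smooth sPhi; rewrite TC.
Qed.

End piecewise_curl.

(** The zero trace of [u] is tested with [grad phi], whose curl vanishes. As [phi] is free at the
    boundary, the identity contains both the vanishing divergence and the vanishing normal trace of
    [w]. *)
Lemma trace_curl_div0 u w phi : trace_curl u w -> smooth phi -> vip Omega w (grad phi) = 0.
Proof.
move=> [_ _ TC] sphi; rewrite -TC; last exact: smooth_grad.
rewrite curl_grad// /vip (@eq_Rintegral _ _ _ _ _ (fun=> 0)).
  by rewrite Rintegral_cst ?mul0r//.
by move=> x _; rewrite /dot big1// => i _; rewrite mxE mulr0.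
Qed.

Lemma trace_curl_weak_div0 u w : trace_curl u w -> weak_div Omega w (fun=> 0).
Proof.
move=> tw; split.
  exact: L2_0.
move=> phi [sphi _ _]; rewrite (trace_curl_div0 tw sphi) oppr0 ipC ip_zeror//.
Qed.

Lemma trace_curl_H0div u w : trace_curl u w -> H0div Omega w.
Proof.
move=> tw; have [_ [wL _] _] := tw; split=> //.
exists (fun=> 0); first exact: trace_curl_weak_div0 tw.
move=> phi sphi; rewrite (trace_curl_div0 tw sphi) ipC ip_zeror ?addr0//.
Qed.

(** * Degrees of derivatives and curls of polynomial fields *)

Lemma pd_add a f g : smooth f -> smooth g ->
  pd a (fun x => f x + g x) = fun x => pd a f x + pd a g x.
Proof.
move=> sf sg; case: (pdP a) => [[j _ E]|[_ E]]; last first.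
  by rewrite (E f) (E g) (E (fun x => _)); apply/funext => x; rewrite addr0.
rewrite (E f) (E g) (E (fun x => _)); apply/funext => x.
by have [_ ->] := is_deriveD (Cn_is_derive j x (sf 1%N)) (Cn_is_derive j x (sg 1%N)).
Qed.

Lemma pd_sub a f g : smooth f -> smooth g ->
  pd a (fun x => f x - g x) = fun x => pd a f x - pd a g x.
Proof.
move=> sf sg; case: (pdP a) => [[j _ E]|[_ E]]; last first.
  by rewrite (E f) (E g) (E (fun x => _)); apply/funext => x; rewrite subr0.
rewrite (E f) (E g) (E (fun x => _)); apply/funext => x.
by have [_ ->] := is_deriveB (Cn_is_derive j x (sf 1%N)) (Cn_is_derive j x (sg 1%N)).
Qed.

Lemma embP (i : 'I_3) :
  (exists j : 'I_d, [/\ (j : nat) = i, forall x : 'rV[R]_d, emb x 0 i = x 0 j &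
    forall f, pd i f = fun x => 'D_(delta_mx 0 j) f x]) \/
  [/\ (d <= i)%N, forall x : 'rV[R]_d, emb x 0 i = 0 & forall f, pd i f = fun=> 0].
Proof.
case: (pdP i) => [[j ji E]|[di E]].
  left; exists j; split=> // x; rewrite mxE; case: insubP => [l _ li|] /=.
    by congr (x _ _); apply/val_inj; rewrite /= ji.
  by rewrite -ji ltn_ord.
by right; split=> // x; rewrite mxE; case: insubP => //; rewrite ltnNge di.
Qed.

Lemma smooth_emb i : smooth (fun x : 'rV[R]_d => emb x 0 i).
Proof.
case: (embP i) => [[j [_ E _]]|[_ E _]]; rewrite (funext E); last exact: smooth_const.
by move=> n; exact: Cn_coord.
Qed.

Lemma smooth_mul f g : smooth f -> smooth g -> smooth (fun x => f x * g x).
Proof. by move=> sf sg n; exact: Cn_mul. Qed.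

Lemma smooth_add f g : smooth f -> smooth g -> smooth (fun x => f x + g x).
Proof. by move=> sf sg n; exact: Cn_add. Qed.

Lemma pd_embM (a b : 'I_3) f : (a < d)%N -> smooth f ->
  pd a (fun x => emb x 0 b * f x) = fun x => (a == b)%:R * f x + emb x 0 b * pd a f x.
Proof.
move=> ad sf; case: (embP a) => [[j [ja _ E]]|[]]; last by rewrite leqNgt ad.
rewrite (E f) (E (fun x => _)); apply/funext => x.
case: (embP b) => [[l [lb F _]]|[db F _]].
  rewrite F; under [fun x => _]eq_fun do rewrite F.
  have [_ ->] := is_deriveM (is_derive_coord l j x) (Cn_is_derive j x (sf 1%N)).
  rewrite addrC /GRing.scale /= mulrC; congr (_ * _ + _).
  by congr (_%:R); rewrite -!val_eqE /= ja lb eq_sym.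
rewrite F; under [fun x => _]eq_fun do rewrite F mul0r.
rewrite derive_cst mul0r addr0 (_ : a == b = false) ?mul0r//.
by apply/negP => /eqP ab; move: db; rewrite -ab leqNgt ad.
Qed.

Lemma poly_fun_pd r f i : poly_fun r f -> poly_fun r.-1 (pd i f).
Proof.
move=> pf; case: (pdP i) => [[j _ ->]|[_ ->]]; last exact: poly_fun_const.
by have [] := poly_fun_derive j pf.
Qed.

Lemma poly_fun_pdW r f i : poly_fun r f -> poly_fun r (pd i f).
Proof. by move=> /(@poly_fun_pd _ _ i); apply: poly_fun_leq; exact: leq_pred. Qed.

Lemma poly_fun_emb_pd r f i : poly_fun r f -> poly_fun r (fun x => emb x 0 i * pd i f x).
Proof.
move=> pf; case: (embP i) => [[j [_ E ->]]|[_ E _]]; under [fun x => _]eq_fun do rewrite E.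
  exact: poly_fun_coord_derive.
by under [fun x => _]eq_fun do rewrite mul0r; exact: poly_fun_const.
Qed.

Lemma poly_fun_emb r f i : poly_fun r f -> poly_fun r.+1 (fun x => emb x 0 i * f x).
Proof.
move=> pf; case: (embP i) => [[j [_ E _]]|[_ E _]]; under [fun x => _]eq_fun do rewrite E.
  exact: poly_fun_coordM.
by under [fun x => _]eq_fun do rewrite mul0r; exact: poly_fun_const.
Qed.

Definition vpoly n (p : vfield R d) := forall i, poly_fun n (vcomp i p).

Lemma vpoly_vsmooth n p : vpoly n p -> vsmooth p.
Proof. by move=> pp i; exact: poly_fun_smooth (pp i). Qed.

Lemma vcomp_cross i (u v : vfield R d) : vcomp i (fun x => cross (u x) (v x)) =
  fun x => vcomp (i + 1) u x * vcomp (i + 2%:R) v x - vcomp (i + 2%:R) u x * vcomp (i + 1) v x.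
Proof. by apply/funext => x; rewrite /vcomp mxE. Qed.

Lemma vpoly_cross_emb n q : vpoly n q -> vpoly n.+1 (fun x => cross (emb x) (q x)).
Proof.
by move=> pq i; rewrite vcomp_cross; apply: poly_fun_sub; apply: poly_fun_emb; exact: pq.
Qed.

Lemma ord3_arith (i : 'I_3) :
  [/\ i + 1 + 1 = i + 2%:R, i + 1 + 2%:R = i, i + 2%:R + 1 = i & i + 2%:R + 2%:R = i + 1].
Proof. by split; apply/val_inj; case: i => -[|[|[|]]]. Qed.

Lemma sum3_from (F : 'I_3 -> R) i : \sum_a F a = F i + F (i + 1) + F (i + 2%:R).
Proof.
rewrite sum3.
have : (i == 0) || (i == 1) || (i == 2%:R) by case: i => -[|[|[|]]].
move=> /orP[/orP[]|] /eqP ->; rewrite !ord3_add//.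
  by rewrite -addrA addrC.
by rewrite addrC addrA.
Qed.

(** The identity behind it, in dimension 3, is $\operatorname{curl}(x\times
    q)=(\operatorname{div}q)\,x-2q-(x\cdot\nabla)q$, whose last term does not raise the degree. *)
Lemma curl_nedelec n (p q : vfield R d) : d = 3%N -> vpoly n p -> vpoly n q ->
  exists p' q', [/\ vpoly n p', poly_fun n q' &
    forall x, curl (fun x => p x + cross (emb x) (q x)) x = p' x + q' x *: emb x].
Proof.
move=> d3 pp pq; have sp := vpoly_vsmooth pp; have sq := vpoly_vsmooth pq.
pose qc a := vcomp a q.
pose p' : vfield R d := fun x => \row_i (vcomp i (curl p) x - 2 * qc i x -
  \sum_(a < 3) emb x 0 a * pd a (qc i) x).
pose q' x := \sum_(a < 3) pd a (qc a) x.
exists p', q'; split.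
- move=> i; rewrite (_ : vcomp i p' = fun x => vcomp i (curl p) x - 2 * qc i x -
    \sum_(a < 3) emb x 0 a * pd a (qc i) x); last by apply/funext => x; rewrite /vcomp mxE.
  apply: poly_fun_sub; last by apply: poly_fun_sum => a _; apply: poly_fun_emb_pd; exact: pq.
  apply: poly_fun_sub; last by apply: poly_fun_scale; exact: pq.
  by rewrite vcomp_curl; apply: poly_fun_sub; apply: poly_fun_pdW; exact: pp.
- by apply: poly_fun_sum => a _; apply: poly_fun_pdW; exact: pq.
- move=> x; apply/rowP => i; rewrite [LHS](_ : _ = vcomp i (curl (fun x => p x + cross (emb x) (q x))) x)//.
  have scr a : smooth (vcomp a (fun x => cross (emb x) (q x))).
    rewrite vcomp_cross; apply: smooth_sub; apply: smooth_mul; rewrite ?/vcomp; (exact: smooth_emb || exact: sq).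
  have lt3 (a : 'I_3) : (a < d)%N by rewrite d3.
  rewrite vcomp_curl !vcompD !pd_add//; try exact: sp.
  have pdc a b c f g : smooth f -> smooth g ->
      pd a (fun x => vcomp b (@emb R d) x * f x - vcomp c (@emb R d) x * g x) x =
      (a == b)%:R * f x + emb x 0 b * pd a f x - ((a == c)%:R * g x + emb x 0 c * pd a g x).
    move=> sf sg; rewrite pd_sub; [|exact: smooth_mul (smooth_emb b) sf|exact: smooth_mul (smooth_emb c) sg].
    by rewrite !pd_embM.
  rewrite !vcomp_cross; have [-> -> -> ->] := ord3_arith i.
  rewrite !pdc; try exact: sq.
  have [n1 n2] : i + 1 == i = false /\ i + 2%:R == i = false.
    by split; case: i => -[|[|[|]]].
  rewrite !eqxx n1 n2.
  have -> : (p' x + q' x *: emb x) 0 i = p' x 0 i + q' x * emb x 0 i.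
    by rewrite mxE [X in _ + X = _]mxE.
  have -> : p' x 0 i = vcomp i (curl p) x - 2 * qc i x -
      \sum_(a < 3) emb x 0 a * pd a (qc i) x by rewrite mxE.
  rewrite vcomp_curl /q' !(sum3_from _ i) /qc /= mulr0n mulr1n.
  by clear; ring.
Qed.

Lemma vip_orthr f (v : vfield R d) : vip Omega v (fun x => orth (f x)) = ip Omega (vcomp ord_max v) f.
Proof. by rewrite vipC vip_orthl ipC. Qed.

(** * Linearity of the continuous and discrete spaces *)

Lemma test_sub (O : set 'rV[R]_d) phi psi chi : test O phi -> test O psi -> smooth chi ->
  (forall x, chi x != 0 -> phi x != 0 \/ psi x != 0) -> test O chi.
Proof.
move=> [_ c1 s1] [_ c2 s2] sc H.
have sub : closure [set x | chi x != 0] `<=`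
    closure [set x | phi x != 0] `|` closure [set x | psi x != 0].
  by rewrite -closureU; apply: closureS => x /H[]; [left|right].
split=> //; last by move=> x /sub[/s1|/s2].
apply: (subclosed_compact _ (compactU c1 c2) sub); exact: closed_closure.
Qed.

Lemma test_add (O : set 'rV[R]_d) phi psi : test O phi -> test O psi ->
  test O (fun x => phi x + psi x).
Proof.
move=> t1 t2; apply: (test_sub t1 t2); first by apply: smooth_add; [case: t1|case: t2].
move=> x; have [->|] := eqVneq (phi x) 0; last by left.
by rewrite add0r; right.
Qed.

Lemma test_scale (O : set 'rV[R]_d) a phi : test O phi -> test O (fun x => a * phi x).
Proof.
move=> t1; apply: (test_sub t1 t1).
  by apply: smooth_mul; [exact: smooth_const|case: t1].
by move=> x; rewrite mulf_eq0 negb_or => /andP[_]; left.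
Qed.

Lemma grad_add f g : smooth f -> smooth g ->
  grad (fun x => f x + g x) = fun x => grad f x + grad g x.
Proof. by move=> sf sg; apply/funext => x; apply/rowP => i; rewrite !mxE pd_add. Qed.

Lemma pd_scale i a f : smooth f -> pd i (fun x => a * f x) = fun x => a * pd i f x.
Proof.
move=> sf; case: (pdP i) => [[j _ E]|[_ E]]; last first.
  by rewrite (E f) (E (fun x => _)); apply/funext => x; rewrite mulr0.
rewrite (E f) (E (fun x => _)); apply/funext => x.
by have [_ ->] := is_deriveZ a (Cn_is_derive j x (sf 1%N)).
Qed.

Lemma grad_scale a f : smooth f -> grad (fun x => a * f x) = fun x => a *: grad f x.
Proof. by move=> sf; apply/funext => x; apply/rowP => i; rewrite !mxE pd_scale. Qed.

Lemma smooth_div (u : vfield R d) : vsmooth u -> smooth (div u).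
Proof. by move=> su n; apply: Cn_sum => i _; exact: (smooth_pd i (su i) n). Qed.


Lemma weak_grad_lin a f f' (g g' : vfield R d) : L2 Omega f -> L2 Omega f' ->
  weak_grad Omega f g -> weak_grad Omega f' g' ->
  weak_grad Omega (fun x => a * f x + f' x) (fun x => a *: g x + g' x).
Proof.
move=> fL fL' [gL H] [gL' H']; have agL := vL2_scale mO a gL; have afL := L2_scale mO a fL.
split; first exact: vL2_add.
move=> Phi tPhi; have sPhi := vtest_smooth tPhi; have PhiL := vsmooth_vL2 sPhi.
have dL : L2 Omega (div Phi) by exact/smooth_L2/smooth_div.
rewrite vip_addl// vip_scalel// H// H'// ip_addl// ip_scalel//; ring.
Qed.

Lemma ip_normD f g : L2 Omega f -> L2 Omega g ->
  ip Omega (fun x => f x + g x) (fun x => f x + g x) <= 2 * ip Omega f f + 2 * ip Omega g g.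
Proof.
move=> fL gL; have fgL := L2_add mO fL gL.
rewrite ip_addl// !ip_addr// [ip _ g f]ipC.
have := ip_young 1 fL gL; lra.
Qed.

Lemma vip_normD (u v : vfield R d) : vL2 Omega u -> vL2 Omega v ->
  vip Omega (fun x => u x + v x) (fun x => u x + v x) <= 2 * vip Omega u u + 2 * vip Omega v v.
Proof.
move=> uL vL; rewrite !vipE//; last exact: vL2_add; last exact: vL2_add.
rewrite !mulr_sumr -big_split; apply: ler_sum => i _.
by rewrite vcompD; exact: ip_normD.
Qed.

Lemma H10_lin a f f' : H10 Omega f -> H10 Omega f' -> H10 Omega (fun x => a * f x + f' x).
Proof.
move=> [fL [g wg H]] [fL' [g' wg' H']].
have afL := L2_scale mO a fL.
split; first exact: L2_add.
exists (fun x => a *: g x + g' x); first exact: weak_grad_lin.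
(* The squared error of the combination is at most $2a^2$ times that of [phi] plus twice that of
   [psi]; [c] dominates both weights, so each approximation gets the budget e / (2c). *)
move=> e e0; pose c := 2 * a ^+ 2 + 2.
have a20 : 0 <= a ^+ 2 by exact: sqr_ge0.
have c0 : 0 < c by rewrite /c; lra.
have ec : 0 < e / (2 * c) by rewrite divr_gt0// mulr_gt0.
have [phi tphi Hp] := H _ ec; have [psi tpsi Hq] := H' _ ec.
exists (fun x => a * phi x + psi x); first by apply: test_add => //; exact: test_scale.
have [sphi _ _] := tphi; have [spsi _ _] := tpsi.
have saphi : smooth (fun x => a * phi x) by apply: smooth_mul => //; exact: smooth_const.
have [gL _] := wg; have [gL' _] := wg'.
have d1 : L2 Omega (f \- phi) by apply: L2_sub => //; exact: smooth_L2.
have d2 : L2 Omega (f' \- psi) by apply: L2_sub => //; exact: smooth_L2.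
have e1 : vL2 Omega (fun x => g x - grad phi x) by apply: vL2_sub => //; apply/vsmooth_vL2/smooth_grad.
have e2 : vL2 Omega (fun x => g' x - grad psi x) by apply: vL2_sub => //; apply/vsmooth_vL2/smooth_grad.
have -> : (fun x => a * f x + f' x) \- (fun x => a * phi x + psi x) =
    (fun x => (fun x => a * (f \- phi) x) x + (f' \- psi) x).
  by apply/funext => x /=; ring.
have -> : (fun x => a *: g x + g' x - grad (fun x => a * phi x + psi x) x) =
    (fun x => (fun x => a *: (fun x => g x - grad phi x) x) x + (fun x => g' x - grad psi x) x).
  rewrite grad_add// grad_scale//; apply/funext => x.
  by rewrite scalerBr opprD addrACA.
have ad1 := L2_scale mO a d1; have ae1 := vL2_scale mO a e1.
apply: le_lt_trans (lerD (ip_normD ad1 d2) (vip_normD ae1 e2)) _.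
rewrite ip_scalel// [ip _ _ (fun x => a * _)]ipC ip_scalel// vip_scalel// vip_scaler//.
set A1 := ip _ _ _ in Hp *; set A2 := vip _ _ _ in Hp *.
set B1 := ip _ _ _ in Hq *; set B2 := vip _ _ _ in Hq *.
have A0 : 0 <= A1 + A2 by rewrite addr_ge0// ?ip_ge0// vip_ge0.
have B0 : 0 <= B1 + B2 by rewrite addr_ge0// ?ip_ge0// vip_ge0.
apply: (@le_lt_trans _ _ (c * (A1 + A2) + c * (B1 + B2))).
  have := mulr_ge0 a20 B0; rewrite /c; lra.
rewrite -mulrDr -ltr_pdivlMl//.
apply: lt_le_trans (ltrD Hp Hq) _.
rewrite le_eqVlt; apply/orP; left; apply/eqP.
have c00 : c != 0 by rewrite gt_eqF.
by move: (c) c00 => z z0; field.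
Qed.

Lemma H0curl_trace_lin a (u v : vfield R d) : H0curl_trace Omega u -> H0curl_trace Omega v ->
  H0curl_trace Omega (fun x => a *: u x + v x).
Proof.
move=> /H0curl_trace_curl[w tw] /H0curl_trace_curl[w' tw'].
have [L ww H] := trace_curl_add (trace_curl_scale a tw) tw'.
split=> //; exists (fun x => a *: w x + w' x) => // Phi sPhi.
by rewrite H// subrr.
Qed.

Lemma H0curl_lin a u v : H0curl Omega u -> H0curl Omega v ->
  H0curl Omega (fun x => a *: u x + v x).
Proof.
rewrite /H0curl; case: ifPn => _; last exact: H0curl_trace_lin.
move=> [u1 u2] [v1 v2]; split.
  have -> : planar_part (fun x => a *: u x + v x) = fun x => a *: planar_part u x + planar_part v x.
    by apply/funext => x; apply/rowP => i; rewrite !mxE; case: ifP; rewrite ?mulr0 ?addr0.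
  exact: H0curl_trace_lin.
have -> : vcomp ord_max (fun x => a *: u x + v x) = fun x => a * vcomp ord_max u x + vcomp ord_max v x.
  by apply/funext => x; rewrite /vcomp !mxE.
exact: H10_lin.
Qed.

Lemma poly_vec_lin n a (p q : vfield R d) : poly_vec n p -> poly_vec n q ->
  poly_vec n (fun x => a *: p x + q x).
Proof.
move=> pp pq i; have [p1 p2] := pp i; have [q1 q2] := pq i; split.
  rewrite vcompD vcompZ; apply: poly_fun_add => //; exact: poly_fun_scale.
by move=> di x; rewrite !mxE p2// q2// mulr0 addr0.
Qed.

Lemma poly_fun_lin n a f g : poly_fun n f -> poly_fun n g -> poly_fun n (fun x => a * f x + g x).
Proof. by move=> pf pg; apply: poly_fun_add => //; exact: poly_fun_scale. Qed.

Lemma crossDr (a b c : 'rV[R]_3) t : cross a (t *: b + c) = t *: cross a b + cross a c.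
Proof. by apply/rowP => i; rewrite !mxE; ring. Qed.

Lemma orth_lin (t a b : R) : orth (t * a + b) = t *: orth a + orth b.
Proof. by apply/rowP => i; rewrite !mxE; case: ifP => _ //; rewrite mulr0 addr0. Qed.

Lemma U_curl_lin r a u v : U_curl Omega T r u -> U_curl Omega T r v ->
  U_curl Omega T r (fun x => a *: u x + v x).
Proof.
move=> [hu ru] [hv rv]; split; first exact: H0curl_lin.
move=> k; have := ru k; have := rv k; case: ifPn => _.
  move=> [p' [q' [g' [pp' pq' pg' E']]]] [p [q [g [pp pq pg E]]]].
  exists (fun x => a *: p x + p' x), (fun x => a * q x + q' x), (fun x => a * g x + g' x).
  split; [exact: poly_vec_lin|exact: poly_fun_lin|exact: poly_fun_lin|].
  move=> x kx; rewrite E// E'// !orth_lin crossDr !scalerDr.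
  by apply/rowP => i; rewrite !mxE; ring.
move=> [p' [q' [pp' pq' E']]] [p [q [pp pq E]]].
exists (fun x => a *: p x + p' x), (fun x => a *: q x + q' x).
split; [exact: poly_vec_lin|exact: poly_vec_lin|].
by move=> x kx; rewrite E// E'// crossDr scalerDr addrACA.
Qed.

Lemma weak_div_lin a (u v : vfield R d) f g : vL2 Omega u -> vL2 Omega v ->
  weak_div Omega u f -> weak_div Omega v g ->
  weak_div Omega (fun x => a *: u x + v x) (fun x => a * f x + g x).
Proof.
move=> uL vL [fL H] [gL H']; have auL := vL2_scale mO a uL; have afL := L2_scale mO a fL.
split; first exact: L2_add.
move=> phi tphi; have [sphi _ _] := tphi; have pL := smooth_L2 sphi.
have gradL := vsmooth_vL2 (smooth_grad sphi).
rewrite ip_addl// ip_scalel// H// H'// vip_addl// vip_scalel//; ring.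
Qed.

Lemma H0div_lin a (u v : vfield R d) : H0div Omega u -> H0div Omega v ->
  H0div Omega (fun x => a *: u x + v x).
Proof.
move=> [uL [f wf H]] [vL [g wg H']]; have auL := vL2_scale mO a uL.
have [fL _] := wf; have [gL _] := wg; have afL := L2_scale mO a fL.
split; first exact: vL2_add.
exists (fun x => a * f x + g x); first exact: weak_div_lin.
move=> phi sphi; have pL := smooth_L2 sphi.
have gradL := vsmooth_vL2 (smooth_grad sphi).
rewrite vip_addl// vip_scalel// ip_addl// ip_scalel//.
by rewrite addrACA -mulrDr H// H'// mulr0 addr0.
Qed.

Lemma U_div_lin r a u v : U_div Omega T r u -> U_div Omega T r v ->
  U_div Omega T r (fun x => a *: u x + v x).
Proof.
move=> [hu ru] [hv rv]; split; first exact: H0div_lin.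
move=> k; have [p [q [pp pq E]]] := ru k; have [p' [q' [pp' pq' E']]] := rv k.
exists (fun x => a *: p x + p' x), (fun x => a * q x + q' x).
split; [exact: poly_vec_lin|exact: poly_fun_lin|].
move=> x kx; rewrite E// E'//.
by apply/rowP => i; rewrite !mxE; ring.
Qed.

Lemma U_grad_lin r a u v : U_grad Omega T r u -> U_grad Omega T r v ->
  U_grad Omega T r (fun x => a *: u x + v x).
Proof.
move=> [hu ru] [hv rv]; split.
  by move=> i; rewrite vcompD vcompZ; exact: H10_lin.
move=> k; have [p pp E] := ru k; have [p' pp' E'] := rv k.
exists (fun x => a *: p x + p' x); first exact: poly_vec_lin.
by move=> x kx; rewrite E// E'.
Qed.

Lemma F_dg_lin s a f g : F_dg Omega T s f -> F_dg Omega T s g ->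
  F_dg Omega T s (fun x => a * f x + g x).
Proof.
move=> [fL rf] [gL rg]; split; first by apply: L2_add => //; exact: L2_scale.
move=> k; have [p pp E] := rf k; have [p' pp' E'] := rg k.
exists (fun x => a * p x + p' x); first exact: poly_fun_lin.
by move=> x kx; rewrite E// E'.
Qed.

(** With one degree bound for all simplices, these fields form a finite-dimensional space up to
    their values off the mesh. This is how finite dimension enters for all the discrete vector
    spaces. *)
Definition vpp n (u : vfield R d) := exists2 P : 'I_N -> vfield R d,
  (forall k, vpoly n (P k)) & forall k x, open_simplex (T k) x -> u x = P k x.

Lemma poly_vec_vpoly n p : poly_vec n p -> vpoly n p.
Proof. by move=> pp i; have [] := pp i. Qed.

Lemma vpoly_leq n m p : (n <= m)%N -> vpoly n p -> vpoly m p.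
Proof. by move=> nm pp i; exact: poly_fun_leq (pp i). Qed.

Lemma vpoly_add n p q : vpoly n p -> vpoly n q -> vpoly n (fun x => p x + q x).
Proof. by move=> pp pq i; rewrite vcompD; exact: poly_fun_add. Qed.

Lemma vpoly_orth n f : poly_fun n f -> vpoly n (fun x => orth (f x)).
Proof. by move=> pf i; rewrite vcomp_orth; case: eqP => // _; exact: poly_fun_const. Qed.

Lemma vpp_vpws n u : vpp n u -> vpws u.
Proof.
move=> [P pP uP] i k; exists (vcomp i (P k)); first exact: vpoly_vsmooth (pP k) i.
by move=> x /uP; rewrite /vcomp => ->.
Qed.

Lemma vpp_of n u : (forall k, exists2 p, vpoly n p & forall x, open_simplex (T k) x -> u x = p x) ->
  vpp n u.
Proof. by move=> /(_ _)/cid2-/all_sig2[P sP fP]; exists P. Qed.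

Lemma U_curl_vpp r u : U_curl Omega T r u -> vpp r.+1 u.
Proof.
move=> [_ ru]; apply: vpp_of => k; have := ru k; case: ifPn => _.
  move=> [p [q [g [pp pq pg E]]]].
  exists (fun x => p x + cross (emb x) (orth (q x)) + orth (g x)) => //.
  apply: vpoly_add; last exact: vpoly_orth.
  apply: vpoly_add; first exact: vpoly_leq (leqnSn _) (poly_vec_vpoly pp).
  by apply: vpoly_cross_emb; exact: vpoly_orth.
move=> [p [q [pp pq E]]]; exists (fun x => p x + cross (emb x) (q x)) => //.
apply: vpoly_add; first exact: vpoly_leq (leqnSn _) (poly_vec_vpoly pp).
by apply: vpoly_cross_emb; exact: poly_vec_vpoly.
Qed.

Lemma U_div_vpp r u : U_div Omega T r u -> vpp r.+1 u.
Proof.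
move=> [_ ru]; apply: vpp_of => k; have [p [q [pp pq E]]] := ru k.
exists (fun x => p x + q x *: emb x) => //.
apply: vpoly_add; first exact: vpoly_leq (leqnSn _) (poly_vec_vpoly pp).
move=> i; rewrite (_ : vcomp i _ = fun x => emb x 0 i * q x); first exact: poly_fun_emb.
by apply/funext => x; rewrite /vcomp !mxE mulrC.
Qed.

Lemma U_grad_vpp r u : U_grad Omega T r u -> vpp r.+1 u.
Proof.
move=> [_ ru]; apply: vpp_of => k; have [p pp E] := ru k.
by exists p => //; exact: poly_vec_vpoly.
Qed.

Lemma F_dg_pws s f : F_dg Omega T s f -> pws f.
Proof. by move=> [_ rf] k; have [p pp E] := rf k; exists p => //; exact: poly_fun_smooth pp. Qed.

Lemma U_curl_vL2 r u : U_curl Omega T r u -> vL2 Omega u.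
Proof. by move=> [/H0curl_has_curl[w []]]. Qed.

Lemma U_div_vL2 r u : U_div Omega T r u -> vL2 Omega u.
Proof. by move=> [[]]. Qed.

(** * Curls of Nedelec fields are Raviart-Thomas fields *)

Hypothesis Hd : d = 2%N \/ d = 3%N.

(* In the plane, only the orthogonal component of a field has a planar curl. *)
Definition axial (u : vfield R d) : vfield R d :=
  if d == 2%N then fun x => orth (vcomp ord_max u x) else u.

Lemma curl_orth_poly n (g : sfield R d) : d = 2%N -> poly_fun n.+1 g ->
  poly_vec n (curl (fun x => orth (g x))).
Proof.
move=> d2 pg i; split.
  have H j a : poly_fun n (pd a (vcomp j (fun x => orth (g x)))).
    rewrite vcomp_orth; case: eqP => _; first exact: (@poly_fun_pd n.+1).
    by rewrite pd_zero; exact: poly_fun_const.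
  by rewrite vcomp_curl; exact: poly_fun_sub.
move=> di x; have {}di : (2 <= i)%N by apply: leq_trans di; rewrite d2.
have -> : i = ord_max by apply/val_inj; case: i di => -[|[|[|]]].
rewrite [LHS](_ : _ = vcomp ord_max (curl (fun x => orth (g x))) x)// vcomp_curl !vcomp_orth.
by rewrite !pd_zero subrr.
Qed.

(** It suffices to represent [axial u] piecewise by smooth fields whose curls have the
    Raviart-Thomas form: the glued curl then gets its zero divergence and normal trace from the zero
    tangential trace. For d = 2 the pieces are $(0,0,g)$ with g of degree r+1, and the rotated
    gradient of g has degree r without any multiple of x. *)
Lemma U_curl_curl r u : U_curl Omega T r u ->
  exists w, [/\ U_div Omega T r w, weak_div Omega w (fun=> 0) & trace_curl (axial u) w].
Proof.
move=> [hu ru].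
suff [w' [P [tw sP uP cP]]] : exists w' P, [/\ trace_curl (axial u) w',
    forall k, vsmooth (P k), forall k x, open_simplex (T k) x -> axial u x = P k x &
    forall k, exists p q, [/\ poly_vec r p, poly_fun r q &
      forall x, curl (P k) x = p x + q x *: emb x]].
  have tc := pcurl_trace_curl sP tw uP; exists (pcurl P); split=> //.
    split; first exact: trace_curl_H0div tc.
    move=> k; have [p [q [pp pq E]]] := cP k; exists p, q; split=> // x kx.
    by rewrite (pcurlE _ kx) E.
  exact: trace_curl_weak_div0 tc.
have [w tw] := H0curl_has_curl hu.
move: hu ru tw; rewrite /H0curl /axial; case: ifPn => [/eqP d2|dn2] hu ru tw.
  have [w' tw'] := orth_trace_curl hu.2.
  have /choice[g Pg] k : exists g, poly_fun r.+1 g /\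
      forall x, open_simplex (T k) x -> vcomp ord_max u x = g x.
    have [p [q [g [pp pq pg E]]]] := ru k; exists g; split=> // x kx.
    rewrite /vcomp E// !mxE eqxx (_ : p x 0 ord_max = 0); last first.
      by have [_ ->] := pp ord_max; rewrite ?d2.
    have -> : (ord_max + 2%:R == ord_max :> 'I_3) = false by [].
    have -> : (ord_max + 1 == ord_max :> 'I_3) = false by [].
    by rewrite !mulr0 subrr !add0r.
  exists w', (fun k x => orth (g k x)); split=> //.
  - by move=> k; apply: (@vpoly_vsmooth r.+1); apply: vpoly_orth; have [] := Pg k.
  - by move=> k x kx; have [_ ->] := Pg k.
  - move=> k; exists (curl (fun x => orth (g k x))), (fun=> 0); split.
    + by apply: curl_orth_poly => //; have [] := Pg k.
    + exact: poly_fun_const.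
    + by move=> x; rewrite scale0r addr0.
have d3 : d = 3%N by case: Hd dn2 => // ->.
have /choice[p Pp] k : exists p, exists q, [/\ poly_vec r p, poly_vec r q &
    forall x, open_simplex (T k) x -> u x = p x + cross (emb x) (q x)] by exact: ru k.
have /choice[q Pq] k := Pp k.
exists w, (fun k x => p k x + cross (emb x) (q k x)); split=> //.
- move=> k; have [pp pq _] := Pq k; apply: (@vpoly_vsmooth r.+1); apply: vpoly_add.
    exact: vpoly_leq (leqnSn _) (poly_vec_vpoly pp).
  by apply: vpoly_cross_emb; exact: poly_vec_vpoly.
- by move=> k x kx; have [_ _ ->] := Pq k.
- move=> k; have [pp pq _] := Pq k.
  have [p' [q' [pp' pq' E]]] := curl_nedelec d3 (poly_vec_vpoly pp) (poly_vec_vpoly pq).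
  exists p', q'; split=> // i; split; first exact: pp'.
  move=> di; have : (3 <= i)%N by apply: leq_trans di; rewrite d3.
  by rewrite leqNgt ltn_ord.
Qed.

(** * Symmetry of the curl *)

Section mollifier.
Variable delta : R.
Hypothesis delta_gt0 : 0 < delta.

(* [bump] is, up to sign, the derivative of the smooth step [step], which
   decreases from [step 0] on the nonpositive reals to 0 beyond [delta]: its
   integral is thus known explicitly. *)
Definition step (t : R) : R := flat 1 (flat 1 delta - flat 1 t).

Definition bump (t : R) : R :=
  flat (flat_deriv 1) (flat 1 delta - flat 1 t) * flat (flat_deriv 1) t.

Lemma is_derive_step (t : R) : is_derive t (1 : R) step (- bump t).
Proof.
have d1 : is_derive t (1 : R) (fun s : R => flat 1 delta - flat 1 s) (- flat (flat_deriv 1) t).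
  apply: (is_derive_eq (is_deriveB (is_derive_cst (flat 1 delta) t (1 : R)) (is_derive_flat 1 t))).
  by rewrite sub0r.
apply: (is_derive_eq (@is_derive1_comp R (flat 1) (fun s => flat 1 delta - flat 1 s) t _ _ (is_derive_flat 1 _) d1)).
by rewrite /bump mulrN.
Qed.

Lemma continuous_flat Q : continuous (flat Q : R -> R).
Proof. by move=> t; apply/differentiable_continuous/derivable1_diffP; have [] := is_derive_flat Q t. Qed.

Lemma flat_deriv1_ge0 (t : R) : 0 <= flat (flat_deriv 1) t.
Proof.
rewrite /flat; case: ifPn => // t0; apply: mulr_ge0; last exact: expR_ge0.
by rewrite /flat_deriv derivC subr0 mulr1 hornerXn sqr_ge0.
Qed.

Lemma bump_ge0 t : 0 <= bump t.
Proof. by apply: mulr_ge0; exact: flat_deriv1_ge0. Qed.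

Lemma flat1_mono (s t : R) : s <= t -> flat 1 s <= flat 1 t.
Proof.
move=> st; have [s0|s0] := leP s 0; first by rewrite flat_le0// flat1_ge0.
have t0 : 0 < t by exact: lt_le_trans st.
rewrite /flat s0 t0 !hornerE ?mul1r ler_expR lerN2 lef_pV2 ?posrE//.
Qed.

Lemma bump_out t : ~ (0 <= t <= delta) -> bump t = 0.
Proof.
move=> /negP; rewrite negb_and -!ltNge => /orP[t0|td].
  by rewrite /bump (@flat_le0 (flat_deriv 1) t (ltW t0)) mulr0.
by rewrite /bump (@flat_le0 _ (_ - _)) ?mul0r// subr_le0; apply: flat1_mono; exact: ltW.
Qed.

Lemma continuous_bump : continuous bump.
Proof.
apply: continuous_mul; last exact: continuous_flat.
move=> t; apply: (@continuous_comp _ _ _ (fun s => flat 1 delta - flat 1 s)); last exact: continuous_flat.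
by apply: cvgB; [exact: cvg_cst|exact: continuous_flat].
Qed.

Definition bump_mass : R := step 0.

Lemma bump_mass_gt0 : 0 < bump_mass.
Proof.
have pos (s : R) : 0 < s -> 0 < flat 1 s.
  by move=> s0; rewrite /flat s0 hornerE ?mul1r expR_gt0.
by rewrite /bump_mass /step (@flat_le0 _ 0)// subr0; exact: (pos _ (pos _ delta_gt0)).
Qed.

Lemma step_delta : step delta = 0.
Proof. by rewrite /step subrr flat_le0. Qed.

Lemma integral_bump_subl (x : R) : (\int[@lebesgue_measure R]_t (bump (x - t))%:E = bump_mass%:E)%E.
Proof.
rewrite (@integral_itv_support _ _ (x - delta) x); last first.
  by move=> t xt; apply: bump_out => /andP[h1 h2]; apply: xt; lra.
have dF (t : R) : is_derive t (1 : R) (fun t => step (x - t)) (bump (x - t)).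
  have d1 : is_derive t (1 : R) (fun s : R => x - s) (- 1).
    apply: (is_derive_eq (is_deriveB (is_derive_cst x t (1 : R)) (is_derive_id t (1 : R)))).
    by rewrite sub0r.
  apply: (is_derive_eq (@is_derive1_comp R step (fun s => x - s) t _ _ (is_derive_step _) d1)).
  by rewrite mulrN1 opprK.
have cf : continuous (fun t => bump (x - t)).
  move=> t; apply: (@continuous_comp _ _ _ (fun t => x - t)); last exact: continuous_bump.
  by apply: cvgB; [exact: cvg_cst|exact: cvg_id].
rewrite (integral_FTC2 _ dF cf) ?gtrBl//.
by rewrite subrr subKr step_delta sube0.
Qed.

Lemma integral_bump_subr (x : R) : (\int[@lebesgue_measure R]_t (bump (t - x))%:E = bump_mass%:E)%E.
Proof.
rewrite (@integral_itv_support _ _ x (x + delta)); last first.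
  by move=> t xt; apply: bump_out => /andP[h1 h2]; apply: xt; lra.
have dF (t : R) : is_derive t (1 : R) (fun t => - step (t - x)) (bump (t - x)).
  have d1 : is_derive t (1 : R) (fun s : R => s - x) 1.
    apply: (is_derive_eq (is_deriveB (is_derive_id t (1 : R)) (is_derive_cst x t (1 : R)))).
    by rewrite subr0.
  have d2 := @is_derive1_comp R step (fun s => s - x) t _ _ (is_derive_step _) d1.
  by apply: (is_derive_eq (is_deriveN d2)); rewrite mulr1 opprK.
have cf : continuous (fun t => bump (t - x)).
  move=> t; apply: (@continuous_comp _ _ _ (fun t => t - x)); last exact: continuous_bump.
  by apply: cvgB; [exact: cvg_id|exact: cvg_cst].
rewrite (integral_FTC2 _ dF cf) ?ltrDl//.
by rewrite subrr [x + _]addrC addrK step_delta oppr0 -EFinB opprK add0r.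
Qed.

Lemma integral_bump (b : bool) (x : R) :
  (\int[@lebesgue_measure R]_t (bump (if b then x - t else t - x))%:E = bump_mass%:E)%E.
Proof. by case: b; [exact: integral_bump_subl|exact: integral_bump_subr]. Qed.

Lemma integrable_bump (b : bool) (x : R) :
  (@lebesgue_measure R).-integrable setT (fun t => (bump (if b then x - t else t - x))%:E).
Proof.
apply/integrableP; split.
  apply/measurable_EFinP; apply: continuous_measurable_fun; case: b => t.
    apply: (@continuous_comp _ _ _ (fun t => x - t)); last exact: continuous_bump.
    by apply: cvgB; [exact: cvg_cst|exact: cvg_id].
  apply: (@continuous_comp _ _ _ (fun t => t - x)); last exact: continuous_bump.
  by apply: cvgB; [exact: cvg_id|exact: cvg_cst].
under eq_integral do rewrite gee0_abs ?lee_fin ?bump_ge0//.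
by rewrite integral_bump ltry.
Qed.

Definition mollifier m (z : 'rV[R]_m) : R := \prod_i bump (z 0 i).

Lemma mollifier_ge0 m z : 0 <= @mollifier m z.
Proof. by apply: prodr_ge0 => i _; exact: bump_ge0. Qed.

Lemma mollifier_out m z : delta < `|z| -> @mollifier m z = 0.
Proof.
move=> dz; apply/eqP/negPn/negP => nz; move: dz; rewrite ltNge => /negP; apply.
rewrite [leLHS]/Num.norm /= mx_normrE; apply/bigmax_leP; split; first exact: ltW.
move=> -[a i] _ /=; rewrite (ord1 a).
have : bump (z 0 i) != 0.
  by apply: contra nz => /eqP b0; rewrite /mollifier (bigD1 i)//= b0 mul0r.
move=> bi; have : 0 <= z 0 i <= delta by apply: contrapT => /bump_out /eqP; rewrite (negbTE bi).
by move=> /andP[z0 zd]; rewrite ger0_norm.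
Qed.

Lemma smooth_mollifier_aux n : Cn n (@mollifier d).
Proof.
apply: Cn_prod => i _; apply: Cn_mul; last by apply: Cn_flat_comp; exact: Cn_coord.
apply: Cn_flat_comp; apply: Cn_add; first exact: Cn_const.
by apply: Cn_opp; apply: Cn_flat_comp; exact: Cn_coord.
Qed.

Lemma smooth_mollifier : smooth (@mollifier d).
Proof. by move=> n; exact: smooth_mollifier_aux. Qed.

Lemma continuous_mollifier m : continuous (@mollifier m).
Proof.
apply: continuous_prod => i _ z; apply: continuous_comp; first exact: continuous_coord.
exact: continuous_bump.
Qed.

Lemma continuous_subl m (x : 'rV[R]_m) : continuous (fun y : 'rV[R]_m => x - y).
Proof. by move=> y; exact: (cvgB (@cvg_cst _ x _ (nbhs y) _) (@cvg_id _ (nbhs y))). Qed.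

Lemma continuous_subr m (x : 'rV[R]_m) : continuous (fun y : 'rV[R]_m => y - x).
Proof. by move=> y; exact: (cvgB (@cvg_id _ (nbhs y)) (@cvg_cst _ x _ (nbhs y) _)). Qed.

Lemma continuous_mollifier_sub m (b : bool) (x : 'rV[R]_m) :
  continuous (fun y : 'rV[R]_m => mollifier (if b then x - y else y - x)).
Proof.
case: b => y.
  exact: (continuous_comp (@continuous_subl m x y) (@continuous_mollifier m (x - y))).
exact: (continuous_comp (@continuous_subr m x y) (@continuous_mollifier m (y - x))).
Qed.

Lemma integrable_mollifier m (b : bool) (x : 'rV[R]_m) :
  (lebesgue_rV R m).-integrable setT (fun y => (mollifier (if b then x - y else y - x))%:E).
Proof.
have H y : `|x| + delta < `|y| -> mollifier (if b then x - y else y - x) = 0.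
  move=> xy; apply: mollifier_out.
  have : `|y| <= `|x| + `|if b then x - y else y - x|.
    case: b; last by rewrite -{1}[y](subrK x) addrC ler_normD.
    by rewrite -{1}[y](subKr x) (le_trans (ler_normB _ _)).
  by lra.
exact: (integrable_bounded_support (@continuous_mollifier_sub m b x) H).
Qed.

(** By Fubini, each coordinate of the tensor product contributes a factor [bump_mass]. *)
Lemma integral_mollifier_sub m (b : bool) (x : 'rV[R]_m) :
  (\int[lebesgue_rV R m]_y (mollifier (if b then x - y else y - x))%:E =
   (bump_mass ^+ m)%:E)%E.
Proof.
elim: m x => [|m IH] x.
  under eq_integral do rewrite /mollifier big_ord0.
  by rewrite /= integral_cst// mul1e [LHS]diracE mem_set.
rewrite integral_rV_cons12; last first.
  exact: integrable_mollifier.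
pose x' : 'rV[R]_m := \row_i x 0 (lift ord0 i).
transitivity (\int[@lebesgue_measure R]_t
   ((bump (if b then x 0 0 - t else t - x 0 0))%:E * (bump_mass ^+ m)%:E))%E.
  apply: eq_integral => t _; rewrite -(IH x') -integralZl//; last first.
    exact: integrable_mollifier.
  apply: eq_integral => y _; rewrite -EFinM; congr EFin.
  rewrite /mollifier big_ord_recl; congr (_ * _).
    by case: b {IH}; rewrite !mxE unlift_none.
  by apply: eq_bigr => i _; case: b {IH}; rewrite !mxE liftK.
rewrite integralZr//; last exact: integrable_bump.
by rewrite integral_bump -EFinM exprS.
Qed.

End mollifier.

(** * Averages over the mesh and exchange of integrals *)

Section product_integrals.
Variable m : nat.
Local Notation nu := (lebesgue_rV R m).

Lemma measurable_rV_sub :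
  measurable_fun setT (fun p : 'rV[R]_m * 'rV[R]_m => p.1 - p.2).
Proof.
apply: measurable_fun_rVP => i.
rewrite (_ : _ \o _ = fun p : 'rV[R]_m * 'rV[R]_m => rV_coord i p.1 - rV_coord i p.2).
  apply: measurable_funB.
    exact: (measurableT_comp (measurable_rV_coord i) measurable_fst).
  exact: (measurableT_comp (measurable_rV_coord i) measurable_snd).
by apply/funext => p; rewrite /rV_coord /= !mxE.
Qed.

(** The integrand is dominated by $M|f(x)||g(y)|$, integrable on the product by Tonelli's theorem.
    This justifies the exchanges of integrals that follow. *)
Lemma integrable_tensor (f g kap : sfield R m) (M : R) :
  nu.-integrable setT (EFin \o f) -> nu.-integrable setT (EFin \o g) ->
  measurable_fun setT kap -> (forall z, `|kap z| <= M) ->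
  (nu \x nu)%E.-integrable setT (fun p => (f p.1 * kap (p.1 - p.2) * g p.2)%:E).
Proof.
move=> fi gi mk kM.
have mf0 : measurable_fun setT f by apply/measurable_EFinP; exact: measurable_int fi.
have mg0 : measurable_fun setT g by apply/measurable_EFinP; exact: measurable_int gi.
have mf : measurable_fun setT (fun p : 'rV[R]_m * 'rV[R]_m => f p.1).
  exact: (measurableT_comp mf0 measurable_fst).
have mg : measurable_fun setT (fun p : 'rV[R]_m * 'rV[R]_m => g p.2).
  exact: (measurableT_comp mg0 measurable_snd).
have mkp : measurable_fun setT (fun p : 'rV[R]_m * 'rV[R]_m => kap (p.1 - p.2)).
  exact: (measurableT_comp mk measurable_rV_sub).
have fgi : (nu \x nu)%E.-integrable setT (fun p => (M * (f p.1 * g p.2))%:E).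
  apply: (@integrableZl _ _ _ (nu \x nu)%E setT measurableT M (fun p => (f p.1 * g p.2)%:E)).
  apply/integrable12ltyP; first by apply/measurable_EFinP; exact: measurable_funM.
  have /integrableP[_ foo] := fi; have /integrableP[mg' goo] := gi.
  under eq_integral => x _.
    under eq_integral => y _ do rewrite /= normrM EFinM.
    rewrite ge0_integralZl//; last by apply/measurable_EFinP; apply: measurableT_comp.
    over.
  rewrite ge0_integralZr//; last 2 first.
    by apply/measurable_EFinP; apply: measurableT_comp.
    exact: integral_ge0.
  by apply: lte_mul_pinfty => //; [exact: integral_ge0|rewrite ge0_fin_numE//; exact: integral_ge0].
apply: (le_integrable _ _ _ fgi) => //.
  by apply/measurable_EFinP; apply: measurable_funM => //; exact: measurable_funM.
move=> p _ /=; rewrite lee_fin !normrM mulrAC mulrC.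
apply: ler_wpM2r; first by rewrite mulr_ge0.
exact: le_trans (kM _) (ler_norm _).
Qed.

End product_integrals.

Lemma bounded_support_bounded m (f : sfield R m) (M : R) : continuous f ->
  (forall x, M < `|x| -> f x = 0) -> exists C : R, forall x, `|f x| <= C.
Proof.
move=> cf f0; have [C C0 fC] := continuous_bounded_on cf (@bounded_norm_le R m M).
exists C => x; have [xM|Mx] := leP `|x| M; first exact: fC.
by rewrite f0// normr0.
Qed.

Section mollification.
Variables (n : nat) (b : bool).

Definition radius : R := n.+1%:R^-1.

Lemma radius_gt0 : 0 < radius.
Proof. by rewrite invr_gt0. Qed.

(** Normalized to unit mass. As [bump] vanishes outside of [0, delta], the kernel is not even: [b]
    selects the kernel or its reflection, and exchanging the two variables of a double integral
    flips [b]. *)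
Definition kap (z : 'rV[R]_d) : R :=
  (bump_mass radius ^+ d)^-1 * mollifier radius (if b then z else - z).

Lemma mass_gt0 : 0 < bump_mass radius ^+ d.
Proof. by rewrite exprn_gt0// bump_mass_gt0// radius_gt0. Qed.

Lemma kap_ge0 z : 0 <= kap z.
Proof. by rewrite mulr_ge0 ?invr_ge0 ?(ltW mass_gt0)// mollifier_ge0. Qed.

Lemma kap_out z : radius < `|z| -> kap z = 0.
Proof.
move=> rz; rewrite /kap mollifier_out ?mulr0//; first exact: radius_gt0.
by case: b; rewrite ?normrN.
Qed.

Lemma kapE x y : kap (x - y) = (bump_mass radius ^+ d)^-1 * mollifier radius (if b then x - y else y - x).
Proof. by rewrite /kap; case: b; rewrite ?opprB. Qed.

Lemma continuous_kap : continuous kap.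
Proof.
apply: continuous_mul; first exact: continuous_const.
case: b; first exact: continuous_mollifier.
by move=> z; have := @continuous_mollifier_sub radius d true 0 z; rewrite /continuous_at/= sub0r
  (_ : (fun y => _) = fun y => mollifier radius (- y))//; apply/funext => y; rewrite sub0r.
Qed.

Lemma continuous_kap_sub (x : 'rV[R]_d) : continuous (fun y : 'rV[R]_d => kap (x - y)).
Proof. by move=> y; exact: (continuous_comp (@continuous_subl d x y) (@continuous_kap (x - y))). Qed.

Lemma integrable_kap x : mu.-integrable setT (fun y => (kap (x - y))%:E).
Proof.
have H := integrable_mollifier radius_gt0 b x.
have := integrableZl measurableT (bump_mass radius ^+ d)^-1 H.
by congr (_.-integrable _ _); apply/funext => y; rewrite kapE EFinM.
Qed.

Lemma integral_kap x : \int[mu]_y kap (x - y) = 1.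
Proof.
under eq_Rintegral do rewrite kapE.
rewrite RintegralZl//; last exact: (integrable_mollifier radius_gt0 b x).
rewrite /Rintegral integral_mollifier_sub ?radius_gt0//=.
by rewrite mulVf// gt_eqF// mass_gt0.
Qed.

Lemma kap_bounded : exists C, forall z, `|kap z| <= C.
Proof. by apply: bounded_support_bounded continuous_kap _ => z; exact: kap_out. Qed.

Definition avg (g : sfield R d) (x : 'rV[R]_d) : R :=
  \int[mu]_(y in D) (kap (x - y) * g y).


Lemma integ_patch g : integ D g -> mu.-integrable setT (EFin \o (g \_ D)).
Proof. by move=> gi; rewrite -restrict_EFin; apply/(integrable_mkcond _ mD). Qed.

Lemma avgE g x : avg g x = \int[mu]_y (kap (x - y) * (g \_ D) y).
Proof.
rewrite /avg Rintegral_mkcond; apply: eq_Rintegral => y _; rewrite !patchE.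
by case: ifP => //; rewrite mulr0.
Qed.

Lemma integrable_kap_mul g x : bdd D g -> mu.-integrable setT (fun y => (kap (x - y) * (g \_ D) y)%:E).
Proof.
move=> bg; have gi := integ_patch (bdd_integ mD finD bg); have [C kC] := kap_bounded.
apply: (@le_integrable _ _ _ mu setT measurableT _ (fun y => (C * (g \_ D) y)%:E)).
- apply/measurable_EFinP; apply: measurable_funM; last first.
    by apply/measurable_EFinP; exact: measurable_int gi.
  by apply: continuous_measurable_rV; exact: continuous_kap_sub.
- move=> y _; rewrite lee_fin normrM [leRHS]normrM; apply: ler_wpM2r => //.
  exact: le_trans (kC _) (ler_norm _).
- by have := integrableZl measurableT C gi.
Qed.

(** The kernel has unit mass, so [avg g x - a] is the average of g - a, to which only points within
    the radius of [x] contribute. The pointwise limit and the uniform bound of the averages are both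
    instances. *)
Lemma avg_dist g x a e : bdd D g -> 0 <= e ->
  (forall y, `|x - y| <= radius -> `|(g \_ D) y - a| <= e) -> `|avg g x - a| <= e.
Proof.
move=> bg e0 ge; have ki := integrable_kap x.
have kgi := integrable_kap_mul x bg.
have kai : mu.-integrable setT (fun y => (kap (x - y) * a)%:E).
  have := integrableZl measurableT a ki.
  by congr (_.-integrable _ _); apply/funext => y; rewrite mulrC EFinM.
have kei : mu.-integrable setT (fun y => (kap (x - y) * e)%:E).
  have := integrableZl measurableT e ki.
  by congr (_.-integrable _ _); apply/funext => y; rewrite mulrC EFinM.
have kdi : mu.-integrable setT (fun y => (kap (x - y) * (g \_ D) y - kap (x - y) * a)%:E).
  by have := integrableB measurableT kgi kai.
have -> : avg g x - a = \int[mu]_y (kap (x - y) * (g \_ D) y - kap (x - y) * a).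
  rewrite RintegralB// -avgE; congr (_ - _).
  by rewrite RintegralZr// integral_kap mul1r.
apply: le_trans (le_normr_Rintegral _ kdi) _ => //.
have -> : e = \int[mu]_y (kap (x - y) * e) by rewrite RintegralZr// integral_kap mul1r.
apply: le_Rintegral => //.
  exact: integrable_norm kdi.
move=> y _; rewrite -mulrBr normrM ger0_norm ?kap_ge0//.
have [xy|xy] := leP `|x - y| radius; last by rewrite kap_out// !mul0r.
by apply: ler_wpM2l; [exact: kap_ge0|exact: ge].
Qed.

(** On [D], the average is the inner integral in Fubini's theorem for the tensor integrand whose
    first factor is the indicator of [D]. *)
Lemma measurable_avg g : bdd D g -> measurable_fun D (avg g).
Proof.
move=> bg; have gi := integ_patch (bdd_integ mD finD bg); have [C kC] := kap_bounded.
have oi : mu.-integrable setT (EFin \o (patch (fun=> 0) D (fun=> 1)) : _ -> \bar R).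
  by apply: integ_patch; apply: bdd_integ => //; exact: bdd_const.
have mk : measurable_fun setT kap by apply: continuous_measurable_rV; exact: continuous_kap.
have := measurable_fubini_F (integrable_tensor oi gi mk kC).
move=> /(measurable_funTS (D := D))/(measurableT_comp (@fine_measurable R _ measurableT)).
apply: eq_measurable_fun => x xD.
rewrite avgE /Rintegral /fubini_F /=; congr fine; apply: eq_integral => y _.
by rewrite !patchE xD mul1r.
Qed.

Lemma avg_le g x M : bdd D g -> (forall y, D y -> `|g y| <= M) -> 0 <= M -> `|avg g x| <= M.
Proof.
move=> bg gM M0; rewrite -[avg g x]subr0; apply: avg_dist => // y _.
by rewrite subr0 patchE; case: ifPn => [/set_mem/gM//|_]; rewrite normr0.
Qed.

End mollification.

Lemma avg_cvg b g x : pws g -> D x -> avg n b g x @[n --> \oo] --> g x.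
Proof.
move=> pg [k _ kx]; have [p sp gp] := pg k; have cp := smooth_continuous sp.
apply/cvgrPdist_le => e e0.
have /nbhs_ballP[c /= c0 cb] : \forall y \near x, open_simplex (T k) y /\ `|p x - p y| < e.
  near=> y; split; last by near: y; move/cvgrPdist_lt : (cp x); exact.
  by near: y; exact: (open_nbhs_nbhs (conj (open_open_simplex (ndT k)) kx)).
near=> n; rewrite distrC; apply: avg_dist => [|//|y xy]; [exact: pws_bdd|exact: ltW|].
have [ky py] : open_simplex (T k) y /\ `|p x - p y| < e.
  apply: cb; rewrite -ball_normE /=; apply: le_lt_trans xy _.
  by near: n; exact: near_infty_natSinv_lt (PosNum c0).
rewrite patchE mem_set; last by exists k.
by rewrite (gp _ ky) (gp _ kx) distrC ltW.
Unshelve. all: by end_near. Qed.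

(** Dominated convergence: the averages converge at every point of the open simplices and inherit
    the bound of [g]. Only the averaged factor has to be piecewise smooth. *)
Lemma ip_avg_cvg b f g : L2 D f -> pws g ->
  ip D f (avg n b g) @[n --> \oo] --> ip D f g.
Proof.
move=> fL pg.
have bg := pws_bdd pg; have [mf _] := fL; have [mg [M0 gM0]] := bg.
pose M := `|M0|; have gM x : D x -> `|g x| <= M by move=> /gM0 H; exact: le_trans H (ler_norm _).
have mF n : measurable_fun D (fun x => f x * avg n b g x).
  by apply: measurable_funM => //; exact: measurable_avg.
have dom n x : `|f x * avg n b g x| <= M * `|f x|.
  by rewrite normrM mulrC; apply: ler_wpM2r => //; apply: avg_le => //; exact: normr_ge0.
have Mf : mu.-integrable D (fun x => (M * `|f x|)%:E).
  by apply: (integ_scale mD M); apply: integrable_norm; exact: L2_integ.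
have Fi n : mu.-integrable D (fun x => (f x * avg n b g x)%:E).
  apply: (le_integrable mD _ _ Mf); first exact/measurable_EFinP.
  by move=> x _ /=; rewrite lee_fin (le_trans (dom _ _))// ler_norm.
have [] := @dominated_convergence _ _ R mu D mD (fun n x => (f x * avg n b g x)%:E)
  (fun x => (f x * g x)%:E) (fun x => (M * `|f x|)%:E).
- by move=> n; apply/measurable_EFinP.
- by apply/measurable_EFinP; apply: measurable_funM.
- apply: aeW => x Dx; apply: cvg_EFin; first by near=> n.
  by apply: (@cvgM R nat \oo _ (fun=> f x) (fun n => avg n b g x)); [exact: cvg_cst|exact: avg_cvg].
- exact: Mf.
- by apply: aeW => x n Dx; rewrite lee_fin.
move=> gi _ H; rewrite /ip /Rintegral; apply: (@fine_cvg _ _ _ _ _ _).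
by rewrite fineK//; exact: integrable_fin_num.
Unshelve. all: by end_near. Qed.

Lemma is_derive_reflect f (v x y : 'rV[R]_d) (l : R) :
  is_derive (y - x) v f l -> is_derive x v (fun z => f (y - z)) (- l).
Proof.
move=> df.
have dg : is_derive (0 : R) 1 (fun t : R => f (y - x + t *: v)) l.
  by apply: is_derive_line; rewrite scale0r addr0.
have dN : is_derive (0 : R) 1 (fun t : R => - t) (-1) by apply: is_deriveN; exact: is_derive_id.
have dg0 : is_derive (- (0 : R)) 1 (fun t : R => f (y - x + t *: v)) l by rewrite oppr0.
have := is_derive1_comp dg0 dN; rewrite mulrN1.
apply: is_derive_reparam => h /=.
by rewrite [h *: 1]mulr1 addr0 scaleNr opprD addrA addrAC.
Qed.

Lemma Cn_reflect n f (y : 'rV[R]_d) : Cn n f -> Cn n (fun x => f (y - x)).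
Proof.
have cc g : continuous g -> continuous (fun x : 'rV[R]_d => g (y - x)).
  by move=> cg x; exact: (continuous_comp (@continuous_subl d y x) (cg _)).
elim: n f => [|n IH] f; first by move=> [cf _]; split => //; exact: cc.
move=> Cf; apply: Cn_intro; first by apply: cc; case: Cf.
move=> j; exists (fun x => - 'D_('e_j) f (y - x)).
  by move=> x; apply: is_derive_reflect; exact: Cn_is_derive Cf.
by apply: Cn_opp; apply: (IH (fun x => 'D_('e_j) f x)); exact: Cn_derive.
Qed.

Lemma smooth_reflect f (y : 'rV[R]_d) : smooth f -> smooth (fun x => f (y - x)).
Proof. by move=> sf n; exact: Cn_reflect. Qed.

Lemma pd_reflect i f (y : 'rV[R]_d) : smooth f ->
  pd i (fun x => f (y - x)) = fun x => - pd i f (y - x).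
Proof.
move=> sf; case: (pdP i) => [[j _ E]|[_ E]]; last first.
  by rewrite (E f) (E (fun x => _)); apply/funext => x; rewrite oppr0.
rewrite (E f) (E (fun x => _)); apply/funext => x.
have dx := is_derive_reflect (Cn_is_derive j (y - x) (sf 1%N)).
by have [_ ->] := dx.
Qed.

Definition conv (K g : sfield R d) (x : 'rV[R]_d) : R := \int[mu]_(y in D) (K (x - y) * g y).

Section adjoint.
Variables (K : sfield R d) (C : R).
Hypotheses (cK : continuous K) (KC : forall z, `|K z| <= C).

Lemma conv_integ g x : integ D g -> integ D (fun y => K (x - y) * g y).
Proof.
move=> gi; apply: (integ_le mD (g := fun y => C * `|g y|)).
- apply: measurable_funM; last exact: integ_measurable gi.
  apply: measurable_funTS; apply: continuous_measurable_rV => y.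
  exact: (continuous_comp (@continuous_subl d x y) (@cK (x - y))).
- by apply: integ_scale => //; have := integrable_norm gi.
- by move=> y _; rewrite normrM; apply: ler_wpM2r.
Qed.

Lemma conv_tensor f g x : integ D g ->
  (\int[mu]_y ((f \_ D) x * K (x - y) * (g \_ D) y)%:E)%E = (((fun x => f x * conv K g x) \_ D) x)%:E.
Proof.
move=> gi; rewrite [in RHS]patchE; case: ifPn => xD; last first.
  by rewrite integral0_eq// => y _; rewrite patchE (negbTE xD) !mul0r.
have ki : mu.-integrable D (fun y => (K (x - y) * g y)%:E) := conv_integ x gi.
rewrite EFinM /conv /Rintegral fineK; last exact: integrable_fin_num.
rewrite -integralZl// [RHS]integral_mkcond; apply: eq_integral => y _.
by rewrite !patchE xD; case: ifP => _; rewrite ?mulr0// -EFinM mulrA.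
Qed.

Lemma conv_mul_integ f g : integ D f -> integ D g -> integ D (fun x => f x * conv K g x).
Proof.
move=> fi gi.
have mK : measurable_fun setT K by exact: continuous_measurable_rV.
have := integrable_fubini_F (integrable_tensor (integ_patch fi) (integ_patch gi) mK KC).
rewrite /fubini_F; under [X in _.-integrable _ X]eq_fun do rewrite conv_tensor//.
by move=> H; apply/(integrable_mkcond _ mD); rewrite restrict_EFin.
Qed.

End adjoint.

Lemma conv_adjoint (K f g : sfield R d) (C : R) : continuous K -> (forall z, `|K z| <= C) ->
  integ D f -> integ D g ->
  \int[mu]_(x in D) (f x * conv K g x) = \int[mu]_(y in D) (g y * conv (fun z => K (- z)) f y).
Proof.
move=> cK KC fi gi.
have cK' : continuous (fun z : 'rV[R]_d => K (- z)).
  by move=> z; apply: continuous_comp; [exact: oppr_continuous|exact: cK].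
have mK : measurable_fun setT K by exact: continuous_measurable_rV.
have KC' (z : 'rV[R]_d) : `|K (- z)| <= C by [].
have := Fubini (integrable_tensor (integ_patch fi) (integ_patch gi) mK KC).
under eq_integral do rewrite (conv_tensor cK KC)//.
have E y : (\int[mu]_x ((f \_ D) x * K (x - y) * (g \_ D) y)%:E)%E =
    (((fun x => g x * conv (fun z => K (- z)) f x) \_ D) y)%:E.
  rewrite -(conv_tensor cK' KC')//; apply: eq_integral => x _.
  by rewrite opprB mulrC mulrA mulrAC.
under [RHS]eq_integral do rewrite E.
move=> H; rewrite /Rintegral; congr fine.
by rewrite integral_mkcond [RHS]integral_mkcond !restrict_EFin.
Qed.

Lemma smooth_kap n b : smooth (kap n b).
Proof.
apply: smooth_mul; first exact: smooth_const.
case: b; first exact: smooth_mollifier.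
rewrite (_ : (fun z => _) = fun z : 'rV[R]_d => mollifier (radius n) (0 - z)).
  by apply: smooth_reflect; exact: smooth_mollifier.
by apply/funext => z; rewrite sub0r.
Qed.

Lemma kapN n b z : kap n b (- z) = kap n (~~ b) z.
Proof. by rewrite /kap; case: b; rewrite ?opprK. Qed.

Lemma pd_kapN n b a z : pd a (kap n b) (- z) = - pd a (kap n (~~ b)) z.
Proof.
have -> : kap n (~~ b) = fun z => kap n b (0 - z) by apply/funext => y; rewrite sub0r kapN.
by rewrite pd_reflect ?opprK ?sub0r//; exact: smooth_kap.
Qed.

Lemma pd_kap_bounded n b a : exists C, forall z, `|pd a (kap n b) z| <= C.
Proof.
apply: (bounded_support_bounded (M := radius n)) => [|z rz].
  by apply: smooth_continuous; apply: smooth_pd; exact: smooth_kap.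
case: (pdP a) => [[j _ ->]|[_ ->]]//.
have k0 : \near z, kap n b z = 0.
  near=> y; apply: kap_out; near: y.
  apply: open_nbhs_nbhs; split => //.
  have := @norm_continuous _ 'rV[R]_d => /continuousP/(_ _ (@open_gt R (radius n))).
  by [].
by rewrite (@near_eq_derive _ _ _ (kap n b) (cst 0))// derive_cst.
Unshelve. all: by end_near. Qed.

Definition dconv n b a (g : sfield R d) := conv (pd a (kap n b)) g.

(** The trace condition is tested with $x\mapsto\kappa(y-x)c$, which is smooth but need not vanish
    at the boundary: this is where the zero tangential trace of [A] enters, and why [y] may be
    arbitrarily close to the boundary. *)
Lemma avg_trace n b (A w : vfield R d) (c : 'rV[R]_3) y : trace_curl A w ->
  \sum_i c 0 i * avg n b (vcomp i w) y =
  - \sum_i (c 0 (i + 2%:R) * dconv n b (i + 1) (vcomp i A) y -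
            c 0 (i + 1) * dconv n b (i + 2%:R) (vcomp i A) y).
Proof.
move=> [AL [wL _] tr].
pose Phi : vfield R d := fun x => \row_i (c 0 i * kap n b (y - x)).
have sk := smooth_reflect y (@smooth_kap n b).
have PhiE i : vcomp i Phi = fun x => c 0 i * kap n b (y - x).
  by apply/funext => x; rewrite /vcomp mxE.
have sPhi : vsmooth Phi by move=> i; rewrite PhiE; apply: smooth_mul => //; exact: smooth_const.
have [C kC] := kap_bounded n b.
have /choice[Ca KC] a := pd_kap_bounded n b a.
have cK a : continuous (pd a (kap n b)).
  by apply: smooth_continuous; apply: smooth_pd; exact: smooth_kap.
have wi i : integ D (vcomp i w) by apply: L2_integ => //; exact: vL2_mesh.
have Ai i : integ D (vcomp i A) by apply: L2_integ => //; exact: vL2_mesh.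
have AD := vL2_mesh AL; have wD := vL2_mesh wL.
have PD : vL2 D Phi by apply: vL2_mesh; exact: vsmooth_vL2.
have cPD : vL2 D (curl Phi) by apply: vL2_mesh; apply: vsmooth_vL2; exact: smooth_curl.
have := tr _ sPhi; rewrite !vip_Omega !vipE// => E; transitivity (\sum_i ip D (vcomp i w) (vcomp i Phi)).
  apply: eq_bigr => i _; rewrite PhiE /avg -RintegralZl//; last first.
    exact: (conv_integ (@continuous_kap n b) kC y (wi i)).
  by rewrite /ip; apply: eq_Rintegral => x _; rewrite mulrA mulrC.
rewrite -E -sumrN; apply: eq_bigr => i _.
have pdPhi a j : pd a (vcomp j Phi) = fun x => c 0 j * - pd a (kap n b) (y - x).
  rewrite PhiE (pd_scale a (c 0 j) sk); apply/funext => x; congr (_ * _).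
  exact: (congr1 (@^~ x) (pd_reflect a y (@smooth_kap n b))).
rewrite vcomp_curl !pdPhi.
have I1 a : integ D (fun x => pd a (kap n b) (y - x) * vcomp i A x).
  exact: (conv_integ (cK a) (KC a) y (Ai i)).
rewrite /dconv /conv -!RintegralZl//; last 2 first.
- exact: I1.
- exact: I1.
rewrite -RintegralB//; last 2 first.
- by apply: integ_scale => //; exact: I1.
- by apply: integ_scale => //; exact: I1.
rewrite /ip -[RHS]mulN1r -RintegralZl//; last first.
  by apply: integ_sub => //; apply: integ_scale => //; exact: I1.
by apply: eq_Rintegral => x _; clear; ring.
Qed.

(** The previous identity is used at each point x with the constant vector [c] equal to $A'(x)$, and
    then integrated; no derivative falls on [A']. *)
Lemma avg_trace_ip n b (A w A' : vfield R d) : trace_curl A w -> vL2 D A' ->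
  \sum_i ip D (vcomp i A') (avg n b (vcomp i w)) =
  - \sum_i (ip D (vcomp (i + 2%:R) A') (dconv n b (i + 1) (vcomp i A)) -
            ip D (vcomp (i + 1) A') (dconv n b (i + 2%:R) (vcomp i A))).
Proof.
move=> tr A'L; have [AL [wL _] _] := tr.
have [C kC] := kap_bounded n b.
have /choice[Ca KC] a := pd_kap_bounded n b a.
have cK a : continuous (pd a (kap n b)).
  by apply: smooth_continuous; apply: smooth_pd; exact: smooth_kap.
have toI v i : vL2 D v -> integ D (vcomp i v).
  by move=> vL; exact: L2_integ.
have wi i := toI w i (vL2_mesh wL); have Ai i := toI A i (vL2_mesh AL).
have A'i i := toI A' i A'L.
have I1 a i j : integ D (fun x => vcomp j A' x * dconv n b a (vcomp i A) x).
  exact: (conv_mul_integ (cK a) (KC a) (A'i j) (Ai i)).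
rewrite -(@Rintegral_sum _ _ _ mD _ _ (fun i x => vcomp i A' x * avg n b (vcomp i w) x)); last first.
  by move=> i; exact: (conv_mul_integ (@continuous_kap n b) kC (A'i i) (wi i)).
under eq_Rintegral => x _ do rewrite (avg_trace n b (A' x) x tr).
have I2 i : integ D (fun x => A' x 0 (i + 2%:R) * dconv n b (i + 1) (vcomp i A) x -
    A' x 0 (i + 1) * dconv n b (i + 2%:R) (vcomp i A) x).
  by apply: integ_sub => //; exact: I1.
under eq_Rintegral do rewrite -mulN1r.
rewrite RintegralZl//; last by apply: integ_sum => // i _; exact: I2.
rewrite mulN1r Rintegral_sum//; congr (- _); apply: eq_bigr => i _.
by rewrite RintegralB//; exact: I1.
Qed.

(** Averaging turns both sides into sums in which all derivatives fall on the kernel. [swap] moves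
    the kernel from one field to the other at the cost of a sign and a reflection, so the averaged
    pairings coincide for every n. Only the curls [w] and [w'] are averaged when passing to the
    limit, hence only they are assumed piecewise smooth. *)
Lemma trace_curl_symmetric (A w A' w' : vfield R d) :
  trace_curl A w -> trace_curl A' w' -> vpws w -> vpws w' ->
  vip D A w' = vip D w A'.
Proof.
move=> tA tA' pw pw'.
have [AL _ _] := tA; have [A'L _ _] := tA'.
have AD := vL2_mesh AL; have A'D := vL2_mesh A'L.
have toI v i : vL2 D v -> integ D (vcomp i v) by move=> vL; apply: L2_integ.
have swap n b a f g : integ D f -> integ D g ->
    ip D f (dconv n b a g) = - ip D g (dconv n (~~ b) a f).
  move=> fi gi; have [C KC] := pd_kap_bounded n b a.
  have [C' KC'] := pd_kap_bounded n (~~ b) a.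
  have cK b' : continuous (pd a (kap n b')).
    by apply: smooth_continuous; apply: smooth_pd; exact: smooth_kap.
  rewrite /ip (conv_adjoint (cK b) KC)// -mulN1r -RintegralZl//; last first.
    exact: (conv_mul_integ (cK (~~ b)) KC' gi fi).
  apply: eq_Rintegral => x _; rewrite mulrCA; congr (_ * _).
  rewrite -[RHS]RintegralZl//; last exact: (conv_integ (cK (~~ b)) KC' x fi).
  by apply: eq_Rintegral => y _; rewrite pd_kapN mulN1r mulNr.
have E n : \sum_i ip D (vcomp i A) (avg n true (vcomp i w')) =
           \sum_i ip D (vcomp i A') (avg n false (vcomp i w)).
  rewrite (avg_trace_ip n true tA' AD) (avg_trace_ip n false tA A'D).
  under eq_bigr => i _.
    rewrite (swap n true _ (vcomp (i + 2%:R) A))//; [|exact: toI|exact: toI].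
    rewrite (swap n true _ (vcomp (i + 1) A))//; [|exact: toI|exact: toI].
    over.
  rewrite !sum3 !ord3_add /=.
  do 6 (move: (ip D _ _) => ?); clear; ring.
have lim b (v z : vfield R d) : vL2 D v -> vpws z ->
    \sum_i ip D (vcomp i v) (avg n b (vcomp i z)) @[n --> \oo] --> vip D v z.
  move=> vL pz; rewrite vipE//; last exact: vpws_vL2.
  by rewrite !sum3; under eq_fun do rewrite sum3; apply: cvgD; [apply: cvgD|];
    apply: ip_avg_cvg => //; exact: pz.
have L := lim false _ _ A'D pw; rewrite -(funext E) in L.
by rewrite (vipC D w); exact: (cvg_unique _ (lim true _ _ AD pw') L).
Qed.

Lemma vip_zerol (v : vfield R d) : vip Omega (fun=> 0) v = 0.
Proof.
rewrite /vip; under eq_Rintegral => x _.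
  rewrite [dot _ _](_ : _ = 0); last by rewrite /dot big1// => i _; rewrite mxE mul0r.
  over.
by rewrite Rintegral_cst// mul0r.
Qed.

Lemma vip_linl a u v w : vL2 Omega u -> vL2 Omega v -> vL2 Omega w ->
  vip Omega (fun x => a *: u x + v x) w = a * vip Omega u w + vip Omega v w.
Proof.
move=> uL vL wL; rewrite vip_addl//; last exact: vL2_scale.
by rewrite vip_scalel.
Qed.

(** * Discrete spaces and Riesz representation *)

(* Each step splits off a non-null field f of V, the orthogonal complement of f
   in V being separated by one functional less. *)
Lemma finite_riesz (k : nat) (V : set (vfield R d)) (L : vfield R d -> R)
    (phi : 'I_k -> vfield R d -> R) :
  V (fun=> 0) -> (forall u, V u -> vL2 Omega u) ->
  (forall a u v, V u -> V v -> V (fun x => a *: u x + v x)) ->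
  (forall a u v, V u -> V v -> L (fun x => a *: u x + v x) = a * L u + L v) ->
  (forall u, V u -> vip Omega u u = 0 -> L u = 0) ->
  (forall j a u v, V u -> V v ->
    phi j (fun x => a *: u x + v x) = a * phi j u + phi j v) ->
  (forall u, V u -> (forall j, phi j u = 0) -> vip Omega u u = 0) ->
  exists2 w, V w & forall v, V v -> vip Omega w v = L v.
Proof.
elim: k V L phi => [|k IH] V L phi V0 VL Vlin Llin Lnull philin phisep.
  by exists (fun=> 0) => // v Vv; rewrite Lnull ?vip_zerol//; apply: phisep => // -[].
have [allnull|/existsNP[f /not_implyP[Vf fn]]] := pselect (forall v, V v -> vip Omega v v = 0).
  by exists (fun=> 0) => // v Vv; rewrite Lnull ?vip_zerol//; exact: allnull.
have [j pj] : exists j, phi j f != 0.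
  apply: contrapT => H; apply: fn; apply: phisep => // j.
  by apply/eqP/negPn/negP => pj; apply: H; exists j.
have q0 : vip Omega f f != 0 by apply/eqP.
pose V' := [set v | V v /\ vip Omega v f = 0].
(* Subtracting a multiple of [phi j] makes these functionals vanish on [f]. *)
pose phi' i v := phi (lift j i) v - phi (lift j i) f / phi j f * phi j v.
have [|||||||w' [Vw' w'f] w'E] := IH V' L phi'.
- by split => //; exact: vip_zerol.
- by move=> u [/VL].
- move=> a u v [Vu uf] [Vv vf]; split; first exact: Vlin.
  by rewrite vip_linl; [rewrite uf vf mulr0 addr0|exact: VL|exact: VL|exact: VL].
- by move=> a u v [Vu _] [Vv _]; exact: Llin.
- by move=> u [Vu _]; exact: Lnull.
- move=> i a u v [Vu _] [Vv _]; rewrite /phi' !philin//.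
  by move: (phi _ f / _) => z; clear; ring.
(* All the functionals vanish on $u-tf$, which is therefore null; pairing it with [f], to which [u]
   is orthogonal, gives t = 0. *)
- move=> u [Vu uf] u0; pose t := phi j u / phi j f.
  have Vr : V (fun x => - t *: f x + u x) by exact: Vlin.
  have rn : vip Omega (fun x => - t *: f x + u x) (fun x => - t *: f x + u x) = 0.
    apply: phisep => // i; rewrite philin// /t.
    case: (unliftP j i) => [i'|] ->; last by rewrite mulNr divfK// addNr.
    have /eqP := u0 i'; rewrite /phi' subr_eq0 => /eqP ->.
    by move: (phi (lift j i') f) (phi j u) (phi j f)^-1 => *; clear; ring.
  have rL := VL _ Vr.
  have := vip_null mO rL (VL _ Vf) rn.
  rewrite vip_linl; [|exact: VL|exact: VL|exact: VL].
  rewrite uf addr0 => /eqP; rewrite mulf_eq0 (negbTE q0) orbF oppr_eq0 => /eqP t0.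
  by move: rn; rewrite t0; under [fun x => - 0 *: _ + _]eq_fun do rewrite oppr0 scale0r add0r.
exists (fun x => (L f / vip Omega f f) *: f x + w' x); first exact: Vlin.
move=> v Vv; pose t := vip Omega v f / vip Omega f f.
have Vv' : V' (fun x => - t *: f x + v x).
  split; first exact: Vlin.
  rewrite vip_linl; [|exact: VL|exact: VL|exact: VL].
  by rewrite /t mulNr divfK// addNr.
have w'v : vip Omega w' v = - t * L f + L v.
  rewrite -Llin// -(w'E _ Vv') [RHS]vipC vip_linl; [|exact: VL|exact: VL|exact: VL].
  by rewrite [vip Omega f w']vipC w'f mulr0 add0r vipC.
rewrite vip_linl; [|exact: VL|exact: VL|exact: VL].
rewrite w'v /t [vip Omega v f]vipC.
by move: (vip _ f v) (vip _ f f)^-1 => *; clear; ring.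
Qed.

Section monomials.
Variable n : nat.
Local Notation mono_index := ('I_N * {ffun 'I_d -> 'I_n.+1})%type.

Definition mono (p : mono_index) : sfield R d :=
  glue (fun l x => (l == p.1)%:R * \prod_i x 0 i ^+ p.2 i).

Lemma mono_pws p : pws (mono p).
Proof.
move=> k; exists (fun x => (k == p.1)%:R * \prod_i x 0 i ^+ p.2 i).
  move=> m; apply: Cn_mul; first exact: Cn_const.
  apply: Cn_prod => i _.
  rewrite (_ : (fun x : 'rV[R]_d => x 0 i ^+ p.2 i) = fun x => \prod_(j < p.2 i) x 0 i).
    by apply: Cn_prod => j _; exact: Cn_coord.
  by apply/funext => x; rewrite prodr_const card_ord.
by move=> x kx; rewrite /mono (glueE _ kx).
Qed.

Lemma mono_span u i : vpp n u -> exists c : mono_index -> R,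
  forall x, D x -> vcomp i u x = \sum_p c p * mono p x.
Proof.
move=> [P pP uP].
have /choice[c cP] : forall k, exists c : {ffun 'I_d -> 'I_n.+1} -> R, forall x,
    vcomp i (P k) x = \sum_(al : {ffun 'I_d -> 'I_n.+1} | (\sum_i al i <= n)%N)
            c al * \prod_i x 0 i ^+ al i by move=> k; exact: pP.
exists (fun p : mono_index => if (\sum_i p.2 i <= n)%N then c p.1 p.2 else 0) => x [k _ kx].
rewrite /vcomp (uP k x kx) [LHS]cP -(pair_bigA _ (fun l al =>
  (if (\sum_i (al : {ffun 'I_d -> 'I_n.+1}) i <= n)%N then c l al else 0) * mono (l, al) x)) /=.
rewrite (bigD1 k)//= [X in _ = _ + X]big1 => [|l lk]; last first.
  rewrite big1// => al _; rewrite /mono (glueE _ kx) /=.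
  by rewrite eq_sym (negbTE lk) mul0r mulr0.
rewrite addr0 big_mkcond; apply: eq_bigr => al _.
by rewrite /mono (glueE _ kx) eqxx mul1r; case: ifP => _ //; rewrite mul0r.
Qed.

(* Inner products with monomials serve as coordinates, because unlike
   coefficients they are visibly linear in u. *)
Lemma mono_separates u : vpp n u ->
  (forall i p, ip D (vcomp i u) (mono p) = 0) -> vip D u u = 0.
Proof.
move=> pu u0.
have bu i := pws_bdd (vpp_vpws pu i).
have uL := vpws_vL2 (vpp_vpws pu).
rewrite vipE// big1// => i _; have [c cE] := mono_span i pu.
have mi p : integ D (fun x => vcomp i u x * mono p x).
  by apply: bdd_integ => //; apply: bdd_mul => //; exact: pws_bdd (mono_pws p).
transitivity (\int[mu]_(x in D) \sum_p (c p * (vcomp i u x * mono p x))).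
  apply: eq_Rintegral => x /set_mem Dx; rewrite {2}cE// mulr_sumr.
  by apply: eq_bigr => p _; rewrite mulrCA.
rewrite Rintegral_sum//; last by move=> p; exact: integ_scale.
rewrite big1// => p _; rewrite RintegralZl//; last exact: mi.
by rewrite [X in _ * X](_ : _ = ip D (vcomp i u) (mono p))// u0 mulr0.
Qed.

(** The separating functionals are the inner products of the three components with the finitely many
    monomials living on a single simplex. The member [u0] puts the zero field in [V]. *)
Lemma riesz (V : set (vfield R d)) (L : vfield R d -> R) u0 :
  V u0 -> (forall u, V u -> vL2 Omega u /\ vpp n u) ->
  (forall a u v, V u -> V v -> V (fun x => a *: u x + v x)) ->
  (forall a u v, V u -> V v -> L (fun x => a *: u x + v x) = a * L u + L v) ->
  (forall u, V u -> vip Omega u u = 0 -> L u = 0) ->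
  exists2 w, V w & forall v, V v -> vip Omega w v = L v.
Proof.
move=> Vu0 VL Vlin Llin Lnull.
pose phi (j : 'I_#|{: 'I_3 * mono_index}|) u :=
  ip D (vcomp (enum_val j).1 u) (mono (enum_val j).2).
apply: (@finite_riesz _ V L phi) => //.
- by have := Vlin (-1) _ _ Vu0 Vu0; rewrite (_ : (fun x => _) = fun=> 0)//;
    apply/funext => x; rewrite scaleN1r addNr.
- by move=> u /VL[].
- move=> j a u v /VL[uL _] /VL[vL _]; rewrite /phi.
  have mL : L2 D (mono (enum_val j).2).
    by apply: bdd_L2 => //; exact: pws_bdd (mono_pws _).
  have uD := vL2_mesh uL; have vD := vL2_mesh vL.
  rewrite vcompD vcompZ ip_addl//; last by apply: L2_scale => //.
  by rewrite ip_scalel.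
- move=> u /VL[_ pu] u0'; rewrite vip_Omega; apply: mono_separates => // i p.
  by have := u0' (enum_rank (i, p)); rewrite /phi enum_rankK.
Qed.

End monomials.

(** [xget] returns its default 0 unless some field satisfies the defining identities; Riesz
    representation supplies such a field. *)
Lemma pi_divP r u : (exists w, U_div Omega T r w) -> vL2 Omega u ->
  U_div Omega T r (pi_div Omega T r u) /\
  forall v, U_div Omega T r v -> vip Omega (pi_div Omega T r u) v = vip Omega u v.
Proof.
move=> [w0 Uw0] uL.
have [||||w Uw wE] := @riesz r.+1 (U_div Omega T r) (vip Omega u) _ Uw0.
- by move=> v Uv; split; [exact: U_div_vL2 Uv|exact: U_div_vpp].
- by move=> a v w Uv Uw; exact: U_div_lin.
- move=> a v w /U_div_vL2 vL /U_div_vL2 wL.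
  by rewrite vipC vip_linl// [vip _ v _]vipC [vip _ w _]vipC.
- by move=> v /U_div_vL2 vL vn; rewrite vipC vip_null.
rewrite /pi_div; case: xgetP => [y -> //|/(_ w)]; by case.
Qed.

Lemma wcurlP u : H0curl Omega u -> weak_curl Omega u (wcurl Omega u).
Proof.
move=> /H0curl_has_curl[w [_ uw _]]; rewrite /wcurl.
by case: xgetP => [y -> //|/(_ w)].
Qed.

Lemma wcurl_ip u w C : H0curl Omega u -> weak_curl Omega u w -> vpws C ->
  vip Omega (wcurl Omega u) C = vip Omega w C.
Proof. by move=> /wcurlP hu uw pC; rewrite !vip_Omega; exact: curl_dense hu uw pC. Qed.

(** [wcurl] is chosen separately for each field and need not be linear, nor vanish on null fields.
    Its pairing with [u], which is piecewise polynomial, has both properties, because all weak curls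
    of a field have the same pairing with [u]. *)
Lemma curl_hP r u : (exists w, U_curl Omega T r w) -> U_div Omega T r u ->
  U_curl Omega T r (curl_h Omega T r u) /\
  forall v, U_curl Omega T r v -> vip Omega (curl_h Omega T r u) v = vip Omega u (wcurl Omega v).
Proof.
move=> [w0 Uw0] Uu; have uL := U_div_vL2 Uu.
have pu := vpp_vpws (U_div_vpp Uu).
have cL v : U_curl Omega T r v -> vL2 Omega (wcurl Omega v) by move=> [/wcurlP[]].
have [||||w Uw wE] := @riesz r.+1 (U_curl Omega T r) (fun v => vip Omega u (wcurl Omega v)) _ Uw0.
- by move=> v Uv; split; [exact: U_curl_vL2 Uv|exact: U_curl_vpp].
- by move=> a v w Uv Uw; exact: U_curl_lin.
- move=> a v w Uv Uw; have Ul := U_curl_lin a Uv Uw.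
  have [[hv _] [hw _] [hl _]] := And3 Uv Uw Ul.
  have vL := U_curl_vL2 Uv; have wL := U_curl_vL2 Uw.
  rewrite !(vipC Omega u) -vip_linl//; [|exact: cL|exact: cL].
  apply: wcurl_ip => //; split.
    by apply: vL2_add => //; [exact: vL2_scale (cL _ Uv)|exact: cL].
  move=> Phi tP; have PL := vsmooth_vL2 (vtest_smooth tP).
  have cPL := vsmooth_vL2 (smooth_curl (vtest_smooth tP)).
  rewrite !vip_linl//; [|exact: cL|exact: cL].
  by rewrite (wcurlP hv).2// (wcurlP hw).2.
- move=> v Uv vn; have vL := U_curl_vL2 Uv; have [hv _] := Uv.
  rewrite vipC -[RHS](vip_zerol u); apply: wcurl_ip => //; split.
    move=> i; rewrite (_ : vcomp i _ = fun=> 0); last by apply/funext => x; rewrite /vcomp mxE.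
    exact: L2_0.
  move=> Phi tP; rewrite vip_zerol vip_null//.
  exact: vsmooth_vL2 (smooth_curl (vtest_smooth tP)).
by rewrite /curl_h; case: xgetP => [y -> //|/(_ w)]; case.
Qed.

(** * Curls of planar fields *)

(** In the plane $\partial_3=0$, so the planar components of [curl Phi] involve only the third
    component of [Phi]. Testing [w] with the orthogonal part of [Phi] therefore gives the identity
    for [Phi] itself. *)
Lemma planar_curl_orth u w : d = 2%N -> weak_curl Omega (planar_part u) w ->
  weak_curl Omega (planar_part u) (fun x => orth (vcomp ord_max w x)).
Proof.
move=> d2 [wL wE]; split; first exact: vL2_orth.
move=> Phi tP.
have pd2 (i : 'I_3) (f : sfield R d) : (d <= i)%N -> pd i f = fun=> 0.
  move=> di; case: (pdP i) => [[j ji _]|[_ ->]]//.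
  by have := ltn_ord j; rewrite ji ltnNge di.
have tO : vtest Omega (fun x => orth (vcomp ord_max Phi x)).
  move=> i; rewrite vcomp_orth; case: eqP => _; first exact: tP.
  have := test_scale 0 (tP i); rewrite (_ : (fun x => 0 * _) = fun=> 0)//.
  by apply/funext => x; rewrite mul0r.
rewrite vip_orthl; transitivity (vip Omega w (fun x => orth (vcomp ord_max Phi x))).
  by rewrite vip_orthr.
rewrite (wE _ tO) /vip; apply: eq_Rintegral => x _.
apply: eq_bigr => i _; rewrite !mxE; case: eqP => [_|im]; first by rewrite !mul0r.
congr (_ * _); rewrite !vcomp_orth ord_max3.
have d2' : (d <= 2)%N by rewrite d2.
have : (i == 0) || (i == 1) by case: i im => -[|[|[|]]]// ? /eqP.
by move=> /orP[]/eqP ->; rewrite ?ord3_add !(pd2 2%:R)//= subr0 ?oppr0 ?sub0r.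
Qed.

(** For d = 2, [w] omits the curl of the planar part of [u]; that curl may be taken orthogonal to
    the plane, and so is not seen by the planar field [C]. *)
Lemma U_curl_wcurl_div r u w (C : vfield R d) : U_curl Omega T r u -> trace_curl (axial u) w ->
  vpws C -> (d = 2%N -> forall x, D x -> C x 0 ord_max = 0) ->
  vip Omega (wcurl Omega u) C = vip Omega w C.
Proof.
move=> [hu _] [aL aw _] pC C0; rewrite /axial in aL aw; case: eqVneq aL aw => [d2|d2] aL aw; last first.
  exact: wcurl_ip.
have CL := vpws_vL2 pC.
have [[pL [w' pw' _]] _] : H0curl_trace Omega (planar_part u) /\ H10 Omega (vcomp ord_max u).
  by move: (hu); rewrite /H0curl; case: eqP d2.
have [w3L w3E] := planar_curl_orth d2 pw'; have [wL wE] := aw.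
rewrite (wcurl_ip hu (w := fun x => 1 *: w x + orth (vcomp ord_max w' x)))//.
  rewrite !vip_Omega vip_addl//; [|by apply: vL2_mesh; exact: vL2_scale|exact: vL2_mesh].
  rewrite vip_scalel//; [|exact: vL2_mesh].
  rewrite mul1r -[RHS]addr0; congr (_ + _).
  rewrite -vip_Omega vip_orthl ip_Omega /ip.
  under eq_Rintegral => x /set_mem Dx do rewrite [vcomp _ C x](C0 d2 x Dx) mulr0.
  by rewrite Rintegral_cst ?mul0r//.
split; first by apply: vL2_add => //; exact: vL2_scale.
move=> Phi tP; have PL := vsmooth_vL2 (vtest_smooth tP).
have cPL := vsmooth_vL2 (smooth_curl (vtest_smooth tP)).
rewrite vip_linl// wE// w3E// mul1r.
by rewrite [in RHS](planar_orth u) vip_addl// addrC.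
Qed.

Lemma U_div_planar r u x : d = 2%N -> U_div Omega T r u -> D x -> u x 0 ord_max = 0.
Proof.
move=> d2 [_ ru] [k _ kx]; have [p [q [pp _ ->//]]] := ru k.
have d2' : (d <= @ord_max 2)%N by rewrite d2.
rewrite !mxE (pp ord_max).2// insubF ?mulr0 ?addr0//.
by rewrite d2.
Qed.

(** * Face terms *)

(** The point is the convex combination, with weights $1-\sum_m t_m$ and $t_m$, of the vertices of
    the face, which are vertices of both simplices; affine barycentric coordinates stay nonnegative
    there. *)
Lemma face_point_shared k l i (t : 'rV[R]_d.-1) : reference_simplex t ->
  shared_face (T k) (T l) i ->
  closed_simplex (T k) ((face_vertices (T k) i)`_0 +
    \sum_(m < d.-1) t 0 m *: face_edge (T k) i m) /\
  closed_simplex (T l) ((face_vertices (T k) i)`_0 +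
    \sum_(m < d.-1) t 0 m *: face_edge (T k) i m).
Proof.
move=> [t0 t1] sf; set p := face_vertices (T k) i; set x := _ + _.
have sp : size p = d.
  have := count_predC (pred1 i) (enum 'I_d.+1).
  rewrite count_uniq_mem ?enum_uniq// mem_enum size_enum_ord add1n => -[E].
  by rewrite size_map size_filter; exact: E.
suff H (L : simplex R d) : Defs.nondegenerate L ->
    (forall m, (m < d)%N -> exists j, p`_m = L j) -> closed_simplex L x.
  split; apply: H => // m md; have : p`_m \in p by rewrite mem_nth ?sp.
    by move=> /mapP[j _ ->]; exists j.
  move=> /mapP[j]; rewrite mem_filter => /andP[ji _] ->.
  have := sf; rewrite /shared_face => /forallP/(_ j); rewrite ji /= => /existsP[j' /eqP ->].
  by exists j'.
move=> ndL pL; rewrite closed_simplexE//= => j.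
have p0 m : (m < d)%N -> 0 <= bary L j p`_m.
  by move=> /pL[j' ->]; rewrite bary_vertex//.
have [a [g E]] := bary_affine L j.
have -> : bary L j x = (1 - \sum_m t 0 m) * bary L j p`_0 + \sum_m t 0 m * bary L j p`_m.+1.
  rewrite !E; under [X in _ = _ + X]eq_bigr do rewrite E mulrDr.
  rewrite big_split /= -mulr_suml /x dotC dotDl dotC.
  have -> : dot (\sum_(m < d.-1) t 0 m *: face_edge (T k) i m) g =
      \sum_(m < d.-1) t 0 m * dot g p`_m.+1 - (\sum_(m < d.-1) t 0 m) * dot g p`_0.
    rewrite mulr_suml -sumrB; elim/big_rec2 : _ => [|m y1 y2 _ <-].
      by rewrite /dot big1// => q _; rewrite mxE mul0r.
    rewrite dotDl dotZl /face_edge dotDl -scaleN1r dotZl -/p [dot _ g]dotC [dot p`_0 _]dotC.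
    by rewrite mulrDr mulN1r mulrN.
  by move: (\sum_m _) (\sum_m _) (dot g _) => *; clear; ring.
apply: addr_ge0; first by apply: mulr_ge0; [rewrite subr_ge0|exact: p0].
by apply: sumr_ge0 => m _; apply: mulr_ge0 => //; apply: p0; rewrite -ltn_predRL.
Qed.

Lemma trace_on_cst k (a : R) x : closed_simplex (T k) x -> trace_on (T k) (fun=> a) x = a.
Proof.
move=> kx; have PF := within_open_simplex_proper (ndT k) kx.
by apply: cvg_lim; [exact: Rhausdorff|exact: cvg_cst].
Qed.

(** The gradient of a constant vanishes, and so does its jump, as the points of a shared face lie in
    both closed simplices and the two traces are genuine limits. Mass conservation rests on this. *)
Lemma b_form_cst (a : R) g u : b_form T (fun=> a) g u = 0.
Proof.
rewrite /b_form [X in _ + X]big1 => [|k _]; last first.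
  rewrite big1// => l _; rewrite big1// => i sf.
  rewrite /face_integral (_ : Rintegral _ _ _ = 0) ?mulr0//.
  under eq_Rintegral => t /set_mem tr.
    have [kx lx] := face_point_shared tr sf.
    rewrite !trace_on_cst// scalerN subrr dotC (_ : dot 0 _ = 0) ?mul0r; last first.
      by rewrite /dot big1// => m _; rewrite mxE mul0r.
    over.
  by rewrite /Rintegral integral0_eq.
rewrite addr0 big1 ?oppr0// => k _.
under eq_Rintegral => x _.
  rewrite (_ : dot _ _ = 0) ?mul0r; last first.
    rewrite /dot big1// => i _.
    rewrite mxE; case: (pdP i) => [[j _ ->]|[_ ->]]; last by rewrite mulr0.
    by rewrite derive_cst mulr0.
  over.
by rewrite /Rintegral integral0_eq.
Qed.

(** * Internal and total energy *)

(** The difference quotient converges relative to [I]; multiplied by y - x it tends to 0. *)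
Lemma C1_on_continuous_within (I : set R) (eps : R -> R) x : C1_on I eps -> I x ->
  eps y @[y --> within I (nbhs x)] --> eps x.
Proof.
move=> [/(_ x) dq _] Ix; have /cvg_ex[l ql] := dq Ix.
have xc : (y - x) @[y --> within (I `\ x) (nbhs x)] --> (0 : R).
  rewrite -(subrr x); apply: cvg_within_filter.
  by apply: cvgB; [exact: cvg_id|exact: cvg_cst].
have : (eps y - eps x) / (y - x) * (y - x) @[y --> within (I `\ x) (nbhs x)] --> l * 0.
  exact: cvgM ql xc.
rewrite mulr0 => H; apply/cvgrPdist_lt => e e0.
move/cvgrPdist_lt : H => /(_ e e0); rewrite !near_withinE; apply: filterS => y Hy Iy.
have [->|yx] := eqVneq y x; first by rewrite subrr normr0.
have := Hy (conj Iy (elimN eqP yx)); rewrite sub0r normrN divfK ?subr_eq0//.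
by rewrite distrC.
Qed.

(* [eps (clamp a b y)] is a continuous extension of [eps] outside of the segment
   from a to b. *)
Definition clamp (a b y : R) : R := Num.max a (Num.min b y).

Lemma clamp_id a b y : a <= y <= b -> clamp a b y = y.
Proof. by move=> /andP[ay yb]; rewrite /clamp (min_idPr yb) (max_idPr ay). Qed.

Lemma clamp_itv a b y : a <= b -> a <= clamp a b y <= b.
Proof. by move=> ab; rewrite /clamp le_max lexx /= ge_max ab ge_min lexx. Qed.

Lemma continuous_clamp a b : continuous (clamp a b).
Proof.
move=> y; apply: (@continuous_max R R (fun=> a) (fun z => Num.min b z) y); first exact: cvg_cst.
by apply: (@continuous_min R R (fun=> b) id y); [exact: cvg_cst|exact: cvg_id].
Qed.

Lemma continuous_comp_clamp (I : interval R) (eps : R -> R) a b : C1_on [set` I] eps ->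
  a \in I -> b \in I -> a <= b -> continuous (fun y => eps (clamp a b y)).
Proof.
move=> epsC aI bI ab.
have cI y : [set` I] (clamp a b y).
  by have /andP[h1 h2] := clamp_itv y ab; apply: (interval_is_interval aI bI); rewrite h1 h2.
move=> x; apply/(@cvgrPdist_lt _ R) => e e0.
have /cvgrPdist_lt/(_ e e0) := C1_on_continuous_within epsC (cI x).
rewrite near_withinE => Hn.
have H : \forall y \near x, [set` I] (clamp a b y) -> `|eps (clamp a b x) - eps (clamp a b y)| < e.
  exact: (@continuous_clamp a b x _ Hn).
by near=> y; have : [set` I] (clamp a b y) := cI y; near: y; exact: H.
Unshelve. all: by end_near. 
Qed.

Lemma trace_on_smooth k f p x : smooth p -> (forall y, open_simplex (T k) y -> f y = p y) ->
  closed_simplex (T k) x -> trace_on (T k) f x = p x.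
Proof.
move=> sp fp kx; have PF := within_open_simplex_proper (ndT k) kx.
apply: cvg_lim; first exact: Rhausdorff.
apply: (@cvg_trans _ (p y @[y --> within (open_simplex (T k)) (nbhs x)])).
  apply: near_eq_cvg; rewrite near_withinE; near=> y => ky.
  by rewrite fp.
by apply: cvg_within_filter; exact: smooth_continuous.
Unshelve. all: by end_near. Qed.

(** Outside of [I] the function [eps] may be arbitrary. The smooth representative of [f] attains its
    minimum and maximum on each closed simplex, both in [I]; clamping between them replaces [eps] by
    a continuous function of the line without changing the composite. *)
Lemma bdd_comp (I : interval R) (eps : R -> R) f : C1_on [set` I] eps -> pws f ->
  (forall k x, closed_simplex (T k) x -> trace_on (T k) f x \in I) ->
  bdd D (fun x => eps (f x)).
Proof.
move=> epsC /pws_rep[P sP fP] fI; have cP k := smooth_continuous (sP k).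
have PI k x : closed_simplex (T k) x -> P k x \in I.
  by move=> kx; rewrite -(trace_on_smooth (sP k) (fP k) kx); exact: fI.
have H k : exists q : sfield R d, continuous q /\
    forall x, open_simplex (T k) x -> eps (f x) = q x.
  have ne : closed_simplex (T k) !=set0.
    exists (T k ord0); rewrite closed_simplexE//= => i.
    by rewrite bary_vertex.
  have cw : {within closed_simplex (T k), continuous (P k)} by exact: continuous_subspaceT.
  have [a /set_mem ka aP] := EVT_min_rV ne (compact_closed_simplex (ndT k)) cw.
  have [b /set_mem kb bP] := EVT_max_rV ne (compact_closed_simplex (ndT k)) cw.
  have ab : P k a <= P k b by apply: aP; rewrite inE.
  exists (fun x => eps (clamp (P k a) (P k b) (P k x))); split; last first.
    move=> x kx; rewrite (fP k x kx) clamp_id//.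
    have kx' : x \in closed_simplex (T k) by rewrite inE; exact: open_simplex_sub.
    by rewrite aP ?bP.
  have ce := continuous_comp_clamp epsC (PI k a ka) (PI k b kb) ab.
  by move=> x; exact: (continuous_comp (cP k x) (ce (P k x))).
have /choice[Q QP] := H; have cQ k := (QP k).1.
split.
  apply: (@eq_measurable_fun _ _ _ _ D (glue Q)); last exact: measurable_glue.
  by move=> x /set_mem[k _ kx]; rewrite (glueE _ kx) (QP k).2.
have /choice[M MP] k : exists M, forall x, D x -> `|Q k x| <= M.
  by have [M _ MP] := continuous_bounded_on (cQ k) bounded_mesh; exists M.
exists (\sum_k `|M k|) => x Dx; have [k _ kx] := Dx; rewrite (QP k).2//.
apply: le_trans (MP k x Dx) _; apply: le_trans (ler_norm _) _.
by rewrite (bigD1 k)//= lerDl sumr_ge0.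
Qed.

Lemma bdd_dot (u v : vfield R d) : vpws u -> vpws v -> bdd D (fun x => dot (u x) (v x)).
Proof.
move=> pu pv; apply: bdd_sum => // i _; apply: bdd_mul.
  exact: (pws_bdd (pu i)).
exact: (pws_bdd (pv i)).
Qed.

Lemma derive_square_line (a b : R) : derive1 (fun t : R => (1 + t) ^+ 2 * a - b) 0 = 2 * a.
Proof.
rewrite derive1E; apply: derive_val; apply: is_derive_eq.
by rewrite /GRing.scale /=; clear; ring.
Qed.

(** Along $u+tu$ the Lagrangian is $(1+t)^2$ times the kinetic energy minus terms independent of t,
    so the functional derivative paired with [u] is twice the kinetic energy. *)
Lemma energyE (eps : R -> R) (u B : vfield R d) rho : vpws u -> vpws B -> pws rho ->
  bdd D (fun x => eps (rho x)) ->
  energy Omega eps u rho B =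
  \int[mu]_(x in Omega) (2^-1 * rho x * dot (u x) (u x) + eps (rho x) + 2^-1 * dot (B x) (B x)).
Proof.
move=> pu pB pr be.
have bu := bdd_dot pu pu; have bB := bdd_dot pB pB; have br := pws_bdd pr.
pose f x := 2^-1 * rho x * dot (u x) (u x).
pose g x := eps (rho x) + 2^-1 * dot (B x) (B x).
have fi : integ D f.
  apply: bdd_integ => //; apply: bdd_mul => //; apply: bdd_mul => //; exact: bdd_const.
have gi : integ D g.
  by apply: bdd_integ => //; apply: bdd_add => //; apply: bdd_mul => //; exact: bdd_const.
have E : (fun t : R => ell Omega eps (fun x => u x + t *: u x) rho B) =
    fun t => (1 + t) ^+ 2 * (\int[mu]_(x in D) f x) - \int[mu]_(x in D) g x.
  apply/funext => t; rewrite /ell Rintegral_Omega -RintegralZl// -RintegralB//.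
    apply: eq_Rintegral => x _.
    rewrite -[X in X + t *: _]scale1r -scalerDl dotZl dotC dotZl /f /g.
    by move: (dot (u x) _) (dot (B x) _) (eps (rho x)) (rho x) => *; clear; ring.
  exact: integ_scale.
have E0 : ell Omega eps u rho B = (\int[mu]_(x in D) f x) - \int[mu]_(x in D) g x.
  have := congr1 (@^~ 0) E => /=; rewrite addr0 expr1n mul1r => <-.
  by congr ell; apply/funext => x; rewrite scale0r addr0.
rewrite /energy /dell_du E E0 Rintegral_Omega.
rewrite derive_square_line.
transitivity ((\int[mu]_(x in D) f x) + \int[mu]_(x in D) g x).
  by move: (Rintegral _ _ f) (Rintegral _ _ g) => y z; clear; ring.
by rewrite -RintegralD//; apply: eq_Rintegral => x _; rewrite addrA.
Qed.

Lemma half_closed (V : set (vfield R d)) u v :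
  (forall a u v, V u -> V v -> V (fun x => a *: u x + v x)) ->
  V u -> V v -> V (fun x => 2^-1 *: (u x + v x)).
Proof.
move=> Vlin Vu Vv; have Vs := Vlin 1 _ _ Vu Vv.
have := Vlin (2^-1 - 1) _ _ Vs Vs; congr V; apply/funext => x.
by rewrite scale1r scalerBl scale1r subrK.
Qed.

Lemma vip_half u v w : vL2 Omega u -> vL2 Omega v -> vL2 Omega w ->
  vip Omega (fun x => 2^-1 *: (u x + v x)) w = 2^-1 * (vip Omega u w + vip Omega v w).
Proof.
by move=> uL vL wL; rewrite vip_scalel// ?vip_addl//; exact: vL2_add.
Qed.

Lemma a_form_diag w u : a_form Omega w u u = 0.
Proof.
rewrite /a_form vipC (_ : bracket Omega u u = fun=> 0) ?vip_zerol ?oppr0//.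
by apply/funext => x; apply/rowP => i; rewrite !mxE subrr.
Qed.

Lemma dot_cross (a b c : 'rV[R]_3) : dot (cross a b) c = dot (cross c a) b.
Proof.
rewrite /dot !sum3 !mxE.
rewrite !ord3_add.
by move: (a 0 0) (a 0 1) (a 0 _) (b 0 0) (b 0 1) (b 0 _) (c 0 0) (c 0 1) (c 0 _); clear=> *; ring.
Qed.

Lemma dot_cross_diag (a b : 'rV[R]_3) : dot (cross a b) b = 0.
Proof.
have : dot (cross a b) b = - dot (cross a b) b.
  by rewrite {1}dot_cross; rewrite [in RHS]/dot -sumrN; apply: eq_bigr => i _; rewrite !mxE; clear; ring.
by move=> ?; lra.
Qed.

Lemma crossC (a b : 'rV[R]_3) : cross a b = - cross b a.
Proof. by apply/rowP => i; rewrite !mxE; clear; ring. Qed.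

(** In the helicity balance, a and b are the new and the old helicity, and c is the common value of
    the mixed pairings $\langle A_k,B_{k+1}\rangle$ and $\langle A_{k+1},B_k\rangle$, which
    cancels. *)
Lemma halves_increment (t a b c : R) :
  t * (a - b) = 2 * (t * (2^-1 * (c + a) - 2^-1 * (b + c))).
Proof. by field. Qed.

(** * The conservation laws *)

Section step.
Variables (r s : nat) (dt nu : R).
Hypothesis dt_gt0 : 0 < dt.
Variables (u0 u1 B0 B1 J H U E alpha : vfield R d).
Hypotheses (UB0 : U_div Omega T r B0) (UB1 : U_div Omega T r B1).
Hypotheses (UJ : U_curl Omega T r J) (UH : U_curl Omega T r H) (UU : U_curl Omega T r U).
Hypotheses (UE : U_curl Omega T r E) (Ualpha : U_curl Omega T r alpha).
Let Bh : vfield R d := fun x => 2^-1 *: (B0 x + B1 x).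
Hypothesis eqB : forall C, U_div Omega T r C ->
  vip Omega (fun x => dt^-1 *: (B1 x - B0 x)) C + vip Omega (wcurl Omega E) C =
  - nu * vip Omega (wcurl Omega J) C.
Hypothesis eqJ : forall K, U_curl Omega T r K -> vip Omega J K = vip Omega Bh (wcurl Omega K).
Hypothesis eqH : forall G, U_curl Omega T r G -> vip Omega H G = vip Omega Bh G.
Hypothesis eqE : forall F, U_curl Omega T r F ->
  vip Omega E F = - vip Omega (fun x => cross (U x) (H x)) F.

Let UBh : U_div Omega T r Bh.
Proof. by apply: half_closed => // *; exact: U_div_lin. Qed.

Let B0L := U_div_vL2 UB0.
Let B1L := U_div_vL2 UB1.

Lemma wcurl_div u w C : U_curl Omega T r u -> trace_curl (axial u) w -> U_div Omega T r C ->
  vip Omega (wcurl Omega u) C = vip Omega w C.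
Proof.
move=> Uu tw UC; apply: (U_curl_wcurl_div Uu tw); first exact: vpp_vpws (U_div_vpp UC).
by move=> d2 x Dx; exact: U_div_planar UC Dx.
Qed.

Lemma vip_increment F : vL2 Omega F ->
  vip Omega (fun x => dt^-1 *: (B1 x - B0 x)) F = dt^-1 * (vip Omega B1 F - vip Omega B0 F).
Proof.
move=> FL; rewrite vip_scalel ?vip_subl//.
have := vL2_add mO B1L (vL2_scale mO (-1) B0L).
by congr vL2; apply/funext => x; rewrite scaleN1r.
Qed.

(** The residual [C] of the induction equation lies in [U_div], so [eqB] makes it orthogonal to
    itself and hence null. The equation may then be tested with fields outside of [U_div]: gradients
    for the divergence, $A_{k+1/2}$ for the helicity. *)
Lemma induction_equation wE wJ F : U_div Omega T r wE -> U_div Omega T r wJ ->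
  trace_curl (axial E) wE -> trace_curl (axial J) wJ -> vL2 Omega F ->
  dt^-1 * (vip Omega B1 F - vip Omega B0 F) + vip Omega wE F + nu * vip Omega wJ F = 0.
Proof.
move=> UwE UwJ tE tJ FL; have wEL := U_div_vL2 UwE; have wJL := U_div_vL2 UwJ.
pose dB : vfield R d := fun x => -1 *: B0 x + B1 x.
have UdB : U_div Omega T r dB by exact: U_div_lin.
have [C UC CE] : exists2 C, U_div Omega T r C & forall G, vL2 Omega G -> vip Omega C G =
    dt^-1 * (vip Omega B1 G - vip Omega B0 G) + vip Omega wE G + nu * vip Omega wJ G.
  exists (fun x => dt^-1 *: dB x + (nu *: wJ x + wE x)).
    by apply: U_div_lin => //; exact: U_div_lin.
  move=> G GL; rewrite vip_linl//; [|exact: U_div_vL2 UdB|exact: U_div_vL2 (U_div_lin nu UwJ UwE)].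
  rewrite !vip_linl// mulN1r; move: (vip _ _ _) (vip _ _ _) (vip _ _ _) (vip _ _ _); clear=> *; ring.
have CL := U_div_vL2 UC; rewrite -CE//; apply: vip_null => //; rewrite CE//.
have e1 := vip_increment CL; have e2 := wcurl_div UE tE UC; have e3 := wcurl_div UJ tJ UC.
have := eqB UC; rewrite e1 e2 e3 => ->.
by rewrite mulNr addNr.
Qed.

Lemma step_weak_div : weak_div Omega B0 (fun=> 0) -> weak_div Omega B1 (fun=> 0).
Proof.
move=> [L0 dB0]; split => // phi tphi; have := dB0 _ tphi.
have [wE [UwE [_ dE] tE]] := U_curl_curl UE; have [wJ [UwJ [_ dJ] tJ]] := U_curl_curl UJ.
have gL : vL2 Omega (grad phi).
  by apply: vsmooth_vL2; apply: smooth_grad; case: tphi.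
have /eqP := induction_equation UwE UwJ tE tJ gL.
have := dE _ tphi; have := dJ _ tphi.
have -> : ip Omega (fun=> 0) phi = 0 by rewrite ipC; exact: ip_zeror.
move=> /eqP; rewrite eq_sym oppr_eq0 => /eqP ->; move=> /eqP; rewrite eq_sym oppr_eq0 => /eqP ->.
rewrite mulr0 !addr0 => H1 /eqP; rewrite eq_sym oppr_eq0 => /eqP H0.
by move: H1; rewrite H0 subr0 mulf_eq0 invr_eq0 gt_eqF//= => /eqP ->; rewrite oppr0.
Qed.

(** [J] plays the part of the discrete curl of $B_{k+1/2}$: the identity of [curl_h] for [Bh], then
    [eqJ], then the identity of [curl_h] for [C] move the curl onto [J]. *)
Lemma e_formE C : U_div Omega T r C ->
  e_form Omega T r nu Bh C = - nu * vip Omega (wcurl Omega J) C.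
Proof.
move=> UC; have exC : exists w, U_curl Omega T r w by exists J.
have [_ hB] := curl_hP exC UBh; have [UcC hC] := curl_hP exC UC.
by rewrite /e_form hB// -eqJ// vipC hC// vipC.
Qed.

(** [H0curl] provides the trace condition for some weak curl; since smooth fields are piecewise
    smooth, density transfers it to the prescribed one. *)
Lemma trace_curl_of A w : H0curl Omega A -> weak_curl Omega A w -> trace_curl A w.
Proof.
move=> /H0curl_has_curl[w' [AL Aw' tr]] Aw; split => // Phi sPhi.
rewrite tr// !vip_Omega; apply: (curl_dense Aw' Aw); exact: vsmooth_vpws.
Qed.

Lemma step_helicity A0 A1 : H0curl Omega A0 -> weak_curl Omega A0 B0 ->
  H0curl Omega A1 -> weak_curl Omega A1 B1 ->
  dt^-1 * (vip Omega A1 B1 - vip Omega A0 B0) =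
  2 * e_form Omega T r nu Bh (pi_div Omega T r (fun x => 2^-1 *: (A0 x + A1 x))).
Proof.
move=> h0 /(trace_curl_of h0) t0 h1 /(trace_curl_of h1) t1.
have [A0L _ _] := t0; have [A1L _ _] := t1.
pose Ah : vfield R d := fun x => 2^-1 *: (A0 x + A1 x).
have tAh : trace_curl Ah Bh by exact: trace_curl_scale (trace_curl_add t0 t1).
have [AhL _ _] := tAh.
have [wE [UwE _ tE]] := U_curl_curl UE; have [wJ [UwJ _ tJ]] := U_curl_curl UJ.
have pws_of C : U_div Omega T r C -> vpws C by move=> UC; exact: vpp_vpws (U_div_vpp UC).
have exC : exists w, U_div Omega T r w by exists B0.
have [UpA pA] := pi_divP exC AhL.
(* Symmetry of the curl for $A_{k+1}$ and $A_k$, whose curls are piecewise polynomial. *)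
have sym : vip Omega A1 B0 = vip Omega A0 B1.
  rewrite !vip_Omega [RHS]vipC.
  exact: (trace_curl_symmetric t1 t0 (pws_of _ UB1) (pws_of _ UB0)).
have AhwE : vip Omega wE Ah = 0.
  rewrite vip_Omega vipC (trace_curl_symmetric tAh tE (pws_of _ UBh) (pws_of _ UwE)) -vip_Omega.
  (* For d = 2 the orthogonal field [axial E] and the planar field $B_{k+1/2}$ have zero product at
     each point; for d = 3 the pairing is $\langle H,E\rangle=-\langle U\times H,H\rangle$. *)
  rewrite /axial; case: eqVneq => [d2|_].
    rewrite vip_orthr ip_Omega /ip.
    under eq_Rintegral => x /set_mem Dx do rewrite [vcomp _ Bh x](U_div_planar d2 UBh Dx) mul0r.
    by rewrite Rintegral_cst ?mul0r//.
  rewrite -eqH// vipC eqE// /vip; under eq_Rintegral do rewrite dot_cross_diag.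
  by rewrite Rintegral_cst ?mul0r ?oppr0.
have FE := induction_equation UwE UwJ tE tJ AhL.
(* The projection disappears because [wJ] belongs to [U_div]. *)
have hE : e_form Omega T r nu Bh (pi_div Omega T r Ah) = - nu * vip Omega wJ Ah.
  by rewrite e_formE// (wcurl_div UJ tJ UpA) vipC pA// vipC.
rewrite -/Ah hE; move: FE; rewrite AhwE addr0.
have AhE w : vL2 Omega w -> vip Omega w Ah = 2^-1 * (vip Omega A0 w + vip Omega A1 w).
  by move=> wL; rewrite vipC vip_half.
rewrite (AhE B1)// (AhE B0)// sym => /eqP; rewrite addr_eq0 => /eqP FE.
by rewrite mulNr -FE; exact: halves_increment.
Qed.

Variables (rho0 rho1 theta : sfield R d) (eps : R -> R) (I : interval R) (visc lambda : R).
Let uh : vfield R d := fun x => 2^-1 *: (u0 x + u1 x).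
Let rhoh : sfield R d := fun x => (rho0 x + rho1 x) / 2.
Let rhouh : vfield R d := fun x => 2^-1 *: (rho0 x *: u0 x + rho1 x *: u1 x).
Hypotheses (Uu0 : U_grad Omega T r u0) (Uu1 : U_grad Omega T r u1).
Hypotheses (Frho0 : F_dg Omega T s rho0) (Frho1 : F_dg Omega T s rho1).
Hypothesis Ftheta : F_dg Omega T s theta.
Hypothesis epsC : C1_on [set` I] eps.
Hypothesis rho0I : forall k x, closed_simplex (T k) x -> trace_on (T k) rho0 x \in I.
Hypothesis rho1I : forall k x, closed_simplex (T k) x -> trace_on (T k) rho1 x \in I.
Hypothesis equ : forall v, U_grad Omega T r v ->
  vip Omega (fun x => dt^-1 *: (rho1 x *: u1 x - rho0 x *: u0 x)) v
  + a_form Omega rhouh uh v + b_form T theta rhoh v + vip Omega alpha v =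
  d_form Omega visc lambda uh v.
Hypothesis eqrho : forall sigma, F_dg Omega T s sigma ->
  ip Omega (fun x => (rho1 x - rho0 x) / dt) sigma + b_form T sigma rhoh uh = 0.
Hypothesis eqtheta : forall tau, F_dg Omega T s tau ->
  ip Omega theta tau = ip Omega (fun x => 2^-1 * dot (u0 x) (u1 x)
                               - delta [set` I] eps (rho0 x) (rho1 x)) tau.
Hypothesis eqU : forall V, U_curl Omega T r V -> vip Omega U V = vip Omega uh V.
Hypothesis eqalpha : forall beta, U_curl Omega T r beta ->
  vip Omega alpha beta = - vip Omega (fun x => cross (J x) (H x)) beta.

Lemma step_mass : \int[mu]_(x in Omega) rho1 x = \int[mu]_(x in Omega) rho0 x.
Proof.
have F1 : F_dg Omega T s (fun=> 1).
  split; first by apply: smooth_L2; exact: smooth_const.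
  by move=> k; exists (fun=> 1) => //; exact: poly_fun_const.
have := eqrho F1; rewrite b_form_cst addr0 /ip => E1.
have [r0L _] := Frho0; have [r1L _] := Frho1.
have r0i : integ Omega rho0 by exact: L2_integ.
have r1i : integ Omega rho1 by exact: L2_integ.
have := E1; rewrite (_ : (fun x => _) = fun x => dt^-1 * (rho1 x - rho0 x)); last first.
  by apply/funext => x; rewrite mulr1 mulrC.
rewrite RintegralZl//; last exact: integ_sub.
by move/eqP; rewrite mulf_eq0 invr_eq0 gt_eqF//= RintegralB// subr_eq0 => /eqP.
Qed.

(** The exact chain rule for the internal energy; at x = y both sides are zero. *)
Lemma deltaE x y : delta [set` I] eps x y * (y - x) = eps y - eps x.
Proof.
rewrite /delta; case: eqVneq => [->|xy]; first by rewrite !subrr mulr0.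
by rewrite divfK// subr_eq0 eq_sym.
Qed.

Let vpws_curl u : U_curl Omega T r u -> vpws u.
Proof. by move=> /U_curl_vpp/vpp_vpws. Qed.

(** Both sides are the integral of the mixed product of J, H and U up to sign: [eqU] and [eqalpha]
    express the left one, [eqE] the right one. The work of the Lorentz force thus matches a term of
    the induction equation. *)
Lemma vip_alpha_uh : vip Omega alpha uh = - vip Omega J E.
Proof.
rewrite vipC -eqU// vipC eqalpha// [vip Omega J E]vipC eqE// opprK.
rewrite !vip_Omega /vip -[LHS]mulN1r -RintegralZl//; last first.
  apply: bdd_integ => //; apply: bdd_sum => // i _; apply: bdd_mul; last exact: pws_bdd (vpws_curl UU i).
  rewrite (_ : (fun x => _) = fun x => vcomp (i + 1) J x * vcomp (i + 2%:R) H x -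
     vcomp (i + 2%:R) J x * vcomp (i + 1) H x); last by apply/funext => x; rewrite mxE.
  by apply: bdd_sub => //; apply: bdd_mul; apply: pws_bdd; exact: vpws_curl.
apply: eq_Rintegral => x _; rewrite dot_cross [RHS]dot_cross crossC.
by rewrite -[- cross _ _]scaleN1r dotZl mulrA mulN1r opprK mul1r.
Qed.

Lemma step_energy :
  (energy Omega eps u1 rho1 B1 - energy Omega eps u0 rho0 B0) / dt =
  d_form Omega visc lambda uh uh + e_form Omega T r nu Bh Bh.
Proof.
have pu0 := vpp_vpws (U_grad_vpp Uu0); have pu1 := vpp_vpws (U_grad_vpp Uu1).
have pB0 := vpp_vpws (U_div_vpp UB0); have pB1 := vpp_vpws (U_div_vpp UB1).
have pr0 := F_dg_pws Frho0; have pr1 := F_dg_pws Frho1.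
have be0 := bdd_comp epsC pr0 rho0I; have be1 := bdd_comp epsC pr1 rho1I.
have Uuh : U_grad Omega T r uh by apply: half_closed => // *; exact: U_grad_lin.
pose tau x := (rho1 x - rho0 x) / dt.
have Ftau : F_dg Omega T s tau.
  have := F_dg_lin dt^-1 (F_dg_lin (-1) Frho0 Frho1) (F_dg_lin (-1) Frho0 Frho0).
  by congr F_dg; apply/funext => x; rewrite /tau !mulN1r addNr addr0 addrC mulrC.
have br0 := pws_bdd pr0; have br1 := pws_bdd pr1.
have b00 := bdd_dot pu0 pu0; have b01 := bdd_dot pu0 pu1; have b11 := bdd_dot pu1 pu1.
have c00 := bdd_dot pB0 pB0; have c11 := bdd_dot pB1 pB1.
have momentum : vip Omega (fun x => dt^-1 *: (rho1 x *: u1 x - rho0 x *: u0 x)) uh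
    + b_form T theta rhoh uh - vip Omega J E = d_form Omega visc lambda uh uh.
  by have := equ Uuh; rewrite a_form_diag addr0 vip_alpha_uh.
have mass := eqrho Ftheta.
have enthalpy := eqtheta Ftau.
have induction := eqB UBh.
(* By [eqJ] with K = E, the curl of [E] paired with $B_{k+1/2}$ is $\langle J,E\rangle$, which
   cancels the Lorentz term in [momentum]. *)
have -> : e_form Omega T r nu Bh Bh =
    vip Omega (fun x => dt^-1 *: (B1 x - B0 x)) Bh + vip Omega J E.
  by rewrite (e_formE UBh) -induction [vip Omega (wcurl Omega E) _]vipC -eqJ.
rewrite -momentum; have b_theta : b_form T theta rhoh uh = - ip Omega theta tau.
  by apply/eqP; rewrite -addr_eq0 addrC ipC; exact/eqP.
rewrite b_theta enthalpy.
transitivity (vip Omega (fun x => dt^-1 *: (rho1 x *: u1 x - rho0 x *: u0 x)) uh -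
  ip Omega (fun x => 2^-1 * dot (u0 x) (u1 x) - delta [set` I] eps (rho0 x) (rho1 x)) tau +
  vip Omega (fun x => dt^-1 *: (B1 x - B0 x)) Bh); last first.
  by move: (vip _ _ _) (ip _ _ _) (vip _ _ _) (vip _ _ _); clear=> *; ring.
(* X - Y + Z is the increment of the energy density divided by dt. Besides the kinetic energies, X
   contains $\frac12(\rho_{k+1}-\rho_k)\,u_k\cdot u_{k+1}/\Delta t$, which is the first term of
   Y. *)
pose X x := dt^-1 * 2^-1 * ((rho1 x * dot (u1 x) (u1 x) + rho1 x * dot (u0 x) (u1 x)) -
   (rho0 x * dot (u0 x) (u1 x) + rho0 x * dot (u0 x) (u0 x))).
pose Y x := 2^-1 * dot (u0 x) (u1 x) * tau x - dt^-1 * (eps (rho1 x) - eps (rho0 x)).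
pose Z x := dt^-1 * 2^-1 * (dot (B1 x) (B1 x) - dot (B0 x) (B0 x)).
have bX : bdd D X := bdd_mul (bdd_const D (dt^-1 * 2^-1))
  (bdd_sub (bdd_add (bdd_mul br1 b11) (bdd_mul br1 b01)) (bdd_add (bdd_mul br0 b01) (bdd_mul br0 b00))).
have btau : bdd D tau := bdd_mul (bdd_sub br1 br0) (bdd_const D dt^-1).
have bY : bdd D Y := bdd_sub (bdd_mul (bdd_mul (bdd_const D 2^-1) b01) btau)
  (bdd_mul (bdd_const D dt^-1) (bdd_sub be1 be0)).
have bZ : bdd D Z := bdd_mul (bdd_const D (dt^-1 * 2^-1)) (bdd_sub c11 c00).
have bE0 := bdd_add (bdd_add (bdd_mul (bdd_mul (bdd_const D 2^-1) br0) b00) be0) (bdd_mul (bdd_const D 2^-1) c00).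
have bE1 := bdd_add (bdd_add (bdd_mul (bdd_mul (bdd_const D 2^-1) br1) b11) be1) (bdd_mul (bdd_const D 2^-1) c11).
have EX : vip Omega (fun x => dt^-1 *: (rho1 x *: u1 x - rho0 x *: u0 x)) uh = \int[mu]_(x in D) X x.
  rewrite vip_Omega /vip; apply: eq_Rintegral => x _; rewrite dotZl /uh dotC dotZl dotDl !(dotC _ (_ - _)) !dotDl.
  rewrite -!scaleNr !dotZl (dotC (u1 x) (u0 x)) /X.
  by move: (dot _ _) (dot _ _) (dot _ _) (rho0 x) (rho1 x) dt^-1; clear=> *; ring.
have EY : ip Omega (fun x => 2^-1 * dot (u0 x) (u1 x) - delta [set` I] eps (rho0 x) (rho1 x)) tau =
    \int[mu]_(x in D) Y x.
  rewrite ip_Omega /ip; apply: eq_Rintegral => x _; rewrite mulrBl /Y; congr (_ - _).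
  by rewrite /tau mulrA deltaE mulrC.
have EZ : vip Omega (fun x => dt^-1 *: (B1 x - B0 x)) Bh = \int[mu]_(x in D) Z x.
  rewrite vip_Omega /vip; apply: eq_Rintegral => x _; rewrite dotZl /Bh dotC dotZl dotDl !(dotC _ (_ - _)) !dotDl.
  rewrite -scaleN1r !dotZl (dotC (B1 x) (B0 x)) /Z.
  by move: (dot _ _) (dot _ _) (dot _ _) dt^-1; clear=> *; ring.
have EN0 := energyE pu0 pB0 pr0 be0; have EN1 := energyE pu1 pB1 pr1 be1.
rewrite EX EY EZ EN0 EN1 (Rintegral_Omega (fun x => _ + _)) [X in (_ - X) / _]Rintegral_Omega.
have toi f : bdd D f -> integ D f := @bdd_integ _ _ _ mD finD f.
rewrite -(RintegralB mD (toi _ bX) (toi _ bY)).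
rewrite -(RintegralD mD (integ_sub mD (toi _ bX) (toi _ bY)) (toi _ bZ)).
rewrite -(RintegralB mD (toi _ bE1) (toi _ bE0)) mulrC.
rewrite -(RintegralZl dt^-1 mD (integ_sub mD (toi _ bE1) (toi _ bE0))).
apply: eq_Rintegral => x _; rewrite /X /Y /Z /tau.
by move: (dot _ _) (dot _ _) (dot _ _) (dot _ _) (dot _ _) (eps (rho0 x)) (eps (rho1 x))
  (rho0 x) (rho1 x) dt^-1; clear=> *; ring.
Qed.

End step.

End mesh.

Theorem proposition4p1 (R : realType) (d : nat) (Hd : d = 2%N \/ d = 3%N)
  (Omega : set 'rV[R]_d) (HOmega : bounded_domain Omega)
  (N : nat) (T : 'I_N -> 'I_d.+1 -> 'rV[R]_d) (HT : triangulation Omega T)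
  (r s : nat) (mu lambda nu dt : R)
  (Hmu : 0 < mu) (Hlambda : 0 <= 2 * mu + 3 * lambda) (Hnu : 0 < nu)
  (Hdt : 0 < dt)
  (I : interval R) (HI : exists a b, [/\ a \in I, b \in I & a < b])
  (eps : R -> R) (Heps : C1_on [set` I] eps)
  (u : nat -> 'rV[R]_d -> 'rV[R]_3) (rho : nat -> 'rV[R]_d -> R)
  (B : nat -> 'rV[R]_d -> 'rV[R]_3)
  (Hu : forall k, U_grad Omega T r (u k))
  (Hrho : forall k, F_dg Omega T s (rho k))
  (HB : forall k, U_div Omega T r (B k))
  (HrhoI : forall k l x, closed_simplex (T l) x -> trace_on (T l) (rho k) x \in I)
  (Hscheme : forall k,
    let uh := fun x => 2^-1 *: (u k x + u k.+1 x) in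
    let rhoh := fun x => (rho k x + rho k.+1 x) / 2 in
    let Bh := fun x => 2^-1 *: (B k x + B k.+1 x) in
    let rhouh := fun x => 2^-1 *: (rho k x *: u k x + rho k.+1 x *: u k.+1 x) in
    exists theta J H U E alpha,
      ([/\ F_dg Omega T s theta, U_curl Omega T r J & U_curl Omega T r H] /\
       [/\ U_curl Omega T r U, U_curl Omega T r E & U_curl Omega T r alpha]) /\
      [/\ forall v, U_grad Omega T r v ->
            vip Omega (fun x => dt^-1 *:
              (rho k.+1 x *: u k.+1 x - rho k x *: u k x)) v
            + a_form Omega rhouh uh v + b_form T theta rhoh v
            + vip Omega alpha v = d_form Omega mu lambda uh v,
          forall sigma, F_dg Omega T s sigma ->
            ip Omega (fun x => (rho k.+1 x - rho k x) / dt) sigma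
            + b_form T sigma rhoh uh = 0,
          forall C, U_div Omega T r C ->
            vip Omega (fun x => dt^-1 *: (B k.+1 x - B k x)) C
            + vip Omega (wcurl Omega E) C = - nu * vip Omega (wcurl Omega J) C &
          forall tau, F_dg Omega T s tau ->
            ip Omega theta tau =
            ip Omega (fun x => 2^-1 * dot (u k x) (u k.+1 x)
                               - delta [set` I] eps (rho k x) (rho k.+1 x)) tau]
      /\
      [/\ forall K, U_curl Omega T r K ->
            vip Omega J K = vip Omega Bh (wcurl Omega K),
          forall G, U_curl Omega T r G -> vip Omega H G = vip Omega Bh G,
          forall V, U_curl Omega T r V -> vip Omega U V = vip Omega uh V,
          forall F, U_curl Omega T r F ->
            vip Omega E F = - vip Omega (fun x => cross (U x) (H x)) F &
          forall beta, U_curl Omega T r beta ->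
            vip Omega alpha beta =
            - vip Omega (fun x => cross (J x) (H x)) beta])
  (HdivB0 : weak_div Omega (B 0%N) (fun=> 0)) :
  forall k,
    let uh := fun x => 2^-1 *: (u k x + u k.+1 x) in
    let Bh := fun x => 2^-1 *: (B k x + B k.+1 x) in
    [/\ weak_div Omega (B k) (fun=> 0),
        \int[lebesgue_rV R d]_(x in Omega) rho k.+1 x =
        \int[lebesgue_rV R d]_(x in Omega) rho k x,
        energy Omega eps (u k) (rho k) (B k) =
        \int[lebesgue_rV R d]_(x in Omega)
          (2^-1 * rho k x * dot (u k x) (u k x) + eps (rho k x)
           + 2^-1 * dot (B k x) (B k x)),
        (energy Omega eps (u k.+1) (rho k.+1) (B k.+1)
         - energy Omega eps (u k) (rho k) (B k)) / dt =
        d_form Omega mu lambda uh uh + e_form Omega T r nu Bh Bh &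
        forall A A' : 'rV[R]_d -> 'rV[R]_3,
          H0curl Omega A -> weak_curl Omega A (B k) ->
          H0curl Omega A' -> weak_curl Omega A' (B k.+1) ->
          dt^-1 * (vip Omega A' (B k.+1) - vip Omega A (B k)) =
          2 * e_form Omega T r nu Bh
                (pi_div Omega T r (fun x => 2^-1 *: (A x + A' x)))].
Proof.
have [ndT OmegaE disjT _] := HT.
have d_gt0 : (0 < d)%N by case: Hd => ->.
(* Only the divergence constraint is propagated by induction from the initial field; each other law
   follows from a single step. *)
have divB k : weak_div Omega (B k) (fun=> 0).
  elim: k => // k IH.
  have [theta [J [H [U [E [alpha [[[_ UJ UH] [UU UE _]] [[_ _ eqB _] _]]]]]]]] := Hscheme k.
  exact: (step_weak_div d_gt0 ndT disjT OmegaE Hd Hdt (HB k) (HB k.+1) UJ UE eqB).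
move=> k uh Bh.
have [theta [J [H [U [E [alpha [[[Ftheta UJ UH] [UU UE Ua]]
  [[equ eqrho eqB eqtheta] [eqJ eqH eqU eqE eqalpha]]]]]]]]] := Hscheme k.
split.
- exact: divB.
- exact: (step_mass d_gt0 ndT OmegaE Hdt (Hrho k) (Hrho k.+1) eqrho).
- apply: (energyE d_gt0 ndT disjT OmegaE).
  + exact: vpp_vpws (U_grad_vpp (Hu k)).
  + exact: vpp_vpws (U_div_vpp (HB k)).
  + exact: F_dg_pws (Hrho k).
  + exact: (bdd_comp ndT disjT Heps (F_dg_pws (Hrho k)) (HrhoI k)).
- exact: (step_energy d_gt0 ndT disjT OmegaE (HB k) (HB k.+1) UJ UH UU UE Ua eqB eqJ eqE
    (Hu k) (Hu k.+1) (Hrho k) (Hrho k.+1) Ftheta Heps (HrhoI k) (HrhoI k.+1)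
    equ eqrho eqtheta eqU eqalpha).
- move=> A A' hA cA hA' cA'.
  exact: (step_helicity d_gt0 ndT disjT OmegaE Hd (HB k) (HB k.+1) UJ UH UE eqB eqJ eqH eqE hA cA hA' cA').
Qed.
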